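(* Let $\mathcal X_{\mathcal P_0,R_0}$ be the symbolic dynamical system associated to $\mathcal P_0,R_0$ (defined in the context), with alphabet $\mathcal A_0=\{0,\dots,10\}$. There exist, for $1\le i\le 10$, lattices $\Gamma_i\subset\mathbb R^2$, alphabets $\mathcal A_i$, $\mathbb Z^2$-actions $R_i:\mathbb Z^2\times\mathbb R^2/\Gamma_i\to\mathbb R^2/\Gamma_i$ and topological partitions $\mathcal P_i$ of $\mathbb R^2/\Gamma_i$ indexed by letters of $\mathcal A_i$ such that: (i) There exists a $2$-dimensional morphism $\beta_0:\mathcal A_1\to\mathcal A_0^{*^2}$ with $\mathcal X_{\mathcal P_0,R_0}=\overline{\beta_0(\mathcal X_{\mathcal P_1,R_1})}^{\sigma}$. (ii) There exists a shear conjugacy $\beta_1:\mathcal X_{\mathcal P_2,R_2}\to\mathcal X_{\mathcal P_1,R_1}$ satisfying $\sigma^{M\boldsymbol k}\circ\beta_1=\beta_1\circ\sigma^{\boldsymbol k}$ for every $\boldsymbol k\in\mathbb Z^2$, where $M=\begin{pmatrix}1&1\\0&1\end{pmatrix}$. (iii) There exist $2$-dimensional morphisms $\beta_i:\mathcal A_{i+1}\to\mathcal A_i^{*^2}$ with $\mathcal X_{\mathcal P_i,R_i}=\overline{\beta_i(\mathcal X_{\mathcal P_{i+1},R_{i+1}})}^{\sigma}$ for each $i\in\{2,3,4,5,6,7\}$. (iv) The subshift $\mathcal X_{\mathcal P_8,R_8}$ is self-similar. More precisely, there exist $2$-dimensional morphisms $\beta_8:\mathcal A_9\to\mathcal A_8^{*^2}$,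 $\beta_9:\mathcal A_{10}\to\mathcal A_9^{*^2}$ and a bijection $\tau:\mathcal A_8\to\mathcal A_{10}$ with $\mathcal X_{\mathcal P_8,R_8}=\overline{\beta_8(\mathcal X_{\mathcal P_9,R_9})}^{\sigma}$, $\mathcal X_{\mathcal P_9,R_9}=\overline{\beta_9(\mathcal X_{\mathcal P_{10},R_{10}})}^{\sigma}$, $\mathcal X_{\mathcal P_{10},R_{10}}=\tau(\mathcal X_{\mathcal P_8,R_8})$, so that $\mathcal X_{\mathcal P_8,R_8}=\overline{\beta_8\beta_9\tau(\mathcal X_{\mathcal P_8,R_8})}^{\sigma}$, and the product $\beta_8\beta_9\tau$ is an expansive and primitive self-similarity. (v) The subshift $\mathcal X_{\mathcal P_8,R_8}$ is topologically conjugate to $\mathcal X_{\mathcal P_{\mathcal U},R_{\mathcal U}}$ (defined in the context): there exists a bijection $\zeta:\{0,\dots,18\}\to\mathcal A_8$ such that $\zeta(\mathcal X_{\mathcal P_{\mathcal U},R_{\mathcal U}})=\mathcal X_{\mathcal P_8,R_8}$.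
   Context: **Subshifts.** For a finite alphabet $\mathcal A$, $\mathcal A^{\mathbb Z^2}$ has the product topology and the shift $(\sigma^{\boldsymbol n}(x))_{\boldsymbol m}=x_{\boldsymbol m+\boldsymbol n}$. A subshift is a closed shift-invariant subset. For $X\subset\mathcal A^{\mathbb Z^2}$, $\overline X^{\sigma}=\bigcup_{\boldsymbol k\in\mathbb Z^2}\sigma^{\boldsymbol k}(X)$. A topological conjugacy is a homeomorphism commuting with the shifts. A shear conjugacy $\theta:X\to Y$ is a homeomorphism with $\sigma^{M\boldsymbol k}\circ\theta=\theta\circ\sigma^{\boldsymbol k}$ for all $\boldsymbol k$, where $M\in\mathrm{GL}_2(\mathbb Z)$ is a shear matrix. A bijection of alphabets acts letterwise on configurations. **Words and morphisms.** A $2$-dimensional word of shape $(n_1,n_2)\in\mathbb N^2$ is a map $\{0,\dots,n_1-1\}\times\{0,\dots,n_2-1\}\to\mathcal A$; $\mathcal A^{*^2}$ is the set of all such words. The concatenation $u\odot^iv$ in direction $\boldsymbol e_i$ ($v$ placed after $u$, i.e. to the right of $u$ if $i=1$, above $u$ if $i=2$) is defined when the shapes agree except possibly in coordinate $i$. A language $L\subseteq\mathcal A^{*^2}$ is factorial if it is closed under rectangular subwords. A $2$-dimensional morphism is a map $\omega:L\to\mathcal B^{*^2}$ on a factorial language $L$ such that whenever $u,v,u\odot^iv\in L$, $\omega(u)\odot^i\omega(v)$ is defined and equals $\omega(u\odot^iv)$. It is determined by the images of letters and is written $\mathcal A\to\mathcal B^{*^2}$ when $L$ is left unspecified (when applied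 to a subshift, $L$ contains its language). It extends to configurations all of whose finite subwords lie in $L$ by concatenating images of letters, with the lower-left corner of $\omega(x_{\boldsymbol 0})$ at the origin. A morphism $\omega:\mathcal A\to\mathcal A^{*^2}$ is expansive if for all $a\in\mathcal A$, $K\in\mathbb N$ there is $m$ with both coordinates of the shape of $\omega^m(a)$ greater than $K$; it is primitive if there is $m$ such that for all $a,b\in\mathcal A$, $b$ occurs in $\omega^m(a)$. A subshift $X\subseteq\mathcal A^{\mathbb Z^2}$ is self-similar if $X=\overline{\omega(X)}^{\sigma}$ for some expansive $2$-dimensional morphism $\omega:\mathcal A\to\mathcal A^{*^2}$, called a self-similarity of $X$. **Symbolic systems.** For a torus $\mathbf T=\mathbb R^2/\Gamma$, a topological partition is a finite collection $\mathcal P=\{P_a\}_{a\in\mathcal A}$ of disjoint open sets with $\mathbf T=\bigcup_a\overline{P_a}$. Given a $\mathbb Z^2$-action $R$ on $\mathbf T$, a pattern $w\in\mathcal A^S$ ($S\subset\mathbb Z^2$ finite) is allowed if $\bigcap_{\boldsymbol k\in S}R^{-\boldsymbol k}(P_{w_{\boldsymbol k}})\neq\varnothing$; $\mathcal X_{\mathcal P,R}\subseteq\mathcal A^{\mathbb Z^2}$ is the set of configurations all of whose finite patterns are allowed. **$\mathcal P_0,R_0$.** Let $\varphi=\frac{1+\sqrt5}2$, $s=\varphi^{-1}$, $t=\varphi^{-2}$, $u=\varphi^{-3}$, $\Gamma_0=\langle(\varphi,0),(1,\varphi+3)\rangle_{\mathbb Z}$, and $R_0^{\boldsymbol n}(\boldsymbol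 x)=\boldsymbol x+\boldsymbol n$ on $\mathbb R^2/\Gamma_0$. $\mathcal P_0$ is indexed by $\{0,\dots,10\}$; the atom of each index is the image in $\mathbb R^2/\Gamma_0$ of the union of the interiors of the following polygons (vertices in cyclic order) in the fundamental domain $[0,\varphi)\times[0,\varphi+3)$: - 0: $(0,0),(s,0),(s,1)$; $(s,0),(1,0),(1,1)$; $(1,0),(\varphi,0),(\varphi,1)$. - 1: $(0,0),(s,1),(0,1)$; $(s,0),(1,1),(s,1)$; $(1,0),(\varphi,1),(1,1)$. - 2: $(0,2),(s,\varphi+2),(0,\varphi+1)$. - 3: $(1,1),(\varphi,2),(\varphi,\varphi+2),(1,2)$. - 4: $(0,2),(1,\varphi+2),(1,\varphi+3)$. - 5: $(0,\varphi+1),(s,\varphi+2),(1,\varphi+3),(t,\varphi+2),(t,\varphi+3),(0,\varphi+2)$. - 6: $(0,\varphi+2),(t,\varphi+3),(0,\varphi+3)$; $(t,\varphi+2),(1,\varphi+3),(t,\varphi+3)$; $(1,\varphi+2),(\varphi,\varphi+3),(1,\varphi+3)$. - 7: $(0,1),(1,\varphi+2),(0,2)$; $(1,\varphi+1),(\varphi,\varphi+2),(\varphi,\varphi+3),(1,\varphi+2)$. - 8: $(s,1),(\varphi,\varphi+2),(s,2)$. - 9: $(0,1),(s,1),(s,2)$; $(s,1),(1,1),(1,2)$; $(1,1),(\varphi,1),(\varphi,2)$. - 10: $(0,1),(1,\varphi+1),(1,\varphi+2)$. **$\mathcal P_{\mathcal U},R_{\mathcal U}$.** $R_{\mathcal U}^{\boldsymbol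 n}(\boldsymbol x)=\boldsymbol x+\varphi^{-2}\boldsymbol n$ on $\mathbb T^2=\mathbb R^2/\mathbb Z^2$. $\mathcal P_{\mathcal U}$ is indexed by $\{0,\dots,18\}$; the atoms are the images in $\mathbb T^2$ of the interiors of the polygons in $[0,1]^2$ with vertices 0: $(s,s),(2t,s),(s,2t)$; 1: $(2t,s),(1,s),(1,1),(s,1),(s,2t)$; 2: $(u,s),(t,s),(0,1)$; 3: $(0,s),(u,s),(0,1)$; 4: $(s,s),(s,2t),(t,1)$; 5: $(s,2t),(s,1),(t,1)$; 6: $(t,s),(t,1),(0,1)$; 7: $(t,s),(s,s),(t,1)$; 8: $(s,0),(1,0),(s,t)$; 9: $(1,0),(1,t),(2t,s),(s,s)$; 10: $(1,t),(1,s),(2t,s)$; 11: $(s,t),(1,0),(s,s)$; 12: $(t,t),(t,s),(u,s)$; 13: $(s,0),(s,t),(t,s),(t,t)$; 14: $(t,0),(t,t),(u,s),(0,s)$; 15: $(t,0),(s,0),(t,t)$; 16: $(0,0),(t,0),(0,t)$; 17: $(t,0),(0,s),(0,t)$; 18: $(s,t),(s,s),(t,s)$. *)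

(* Defs.v *)
From HB Require Import structures.
From mathcomp Require Import all_boot all_order all_algebra.
From mathcomp Require Import all_classical all_reals all_analysis.

Set Implicit Arguments.
Unset Strict Implicit.
Unset Printing Implicit Defensive.

Import Order.TTheory GRing.Theory Num.Theory.
Import numFieldNormedType.Exports.

Local Open Scope classical_set_scope.
Local Open Scope ring_scope.
Local Open Scope quotient_scope.

Notation Z2 := (int * int)%type.

Definition mulZ2 (M : 'M[int]_2) (k : Z2) : Z2 :=
  (M 0 0 * k.1 + M 0 1 * k.2, M 1 0 * k.1 + M 1 1 * k.2).

Definition shear11 : 'M[int]_2 :=
  \matrix_(i, j) (if (i == 1) && (j == 0) then 0 else 1).

Definition config (A : finType) :=
  prod_topology (fun _ : Z2 => discrete_topology A).

Definition shift (A : finType) (n : Z2) (x : config A) : config A :=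
  fun m => x (m + n).

Definition is_subshift (A : finType) (X : set (config A)) :=
  closed X /\ forall k x, X x -> X (shift k x).

Definition shift_closure (A : finType) (X : set (config A)) : set (config A) :=
  \bigcup_(k in [set: Z2]) (shift k @` X).

Definition letterwise (A B : finType) (f : A -> B) (x : config A) : config B :=
  fun m => f (x m).

(* Only the values of [f] on [X] matter. *)
Definition homeomorphism_between (T U : topologicalType)
    (X : set T) (Y : set U) (f : T -> U) :=
  set_bij X Y f /\ {within X, continuous f} /\
  exists g : U -> T,
    {within Y, continuous g} /\ (forall x, X x -> g (f x) = x).

Definition shear_conjugacy (A B : finType) (M : 'M[int]_2)
    (X : set (config A)) (Y : set (config B)) (f : config A -> config B) :=
  homeomorphism_between X Y f /\
  forall k x, X x -> shift (mulZ2 M k) (f x) = f (shift k x).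

Definition topological_conjugacy (A B : finType)
    (X : set (config A)) (Y : set (config B)) (f : config A -> config B) :=
  homeomorphism_between X Y f /\
  forall k x, X x -> shift k (f x) = f (shift k x).

(* The letter at position (i, j), with i horizontal and j vertical, is the
   entry [wmat w i j]: matrix rows are the vertical lines of the word, so
   stacking matrices with [col_mx] is concatenation in direction e_1 and
   [row_mx] is concatenation in direction e_2. *)
Record word (A : finType) := Word {
  width : nat;
  height : nat;
  wmat : 'M[A]_(width, height) }.

Definition letter (A : finType) (a : A) : word A :=
  Word (const_mx a : 'M[A]_(1, 1)).

Definition map_word (A B : finType) (f : A -> B) (w : word A) : word B :=
  Word (map_mx f (wmat w)).

(* [concat1 u v w]: the concatenation of u and v in direction e_1 is defined
   and equal to w. *)
Inductive concat1 (A : finType) : word A -> word A -> word A -> Prop :=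
  Concat1 m1 m2 n (u : 'M[A]_(m1, n)) (v : 'M[A]_(m2, n)) :
    concat1 (Word u) (Word v) (Word (col_mx u v)).

Inductive concat2 (A : finType) : word A -> word A -> word A -> Prop :=
  Concat2 m n1 n2 (u : 'M[A]_(m, n1)) (v : 'M[A]_(m, n2)) :
    concat2 (Word u) (Word v) (Word (row_mx u v)).

Definition nonempty_word (A : finType) (w : word A) :=
  (0 < width w)%N && (0 < height w)%N.

Definition subword (A : finType) (u w : word A) :=
  exists (i0 j0 : nat)
         (f : 'I_(width u) -> 'I_(width w)) (g : 'I_(height u) -> 'I_(height w)),
    [/\ forall i, f i = (i0 + i)%N :> nat,
        forall j, g j = (j0 + j)%N :> nat &
        wmat u = mxsub f g (wmat w)].

(* Degenerate words, of shape (n, 0) or (0, n), are not required to belong to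
   a factorial language: if the word of shape (0, 1) belonged to the domain of
   a morphism, being neutral for horizontal concatenation with every letter it
   would force the images of all letters to have the same height. *)
Definition factorial_language (A : finType) (L : set (word A)) :=
  forall u w, L w -> nonempty_word u -> subword u w -> L u.

Definition config_language (A : finType) (x : config A) : set (word A) :=
  [set w | nonempty_word w /\
     exists k : Z2, forall (i : 'I_(width w)) (j : 'I_(height w)),
       wmat w i j = x (k.1 + i%:Z, k.2 + j%:Z)].

Definition language (A : finType) (X : set (config A)) : set (word A) :=
  \bigcup_(x in X) config_language x.

(* A map defined on the language [wdom]; its values elsewhere are irrelevant. *)
Record wordmap (A B : finType) := WordMap {
  wdom : set (word A);
  wfun :> word A -> word B }.

Definition is_morphism (A B : finType) (f : wordmap A B) :=
  [/\ factorial_language (wdom f),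
      forall u v w, wdom f u -> wdom f v -> wdom f w ->
        concat1 u v w -> concat1 (f u) (f v) (f w) &
      forall u v w, wdom f u -> wdom f v -> wdom f w ->
        concat2 u v w -> concat2 (f u) (f v) (f w)].

Definition wcomp (A B C : finType) (f : wordmap B C) (g : wordmap A B) :
    wordmap A C :=
  WordMap [set w | wdom g w /\ wdom f (g w)] (fun w => f (g w)).

Definition letter_map (A B : finType) (f : A -> B) : wordmap A B :=
  WordMap setT (map_word f).

(* [extends f x y]: y is the image of x, obtained by concatenating the words
   f(x_(i,j)); the lower-left corner of f(x_(i,j)) is at (p i, q j).  The last
   clause says that these words cover the whole plane, so that y is unique. *)
Definition extends (A B : finType) (f : wordmap A B)
    (x : config A) (y : config B) :=
  exists p q : int -> int,
  [/\ p 0 = 0 /\ q 0 = 0,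
      forall i j, p (i + 1) = p i + (width (f (letter (x (i, j)))))%:Z,
      forall i j, q (j + 1) = q j + (height (f (letter (x (i, j)))))%:Z,
      forall i j (a : 'I_(width (f (letter (x (i, j))))))
                 (b : 'I_(height (f (letter (x (i, j)))))),
        y (p i + a%:Z, q j + b%:Z) = wmat (f (letter (x (i, j)))) a b &
      forall m : Z2, exists i j,
        p i <= m.1 < p (i + 1) /\ q j <= m.2 < q (j + 1)].

Definition applicable (A B : finType) (f : wordmap A B) (X : set (config A)) :=
  language X `<=` wdom f /\ forall x, X x -> exists y, extends f x y.

Definition config_image (A B : finType) (f : wordmap A B)
    (X : set (config A)) : set (config B) :=
  [set y | exists2 x, X x & extends f x y].

Definition desubstitution (A B : finType) (f : wordmap A B)
    (Y : set (config A)) (X : set (config B)) :=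
  [/\ is_morphism f, applicable f Y & X = shift_closure (config_image f Y)].

(* The m-th iterate of [f] is defined at [w]. *)
Definition iter_defined (A : finType) (f : wordmap A A) (m : nat) (w : word A) :=
  forall k, (k < m)%N -> wdom f (iter k f w).

Definition expansive (A : finType) (f : wordmap A A) :=
  forall (a : A) (K : nat), exists m,
    [/\ iter_defined f m (letter a),
        (K < width (iter m f (letter a)))%N &
        (K < height (iter m f (letter a)))%N].

Definition occurs (A : finType) (b : A) (w : word A) :=
  exists i j, wmat w i j = b.

Definition primitive (A : finType) (f : wordmap A A) :=
  exists m, forall a b : A,
    iter_defined f m (letter a) /\ occurs b (iter m f (letter a)).

Definition self_similarity (A : finType) (f : wordmap A A)
    (X : set (config A)) :=
  [/\ is_subshift X, expansive f & desubstitution f X X].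

Definition self_similar (A : finType) (X : set (config A)) :=
  exists f : wordmap A A, self_similarity f X.

Record lattice (R : realType) := Lattice {
  gen1 : R * R;
  gen2 : R * R;
  gen_indep : gen1.1 * gen2.2 - gen1.2 * gen2.1 != 0 }.

Section Torus.
Variables (R : realType) (G : lattice R).

Definition lattice_set : set (R * R) :=
  [set v | exists m n : int, v = gen1 G *~ m + gen2 G *~ n].

Definition lattice_rel (x y : R * R) : bool := `[< lattice_set (x - y) >].

Lemma lattice_rel_refl : reflexive lattice_rel.
Proof. by move=> x; apply/asboolP; exists 0, 0; rewrite subrr !mulr0z addr0. Qed.

Lemma lattice_rel_sym : symmetric lattice_rel.
Proof.
move=> x y; apply/asboolP/asboolP => -[m [n e]]; exists (- m), (- n);
  by rewrite !mulrNz -opprD -e opprB.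
Qed.

Lemma lattice_rel_trans : transitive lattice_rel.
Proof.
move=> y x z /asboolP[m [n e]] /asboolP[m' [n' e']].
apply/asboolP; exists (m + m'), (n + n').
by rewrite !mulrzDr addrACA -e -e' addrA subrK.
Qed.

Canonical lattice_equiv :=
  EquivRel lattice_rel lattice_rel_refl lattice_rel_sym lattice_rel_trans.

Definition torus := quotient_topology {eq_quot lattice_rel}.

Definition torus_pi (x : R * R) : torus := \pi_torus x.

Definition torus_add (p : torus) (v : R * R) : torus := torus_pi (repr p + v).

Lemma torus_add_pi x v : torus_add (torus_pi x) v = torus_pi (x + v).
Proof.
apply/eqmodP; rewrite /= /lattice_rel opprD addrACA subrr addr0.
by have /eqmodP := reprK (torus_pi x).
Qed.

Definition is_Z2_action (T : Z2 -> torus -> torus) :=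
  [/\ forall p, T 0 p = p,
      forall m n p, T (m + n) p = T m (T n p) &
      forall n, continuous (T n)].

Definition is_topological_partition (A : finType) (P : A -> set torus) :=
  [/\ forall a, open (P a),
      forall a b, a != b -> P a `&` P b = set0 &
      \bigcup_(a in [set: A]) closure (P a) = setT].

Definition allowed (A : finType) (P : A -> set torus) (T : Z2 -> torus -> torus)
    (S : set Z2) (w : Z2 -> A) :=
  \bigcap_(k in S) (T (- k) @` P (w k)) !=set0.

Definition symbolic_shift (A : finType) (P : A -> set torus)
    (T : Z2 -> torus -> torus) : set (config A) :=
  [set x | forall S : set Z2, finite_set S -> allowed P T S x].

End Torus.

Record torus_system (R : realType) := TorusSystem {
  alphabet : finType;
  slattice : lattice R;
  action : Z2 -> torus slattice -> torus slattice;
  atoms : alphabet -> set (torus slattice);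
  actionP : is_Z2_action action;
  atomsP : is_topological_partition atoms }.

Definition shift_of (R : realType) (S : torus_system R) :
    set (config (alphabet S)) :=
  symbolic_shift (@atoms R S) (@action R S).
Arguments shift_of {R} S _.

Section Polygons.
Variable R : realType.

Definition segment (a b : R * R) : set (R * R) :=
  [set p | exists2 t : R, 0 <= t <= 1 &
     p = (a.1 + t * (b.1 - a.1), a.2 + t * (b.2 - a.2))].

Definition polygon_boundary (vs : seq (R * R)) : set (R * R) :=
  [set p | exists2 e, e \in zip vs (rot 1 vs) & segment e.1 e.2 p].

(* The region enclosed by the closed polygonal line with vertices [vs], in
   cyclic order: the bounded components of the complement of that line. *)
Definition polygon_interior (vs : seq (R * R)) : set (R * R) :=
  [set p | ~ polygon_boundary vs p /\
     bounded_set (connected_component (~` polygon_boundary vs) p)].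

Definition polygons_atom (G : lattice R) (pols : seq (seq (R * R))) :
    set (torus G) :=
  @torus_pi R G @`
    [set p | exists2 vs, vs \in pols & polygon_interior vs p].

End Polygons.

Section Explicit.
Variable R : realType.

Definition phi : R := (1 + Num.sqrt 5) / 2.

Lemma phi_gt0 : 0 < phi.
Proof. by rewrite divr_gt0// ltr_pwDl// sqrtr_ge0. Qed.

Local Notation s := (phi^-1).
Local Notation t := (phi^-2).
Local Notation u := (phi^-3).

Lemma lattice0_indep :
  (phi, 0 : R).1 * (1 : R, phi + 3).2 - (phi, 0 : R).2 * (1 : R, phi + 3).1 != 0.
Proof.
by rewrite /= mul0r subr0 mulf_neq0// gt_eqF// ?addr_gt0// phi_gt0.
Qed.

Definition lattice0 : lattice R := Lattice lattice0_indep.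

Definition R0 (n : Z2) (p : torus lattice0) : torus lattice0 :=
  torus_add p (n.1%:~R, n.2%:~R).

Definition polygons0 : seq (seq (seq (R * R))) :=
  [::
    (* 0 *)
    [:: [:: (0, 0); (s, 0); (s, 1)];
        [:: (s, 0); (1, 0); (1, 1)];
        [:: (1, 0); (phi, 0); (phi, 1)]];
    (* 1 *)
    [:: [:: (0, 0); (s, 1); (0, 1)];
        [:: (s, 0); (1, 1); (s, 1)];
        [:: (1, 0); (phi, 1); (1, 1)]];
    (* 2 *)
    [:: [:: (0, 2); (s, phi + 2); (0, phi + 1)]];
    (* 3 *)
    [:: [:: (1, 1); (phi, 2); (phi, phi + 2); (1, 2)]];
    (* 4 *)
    [:: [:: (0, 2); (1, phi + 2); (1, phi + 3)]];
    (* 5 *)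
    [:: [:: (0, phi + 1); (s, phi + 2); (1, phi + 3);
            (t, phi + 2); (t, phi + 3); (0, phi + 2)]];
    (* 6 *)
    [:: [:: (0, phi + 2); (t, phi + 3); (0, phi + 3)];
        [:: (t, phi + 2); (1, phi + 3); (t, phi + 3)];
        [:: (1, phi + 2); (phi, phi + 3); (1, phi + 3)]];
    (* 7 *)
    [:: [:: (0, 1); (1, phi + 2); (0, 2)];
        [:: (1, phi + 1); (phi, phi + 2); (phi, phi + 3); (1, phi + 2)]];
    (* 8 *)
    [:: [:: (s, 1); (phi, phi + 2); (s, 2)]];
    (* 9 *)
    [:: [:: (0, 1); (s, 1); (s, 2)];
        [:: (s, 1); (1, 1); (1, 2)];
        [:: (1, 1); (phi, 1); (phi, 2)]];
    (* 10 *)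
    [:: [:: (0, 1); (1, phi + 1); (1, phi + 2)]]
  ].

Definition P0 (a : 'I_11) : set (torus lattice0) :=
  @polygons_atom R lattice0 (nth [::] polygons0 a).

Definition X0 : set (config 'I_11) := symbolic_shift P0 R0.

Lemma latticeZ2_indep :
  (1 : R, 0 : R).1 * (0 : R, 1 : R).2 - (1 : R, 0 : R).2 * (0 : R, 1 : R).1 != 0.
Proof. by rewrite /= mulr1 mulr0 subr0 oner_neq0. Qed.

Definition latticeZ2 : lattice R := Lattice latticeZ2_indep.

Definition RU (n : Z2) (p : torus latticeZ2) : torus latticeZ2 :=
  torus_add p (t * n.1%:~R, t * n.2%:~R).

Definition polygonsU : seq (seq (R * R)) :=
  [::
    (* 0 *)  [:: (s, s); (2 * t, s); (s, 2 * t)];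
    (* 1 *)  [:: (2 * t, s); (1, s); (1, 1); (s, 1); (s, 2 * t)];
    (* 2 *)  [:: (u, s); (t, s); (0, 1)];
    (* 3 *)  [:: (0, s); (u, s); (0, 1)];
    (* 4 *)  [:: (s, s); (s, 2 * t); (t, 1)];
    (* 5 *)  [:: (s, 2 * t); (s, 1); (t, 1)];
    (* 6 *)  [:: (t, s); (t, 1); (0, 1)];
    (* 7 *)  [:: (t, s); (s, s); (t, 1)];
    (* 8 *)  [:: (s, 0); (1, 0); (s, t)];
    (* 9 *)  [:: (1, 0); (1, t); (2 * t, s); (s, s)];
    (* 10 *) [:: (1, t); (1, s); (2 * t, s)];
    (* 11 *) [:: (s, t); (1, 0); (s, s)];
    (* 12 *) [:: (t, t); (t, s); (u, s)];
    (* 13 *) [:: (s, 0); (s, t); (t, s); (t, t)];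
    (* 14 *) [:: (t, 0); (t, t); (u, s); (0, s)];
    (* 15 *) [:: (t, 0); (s, 0); (t, t)];
    (* 16 *) [:: (0, 0); (t, 0); (0, t)];
    (* 17 *) [:: (t, 0); (0, s); (0, t)];
    (* 18 *) [:: (s, t); (s, s); (t, s)]
  ].

Definition PU (a : 'I_19) : set (torus latticeZ2) :=
  @polygons_atom R latticeZ2 [:: nth [::] polygonsU a].

Definition XU : set (config 'I_19) := symbolic_shift PU RU.

End Explicit.

(* Main.v *)
(* Call a point generic when it lies on no line with coefficients in Z[phi]:
   generic points are dense and never meet the boundary of an atom, so on them
   the codings are honest partitions. A configuration of a symbolic system is
   the limit, along an ultrafilter of generic points, of codings of points.
   If the generic points of one torus are those of a Rokhlin tower over a window
   which the other system parametrizes, with floors inside atoms, then reading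
   limits of codings in both directions shows that the tower is a
   desubstitution; no recognizability is needed.

   Inducing R0 on 0 < y < 1 and shearing gives the rotation of the rectangular
   torus by (1, 0) and (0, t). It contains a window, of size phi^-3 by phi^-2,
   on which the return maps are conjugate to the rotation RU by an affine map,
   and the tower over the image of PU there refines everything, so that the
   systems 3 to 10 may all be taken to be (PU, RU). The map v -> s - s v of the
   unit square gives the self-similarity, whose columns and rows follow the
   Fibonacci substitution.

   All the plane geometry is exact linear arithmetic over Z[phi]: implications
   between strict linear inequalities in two variables are certified by Farkas
   combinations of two of them. *)
Require Import Defs.
From mathcomp Require Import all_boot all_order all_algebra.
From mathcomp Require Import all_classical all_reals all_analysis.
From mathcomp Require Import finmap zify ssrZ ring lra.
From Stdlib Require BinInt.

Set Implicit Arguments.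
Unset Strict Implicit.
Unset Printing Implicit Defensive.

Import Order.TTheory GRing.Theory Num.Theory.
Import numFieldNormedType.Exports.

Local Open Scope classical_set_scope.
Local Open Scope ring_scope.

(** * Two-dimensional morphisms defined by blocks *)

(** Images of letters can be concatenated only if widths agree along columns and heights along rows.
    After the shear the rotation acts on each coordinate separately, so a product of two
    one-dimensional towers has widths depending on x alone and heights on y alone: hence blocks
    indexed by a column class and a row class.

    In the first induction 5 - (phi + 3) = t and 4 - (phi + 3) = t - 1 give the return times 5 and
    4; the coordinate 1 of the lattice vector (1, phi + 3) slides each vertical return by -1, which
    the shear undoes.

    In the other towers the return displacements dictate the scale c, since they must be c t and c
    (t - 1): 8 - 5 phi = -u t and 5 - 3 phi = u s for the columns of the window, 3 t - 1 = t t and 2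
    t - 1 = -s t for its rows, 2 t - 1 = -s t and t = s s for the self-similarity. The scales are
    thus -u, t and -s, the negative ones reversing orientation.

    Coverings are decided by computation at generic points only. The interior of a polygon involves
    every point of the plane, so it needs separate arguments about points on the lines of the
    sides. *)

Section Words.
Variables (B : finType) (b0 : B).

(** Total access by natural numbers: words of different shapes are compared without casts between
    ordinals. *)
Definition wget (w : word B) (i j : nat) : B :=
  if insub i is Some i' then
    if insub j is Some j' then wmat w i' j' else b0
  else b0.

Lemma wgetE (w : word B) (i : 'I_(width w)) (j : 'I_(height w)) :
  wget w i j = wmat w i j.
Proof. by rewrite /wget !valK. Qed.

Lemma wget_letter (b : B) : wget (letter b) 0 0 = b.
Proof. by rewrite (wgetE (w := letter b) ord0 ord0) mxE. Qed.

(** Replaces an inductive relation on dependent matrices by equations over natural numbers, so that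
    equalities of shapes can be proved rather than hold by conversion. *)
Lemma concat1P (u v w : word B) :
  concat1 u v w <->
  [/\ height u = height w, height v = height w,
      (width u + width v)%N = width w,
      forall i j, (i < width u)%N -> (j < height w)%N ->
        wget w i j = wget u i j &
      forall i j, (i < width v)%N -> (j < height w)%N ->
        wget w (width u + i) j = wget v i j].
Proof.
split=> [[m1 m2 n U V]|].
  split=> //= i j hi hj.
    have -> : i = lshift m2 (Ordinal hi) :> nat by [].
    have -> : j = Ordinal hj :> nat by [].
    by rewrite (wgetE (w := Word (col_mx U V))) (wgetE (w := Word U) (Ordinal hi)) /= col_mxEu.
  have -> : (m1 + i)%N = rshift m1 (Ordinal hi) :> nat by [].
  have -> : j = Ordinal hj :> nat by [].
  by rewrite (wgetE (w := Word (col_mx U V))) (wgetE (w := Word V) (Ordinal hi)) /= col_mxEd.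
case: u v w => [m1 n U] [m2 n2 V] [m n3 W] /= [h1 h2 h3]; subst n n2 m => hU hV.
have -> : W = col_mx U V; last by constructor.
apply/matrixP => i j.
rewrite -[W i j](wgetE (w := Word W)) -(fintype.splitK i) mxE unsplitK.
case: (fintype.split i) => k /=.
  by rewrite hU// (wgetE (w := Word U)).
by rewrite hV// (wgetE (w := Word V)).
Qed.

Lemma concat2P (u v w : word B) :
  concat2 u v w <->
  [/\ width u = width w, width v = width w,
      (height u + height v)%N = height w,
      forall i j, (i < width w)%N -> (j < height u)%N ->
        wget w i j = wget u i j &
      forall i j, (i < width w)%N -> (j < height v)%N ->
        wget w i (height u + j) = wget v i j].
Proof.
split=> [[m n1 n2 U V]|].
  split=> //= i j hi hj.
    have -> : j = lshift n2 (Ordinal hj) :> nat by [].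
    have -> : i = Ordinal hi :> nat by [].
    by rewrite (wgetE (w := Word (row_mx U V))) (wgetE (w := Word U) _ (Ordinal hj)) /= row_mxEl.
  have -> : (n1 + j)%N = rshift n1 (Ordinal hj) :> nat by [].
  have -> : i = Ordinal hi :> nat by [].
  by rewrite (wgetE (w := Word (row_mx U V))) (wgetE (w := Word V) _ (Ordinal hj)) /= row_mxEr.
case: u v w => [m n1 U] [m2 n2 V] [m3 n W] /= [h1 h2 h3]; subst m m2 n => hU hV.
have -> : W = row_mx U V; last by constructor.
apply/matrixP => i j.
rewrite -[W i j](wgetE (w := Word W)) -(fintype.splitK j) mxE unsplitK.
case: (fintype.split j) => k /=.
  by rewrite hU// (wgetE (w := Word U)).
by rewrite hV// (wgetE (w := Word V)).
Qed.

End Words.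

Lemma flatten_index_catl (s1 s2 : seq nat) r c : (r < size s1)%N ->
  flatten_index (s1 ++ s2) r c = flatten_index s1 r c.
Proof. by move=> h; rewrite /flatten_index take_cat h. Qed.

Lemma flatten_index_catr (s1 s2 : seq nat) r c :
  flatten_index (s1 ++ s2) (size s1 + r) c = (sumn s1 + flatten_index s2 r c)%N.
Proof.
rewrite /flatten_index take_cat ltnNge leq_addr /= addKn sumn_cat.
by rewrite addnA.
Qed.

Section BlockMorphism.
Variables (A B : finType) (C D : eqType) (b0 : B).
Variables (ct : B -> C) (rt : B -> D) (wd : C -> nat) (ht : D -> nat).
Variable e : B -> nat -> nat -> A.

(** Widths are read in row 0 and, in [row_shape], heights in column 0; on consistent words every
    other row or column gives the same. *)
Definition col_shape (w : word B) : seq nat :=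
  [seq wd (ct (wget b0 w i 0)) | i <- iota 0 (width w)].
Definition row_shape (w : word B) : seq nat :=
  [seq ht (rt (wget b0 w 0 j)) | j <- iota 0 (height w)].

Definition block_image (w : word B) : word A :=
  Word (\matrix_(x < sumn (col_shape w), y < sumn (row_shape w))
    e (wget b0 w (reshape_index (col_shape w) x) (reshape_index (row_shape w) y))
      (reshape_offset (col_shape w) x) (reshape_offset (row_shape w) y)).

Definition consistent_word : set (word B) :=
  [set w | [/\ nonempty_word w,
     forall i j j', ct (wmat w i j) = ct (wmat w i j') &
     forall i i' j, rt (wmat w i j) = rt (wmat w i' j)]].

Definition block_morphism : wordmap B A := WordMap consistent_word block_image.

Lemma consistent_wget w : consistent_word w ->
  (forall i j j', (i < width w)%N -> (j < height w)%N -> (j' < height w)%N ->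
     ct (wget b0 w i j) = ct (wget b0 w i j')) /\
  (forall i i' j, (i < width w)%N -> (i' < width w)%N -> (j < height w)%N ->
     rt (wget b0 w i j) = rt (wget b0 w i' j)).
Proof.
move=> [_ h1 h2]; split.
  move=> i j j' hi hj hj'.
  by rewrite (wgetE b0 (Ordinal hi) (Ordinal hj)) (wgetE b0 (Ordinal hi) (Ordinal hj')).
move=> i i' j hi hi' hj.
by rewrite (wgetE b0 (Ordinal hi) (Ordinal hj)) (wgetE b0 (Ordinal hi') (Ordinal hj)).
Qed.

Lemma nth_col_shape w r : (r < width w)%N ->
  nth 0%N (col_shape w) r = wd (ct (wget b0 w r 0)).
Proof. by move=> h; rewrite (nth_map 0%N) ?size_iota// nth_iota. Qed.

Lemma nth_row_shape w r : (r < height w)%N ->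
  nth 0%N (row_shape w) r = ht (rt (wget b0 w 0 r)).
Proof. by move=> h; rewrite (nth_map 0%N) ?size_iota// nth_iota. Qed.

Lemma size_col_shape w : size (col_shape w) = width w.
Proof. by rewrite size_map size_iota. Qed.

Lemma size_row_shape w : size (row_shape w) = height w.
Proof. by rewrite size_map size_iota. Qed.

Variable a0 : A.

Lemma block_imageE w r r' c c' : (r < width w)%N -> (r' < height w)%N ->
  (c < wd (ct (wget b0 w r 0)))%N -> (c' < ht (rt (wget b0 w 0 r')))%N ->
  wget a0 (block_image w) (flatten_index (col_shape w) r c)
                       (flatten_index (row_shape w) r' c') =
  e (wget b0 w r r') c c'.
Proof.
move=> hr hr'; rewrite -(nth_col_shape hr) -(nth_row_shape hr') => hc hc'.
rewrite (wgetE a0 (w := block_image w) (Ordinal (flatten_indexP hc)) (Ordinal (flatten_indexP hc'))).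
by rewrite mxE/= !flatten_indexKl// !flatten_indexKr.
Qed.

Lemma flatten_indexW (s : seq nat) x : (x < sumn s)%N ->
  exists r c, [/\ (r < size s)%N, (c < nth 0 s r)%N & x = flatten_index s r c].
Proof.
move=> h; exists (reshape_index s x), (reshape_offset s x).
by rewrite reshape_indexP// reshape_offsetP// reshape_indexK.
Qed.

Lemma block_concat1 u v w : consistent_word u -> consistent_word v ->
  consistent_word w -> concat1 u v w ->
  concat1 (block_image u) (block_image v) (block_image w).
Proof.
move=> Lu Lv Lw /(concat1P b0)[hu hv hw eu ev].
have [/andP[wu hu0] _ _] := Lu; have [/andP[wv hv0] _ _] := Lv.
have hw0 : (0 < height w)%N by rewrite -hu.
have [_ cw] := consistent_wget Lw.
have csw : col_shape w = col_shape u ++ col_shape v.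
  apply: (@eq_from_nth _ 0%N); rewrite ?size_cat !size_col_shape // => i hi.
  rewrite nth_col_shape// nth_cat size_col_shape.
  case: ifP => hiu; first by rewrite nth_col_shape// eu.
  have hi' : i = (width u + (i - width u))%N by lia.
  rewrite nth_col_shape; last by lia.
  by rewrite {1}hi' ev//; lia.
have rsu : row_shape u = row_shape w.
  apply: (@eq_from_nth _ 0%N); rewrite !size_row_shape // => j hj.
  by rewrite !nth_row_shape// -?hu// eu// -hu.
have rsv : row_shape v = row_shape w.
  apply: (@eq_from_nth _ 0%N); rewrite !size_row_shape // => j hj.
  rewrite !nth_row_shape// -?hv// -[in LHS](ev 0%N j)// -?hv//.
  (* The heights of [v] are read in column [width u] of [w], those of [w] in column 0; consistency
     of [w] identifies them. *)
  by congr (ht _); apply: cw; lia.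
apply/(concat1P a0); split.
- by rewrite /= rsu.
- by rewrite /= rsv.
- by rewrite /= csw sumn_cat.
- move=> x y /flatten_indexW[r [c [hr hc ->]]] /flatten_indexW[r' [c' [hr' hc' ->]]].
  rewrite size_col_shape in hr; rewrite size_row_shape in hr'.
  rewrite nth_col_shape// in hc; rewrite nth_row_shape// in hc'.
  rewrite -{1}rsu -[in LHS](@flatten_index_catl _ (col_shape v)) ?size_col_shape// -csw.
  rewrite rsu block_imageE//; last 2 first.
  + by rewrite -hw; lia.
  + by rewrite eu.
  rewrite -{1}rsu block_imageE// ?hu// ?eu//.
  by rewrite -eu.
- move=> x y /flatten_indexW[r [c [hr hc ->]]] /flatten_indexW[r' [c' [hr' hc' ->]]].
  rewrite size_col_shape in hr; rewrite size_row_shape in hr'.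
  rewrite nth_col_shape// in hc; rewrite nth_row_shape// in hc'.
  rewrite [width (block_image u)]/= -flatten_index_catr -csw size_col_shape.
  rewrite block_imageE//; last 2 first.
  + by rewrite -hw; lia.
  + by rewrite ev.
  rewrite -{1}rsv block_imageE// ?hv// ?ev//.
  rewrite -ev// -[X in wget _ _ X _]addn0 addn0 (cw _ 0%N)//; lia.
Qed.

Lemma block_concat2 u v w : consistent_word u -> consistent_word v ->
  consistent_word w -> concat2 u v w ->
  concat2 (block_image u) (block_image v) (block_image w).
Proof.
move=> Lu Lv Lw /(concat2P b0)[hu hv hw eu ev].
have [/andP[wu hu0] _ _] := Lu; have [/andP[wv hv0] _ _] := Lv.
have hw0 : (0 < width w)%N by rewrite -hu.
have [cw _] := consistent_wget Lw.
have csw : row_shape w = row_shape u ++ row_shape v.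
  apply: (@eq_from_nth _ 0%N); rewrite ?size_cat !size_row_shape // => i hi.
  rewrite nth_row_shape// nth_cat size_row_shape.
  case: ifP => hiu; first by rewrite nth_row_shape// eu.
  have hi' : i = (height u + (i - height u))%N by lia.
  rewrite nth_row_shape; last by lia.
  by rewrite {1}hi' ev//; lia.
have rsu : col_shape u = col_shape w.
  apply: (@eq_from_nth _ 0%N); rewrite !size_col_shape // => j hj.
  by rewrite !nth_col_shape// -?hu// eu// -hu.
have rsv : col_shape v = col_shape w.
  apply: (@eq_from_nth _ 0%N); rewrite !size_col_shape // => j hj.
  rewrite !nth_col_shape// -?hv// -[in LHS](ev j 0%N)// -?hv//.
  by congr (wd _); apply: cw; lia.
apply/(concat2P a0); split.
- by rewrite /= rsu.
- by rewrite /= rsv.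
- by rewrite /= csw sumn_cat.
- move=> x y /flatten_indexW[r [c [hr hc ->]]] /flatten_indexW[r' [c' [hr' hc' ->]]].
  rewrite size_col_shape in hr; rewrite size_row_shape in hr'.
  rewrite nth_col_shape// in hc; rewrite nth_row_shape// in hc'.
  rewrite -[X in wget _ _ _ X = _](@flatten_index_catl _ (row_shape v)) ?size_row_shape// -csw.
  rewrite block_imageE//; last 2 first.
  + by rewrite -hw; lia.
  + by rewrite eu.
  rewrite -{1}rsu block_imageE// ?hu// ?eu//.
  by rewrite -eu.
- move=> x y /flatten_indexW[r [c [hr hc ->]]] /flatten_indexW[r' [c' [hr' hc' ->]]].
  rewrite size_col_shape in hr; rewrite size_row_shape in hr'.
  rewrite nth_col_shape// in hc; rewrite nth_row_shape// in hc'.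
  rewrite [height (block_image u)]/= -flatten_index_catr -csw size_row_shape.
  rewrite block_imageE//; last 2 first.
  + by rewrite -hw; lia.
  + by rewrite ev.
  rewrite -{1}rsv block_imageE// ?hv// ?ev//.
  rewrite -ev// (cw _ _ 0%N)//; lia.
Qed.

Lemma consistent_factorial : factorial_language consistent_word.
Proof.
move=> u w [_ h1 h2] nu [i0 [j0 [f [g [_ _ eq]]]]]; split=> //.
  by move=> i j j'; rewrite eq !mxE.
by move=> i i' j; rewrite eq !mxE.
Qed.

Lemma block_is_morphism : is_morphism block_morphism.
Proof.
by split; [exact: consistent_factorial|exact: block_concat1|exact: block_concat2].
Qed.

Lemma width_block_letter b : width (block_morphism (letter b)) = wd (ct b).
Proof. by rewrite /= wget_letter addn0. Qed.

Lemma height_block_letter b : height (block_morphism (letter b)) = ht (rt b).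
Proof. by rewrite /= wget_letter addn0. Qed.

Lemma block_letterE b (i : 'I_(width (block_morphism (letter b))))
    (j : 'I_(height (block_morphism (letter b)))) :
  wmat (block_morphism (letter b)) i j = e b i j.
Proof.
have hi : (i < wd (ct (wget b0 (letter b) 0 0)))%N.
  by rewrite (leq_trans (ltn_ord i))// width_block_letter wget_letter.
have hj : (j < ht (rt (wget b0 (letter b) 0 0)))%N.
  by rewrite (leq_trans (ltn_ord j))// height_block_letter wget_letter.
rewrite -(wgetE a0 (w := block_morphism (letter b))).
have := @block_imageE (letter b) 0 0 i j isT isT hi hj.
rewrite /flatten_index !take0 [sumn _]/= !add0n => ->; congr (e _ _ _).
exact: wget_letter.
Qed.

End BlockMorphism.

(** * Symbolic systems and ultrafilters of generic points *)

Section CumulativePosition.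
Variable g : int -> nat.

(** Two-sided partial sums of the widths: the functions [p] and [q] of [extends]. *)
Definition cpos (i : int) : int :=
  match i with
  | Posz n => (\sum_(k < n) g k%:Z)%:Z
  | Negz n => - (\sum_(k < n.+1) g (Negz k))%:Z
  end.

Lemma cpos0 : cpos 0 = 0. Proof. by rewrite -[0]/(Posz 0) /cpos big_ord0. Qed.

Lemma cposS i : cpos (i + 1) = cpos i + (g i)%:Z.
Proof.
case: i => n; first by rewrite -PoszD addn1 /cpos big_ord_recr /= PoszD.
case: n => [|n].
  have -> : Negz 0 + 1 = 0 :> int by [].
  by rewrite cpos0 /cpos big_ord1 addNr.
have -> : Negz n.+1 + 1 = Negz n :> int by lia.
by rewrite /cpos [in RHS]big_ord_recr /= PoszD; lia.
Qed.

Hypothesis g_gt0 : forall i, (0 < g i)%N.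

Lemma cpos_lt (i : int) (n : nat) : cpos (i + 1) <= cpos (i + 1 + n%:Z).
Proof.
elim: n => [|n IH]; first by rewrite addr0.
by rewrite -[n.+1]addn1 PoszD addrA [leRHS]cposS (le_trans IH)// lerDl.
Qed.

Lemma cpos_le (i j : int) : i < j -> cpos (i + 1) <= cpos j.
Proof.
move=> h; have -> : j = i + 1 + (absz (j - i - 1)%R)%:Z by lia.
exact: cpos_lt.
Qed.

Lemma cpos_ge (n : nat) : n%:Z <= cpos n.
Proof.
elim: n => [|n IH]; first by rewrite cpos0.
by rewrite -[n.+1]addn1 PoszD cposS; have := g_gt0 n; lia.
Qed.

Lemma cpos_leN (n : nat) : cpos (- n%:Z) <= - n%:Z.
Proof.
elim: n => [|n IH]; first by rewrite oppr0 cpos0.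
have := cposS (- n.+1%:Z); have -> : - n.+1%:Z + 1 = - n%:Z by lia.
by have := g_gt0 (- n.+1%:Z); lia.
Qed.

(** Column -|m| starts at or before m, and every column beyond |m| starts after m, since widths are
    positive; the last column starting at or before m contains it. *)
Lemma cpos_cover m : exists i, cpos i <= m < cpos (i + 1).
Proof.
pose P (n : nat) := cpos (- `|m|%N%:Z + n%:Z) <= m.
have exP : exists n, P n by exists 0%N; rewrite /P addr0; have := cpos_leN `|m|%N; lia.
have bP n : P n -> (n <= `|m|%N + `|m|%N)%N.
  rewrite /P => h; rewrite leqNgt; apply/negP => hn.
  move: h; have -> : - `|m|%N%:Z + n%:Z = (n - `|m|)%N%:Z by lia.
  by have := cpos_ge (n - `|m|)%N; lia.
case: (ex_maxnP exP bP) => n Pn nmax.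
exists (- `|m|%N%:Z + n%:Z); rewrite [_ <= m]Pn /= ltNge; apply/negP => h.
have : P n.+1 by rewrite /P -addn1 PoszD addrA.
by move=> /nmax; rewrite ltnn.
Qed.

Lemma cpos_inj i j m : cpos i <= m < cpos (i + 1) ->
  cpos j <= m < cpos (j + 1) -> i = j.
Proof.
move=> /andP[h1 h2] /andP[h3 h4]; apply/eqP; rewrite eq_le !leNgt.
by apply/andP; split; apply/negP => /cpos_le h; lia.
Qed.

End CumulativePosition.

Section BlockExtends.
Variables (A B : finType) (C D : eqType) (b0 : B).
Variables (ct : B -> C) (rt : B -> D) (wd : C -> nat) (ht : D -> nat).
Variable e : B -> nat -> nat -> A.
Hypothesis wd_gt0 : forall c, (0 < wd c)%N.
Hypothesis ht_gt0 : forall c, (0 < ht c)%N.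

Definition consistent_config (x : config B) :=
  (forall i j j', ct (x (i, j)) = ct (x (i, j'))) /\
  (forall i i' j, rt (x (i, j)) = rt (x (i', j))).

Lemma consistent_config_language x w :
  consistent_config x -> config_language x w -> consistent_word ct rt w.
Proof.
move=> [h1 h2] [nw [k wk]]; split=> //.
  by move=> i j j'; rewrite !wk; apply: h1.
by move=> i i' j; rewrite !wk; apply: h2.
Qed.

Lemma block_extends x : consistent_config x ->
  exists y, extends (block_morphism b0 ct rt wd ht e) x y.
Proof.
move=> [h1 h2].
pose g1 i := wd (ct (x (i, 0))); pose g2 j := ht (rt (x (0, j))).
have g1_gt0 i : (0 < g1 i)%N by apply: wd_gt0.
have g2_gt0 i : (0 < g2 i)%N by apply: ht_gt0.
have [I HI] := choice (cpos_cover g1_gt0).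
have [J HJ] := choice (cpos_cover g2_gt0).
pose y : config A := fun m : Z2 => e (x (I m.1, J m.2))
  (absz (m.1 - cpos g1 (I m.1))%R) (absz (m.2 - cpos g2 (J m.2))%R).
have W i j : width (block_morphism b0 ct rt wd ht e (letter (x (i, j)))) = g1 i.
  by rewrite width_block_letter (h1 _ _ 0).
have H i j : height (block_morphism b0 ct rt wd ht e (letter (x (i, j)))) = g2 j.
  by rewrite height_block_letter (h2 _ 0).
exists y, (cpos g1), (cpos g2); split.
- by rewrite !cpos0.
- by move=> i j; rewrite W cposS.
- by move=> i j; rewrite H cposS.
- move=> i j a b; rewrite block_letterE /=; last exact: (e (x 0) 0%N 0%N).
  have ha : (a < g1 i)%N by rewrite -(W i j).
  have hb : (b < g2 j)%N by rewrite -(H i j).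
  rewrite /y /=.
  have -> : I (cpos g1 i + a%:Z) = i.
    apply: (cpos_inj (g := g1)); first exact: HI.
    by rewrite cposS; lia.
  have -> : J (cpos g2 j + b%:Z) = j.
    apply: (cpos_inj (g := g2)); first exact: HJ.
    by rewrite cposS; lia.
  by congr (e _ _ _); lia.
- by move=> m; exists (I m.1), (J m.2).
Qed.

End BlockExtends.

Lemma filter_finite_bigcap (T : Type) (I : choiceType) (F : set_system T)
    (D : set I) (f : I -> set T) :
  Filter F -> finite_set D -> (forall i, D i -> F (f i)) ->
  F (\bigcap_(i in D) f i).
Proof.
move=> FF fD h; rewrite -(fset_setK fD); apply: filter_bigI => i.
by rewrite in_fset_set// => /set_mem/h.
Qed.

Section SymbolicShift.
Variables (R : realType) (G : lattice R) (A : finType).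
Variables (P : A -> set (torus G)) (act : Z2 -> torus G -> torus G).
Hypothesis actP : is_Z2_action act.

Lemma actionK n : cancel (act n) (act (- n)).
Proof. by case: actP => h0 h _ p; rewrite -h addNr h0. Qed.

Lemma actionVK n : cancel (act (- n)) (act n).
Proof. by case: actP => h0 h _ p; rewrite -h subrr h0. Qed.

Lemma action_image (n : Z2) (X : set (torus G)) p :
  (act (- n) @` X) p <-> X (act n p).
Proof.
split=> [[q Xq <-]|h]; first by rewrite actionVK.
by exists (act n p) => //; rewrite actionK.
Qed.

Lemma allowedP S x : allowed P act S x <->
  exists p, forall k, S k -> P (x k) (act k p).
Proof.
split=> -[p hp]; exists p => k Sk; first exact/action_image/hp.
by apply/action_image/hp.
Qed.

Lemma symbolic_shift_shift k x :
  symbolic_shift P act x -> symbolic_shift P act (Defs.shift k x).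
Proof.
move=> hx S fS; apply/allowedP.
have /allowedP[p hp] := hx ([set m + k | m in S]) (finite_image _ fS).
exists (act k p) => m Sm; case: actP => _ h _; rewrite -h.
by apply: hp; exists m.
Qed.

(** For a fixed finite set S, being allowed depends on the coordinates in S only, so the
    configurations that are not allowed form a union of cylinders. *)
Lemma symbolic_shift_subshift : is_subshift (symbolic_shift P act).
Proof.
split; last exact: symbolic_shift_shift.
rewrite [X in closed X](_ : _ = \bigcap_(S in @finite_set Z2)
    [set x : config A | allowed P act S x]); last by apply/seteqP; split=> x hx S; exact: hx.
apply: closed_bigI => S fS; rewrite -[X in closed X]setCK; apply: open_closedC.
rewrite openE => x /= hx.
have cyl : nbhs x (\bigcap_(k in S) [set z : config A | z k = x k]).
  apply: filter_finite_bigcap => // k _.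
  have : nbhs (proj k x) [set x k].
    by apply: open_nbhs_nbhs; split=> //; exact: discrete_open.
  by move=> h; have := @proj_continuous _ (fun _ : Z2 => discrete_topology A) k x _ h.
apply: filterS cyl => z hz; apply: contra_not hx => /allowedP[p hp].
by apply/allowedP; exists p => k Sk; rewrite -(hz k Sk); exact: hp.
Qed.

(** Finitely many of these conditions hold at a common index, whose point realizes the pattern. *)
Lemma near_symbolic_shift (I : Type) (F : set_system I) (p : I -> torus G) x :
  ProperFilter F -> (forall k, \forall i \near F, P (x k) (act k (p i))) ->
  symbolic_shift P act x.
Proof.
move=> FF h S fS; apply/allowedP.
have : F (\bigcap_(k in S) [set i | P (x k) (act k (p i))]).
  by apply: filter_finite_bigcap => // k _; exact: h.
by move=> /filter_ex[i hi]; exists (p i).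
Qed.

Variable gd : set (torus G).
Hypothesis gd_dense : dense gd.
Hypothesis P_open : forall a, open (P a).

(* The patterns of [x] and the dense set of generic points generate a filter. *)
Lemma symbolic_shift_ultra x : symbolic_shift P act x ->
  exists F : set_system (torus G),
    [/\ UltraFilter F, \forall p \near F, gd p &
        forall k, \forall p \near F, P (x k) (act k p)].
Proof.
move=> hx.
pose cell (S : set Z2) := [set p | gd p /\ forall k, S k -> P (x k) (act k p)].
have cellF : ProperFilter (filter_from finite_set cell).
  apply: filter_from_proper; first apply: filter_from_filter.
  - by exists set0.
  - move=> S S' fS fS'; exists (S `|` S'); first by rewrite finite_setU.
    by move=> p [gp hp]; split; split=> // k Sk; apply: hp; [left|right].
  move=> S fS.
  have [ne0 opO] : (\bigcap_(k in S) (act k @^-1` P (x k))) !=set0 /\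
      open (\bigcap_(k in S) (act k @^-1` P (x k))).
    split; first by have /allowedP[p hp] := hx S fS; exists p => k; apply: hp.
    rewrite openE => p hp; apply: filter_finite_bigcap => // k Sk.
    case: actP => _ _ /(_ k p); apply; apply: open_nbhs_nbhs.
    by split=> //; exact: hp.
  by have [p [hp gp]] := gd_dense ne0 opO; exists p; split=> // k Sk; exact: hp.
have [F [FU hF]] := ultraFilterLemma cellF.
exists F; split=> //.
  by apply: hF; exists set0 => //= p [].
move=> k; apply: hF; exists [set k]; first exact: finite_set1.
by move=> p [_ hp]; apply: hp.
Qed.

End SymbolicShift.

(** Makes an ultrafilter choose a floor of the tower, and then a letter at each position. *)
Lemma ultra_pigeonhole (T : Type) (I : finType) (F : set_system T) (S : I -> set T) :
  UltraFilter F -> (\forall t \near F, exists i, S i t) ->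
  exists i, \forall t \near F, S i t.
Proof.
move=> FU h; apply: contrapT => /forallNP hn.
have hn' i : \forall t \near F, ~ S i t.
  by have [/hn|] := in_ultra_setVsetC (S i) FU.
have hall : \forall t \near F, forall i, ~ S i t by exact: filter_forall.
have /filter_ex[t [[i Si] /(_ i)]] :
  \forall t \near F, (exists i, S i t) /\ forall i, ~ S i t by exact: filterI.
by [].
Qed.

(** * Desubstitution along a tower *)

Lemma Z2D (a b c d : int) : (a, b) + (c, d) = (a + c, b + d) :> Z2.
Proof. by []. Qed.

Lemma near_ex3 (T : Type) (F : set_system T) {FF : ProperFilter F}
    (P1 P2 P3 : set T) :
  (\forall t \near F, P1 t) -> (\forall t \near F, P2 t) ->
  (\forall t \near F, P3 t) -> exists t, [/\ P1 t, P2 t & P3 t].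
Proof.
move=> h1 h2 h3; apply: (@filter_ex _ F).
by apply: filterS3 h1 h2 h3 => t ? ? ?; split.
Qed.

Lemma int_induction (Q : int -> Prop) :
  Q 0 -> (forall i, Q i <-> Q (i + 1)) -> forall i, Q i.
Proof.
move=> h0 hS; case=> n.
  elim: n => [//|n /hS]; have -> : n%:Z + 1 = n.+1%:Z by lia.
  by [].
elim: n => [|n IH]; first by apply/hS.
by apply/hS; have -> : Negz n.+1 + 1 = Negz n :> int by lia.
Qed.

Section Desubstitution.
Variables (R : realType) (G G' : lattice R) (A B : finType) (C D : eqType).
Variables (P : A -> set (torus G)) (act : Z2 -> torus G -> torus G).
Variables (Q : B -> set (torus G')) (act' : Z2 -> torus G' -> torus G').
Variables (gd : set (torus G)) (gd' : set (torus G')).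
Variables (ct : B -> C) (rt : B -> D) (wd : C -> nat) (ht : D -> nat).
Variables (e : B -> nat -> nat -> A) (base : torus G' -> torus G) (b0 : B).

Hypotheses (actP : is_Z2_action act) (actP' : is_Z2_action act').
Hypotheses (gd_dense : dense gd) (gd_dense' : dense gd').
Hypotheses (P_open : forall a, open (P a)) (Q_open : forall b, open (Q b)).
Hypothesis P_disj : forall a a' p, P a p -> P a' p -> a = a'.
Hypothesis gd_act' : forall k q, gd' q -> gd' (act' k q).
Hypothesis gd_cover' : forall q, gd' q -> exists b, Q b q.
Hypotheses (wd_gt0 : forall c, (0 < wd c)%N) (ht_gt0 : forall d, (0 < ht d)%N).
Hypothesis ct_col : forall b b' q, gd' q -> Q b q -> Q b' (act' (0, 1) q) ->
  ct b = ct b'.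
Hypothesis rt_row : forall b b' q, gd' q -> Q b q -> Q b' (act' (1, 0) q) ->
  rt b = rt b'.
Hypothesis return1 : forall b q, gd' q -> Q b q ->
  base (act' (1, 0) q) = act ((wd (ct b))%:Z, 0) (base q).
Hypothesis return2 : forall b q, gd' q -> Q b q ->
  base (act' (0, 1) q) = act (0, (ht (rt b))%:Z) (base q).
Hypothesis return_letters : forall b q (i j : nat), gd' q -> Q b q ->
  (i < wd (ct b))%N -> (j < ht (rt b))%N ->
  P (e b i j) (act (i%:Z, j%:Z) (base q)).
Hypothesis tower_cover : forall p, gd p -> exists q b (i j : nat),
  [/\ gd' q, Q b q, (i < wd (ct b))%N, (j < ht (rt b))%N &
      p = act (i%:Z, j%:Z) (base q)].

Let f := block_morphism b0 ct rt wd ht e.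

Let actD (m n : Z2) q : act (m + n) q = act m (act n q).
Proof. by case: actP => _ ->. Qed.
Let actD' (m n : Z2) q : act' (m + n) q = act' m (act' n q).
Proof. by case: actP' => _ ->. Qed.

(** Two adjacent letters of x are realized by a common generic point, to which [ct_col] or [rt_row]
    applies. *)
Lemma symbolic_consistent x :
  symbolic_shift Q act' x -> consistent_config ct rt x.
Proof.
move=> hx; have [F [FU Fg Fx]] := symbolic_shift_ultra actP' gd_dense' Q_open hx.
split.
  suff h i j : ct (x (i, j)) = ct (x (i, 0)) by move=> i j j'; rewrite h -(h _ j').
  move: j; apply: int_induction => // j.
  suff -> : ct (x (i, j)) = ct (x (i, j + 1)) by [].
  have [q [gq qj qj1]] := near_ex3 Fg (Fx (i, j)) (Fx (i, j + 1)).
  apply: (ct_col (gd_act' (i, j) gq) qj).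
  by rewrite -actD' Z2D add0r [1 + _]addrC.
suff h i j : rt (x (i, j)) = rt (x (0, j)) by move=> i i' j; rewrite h -(h i').
move: i; apply: int_induction => // i.
suff -> : rt (x (i, j)) = rt (x (i + 1, j)) by [].
have [q [gq qj qj1]] := near_ex3 Fg (Fx (i, j)) (Fx (i + 1, j)).
apply: (rt_row (gd_act' (i, j) gq) qj).
by rewrite -actD' Z2D add0r [1 + _]addrC.
Qed.

(** The increments of [p1] and [p2] are the return times met along the orbit. The induction on Z
    also runs backwards, where a step is undone by injectivity of the action. *)
Lemma near_return (I : Type) (F : set_system I) {FF : Filter F} (q : I -> torus G') x
    (p1 p2 : int -> int) :
  (\forall i \near F, gd' (q i)) ->
  (forall k, \forall i \near F, Q (x k) (act' k (q i))) ->
  p1 0 = 0 -> p2 0 = 0 ->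
  (forall i j, p1 (i + 1) = p1 i + (wd (ct (x (i, j))))%:Z) ->
  (forall i j, p2 (j + 1) = p2 j + (ht (rt (x (i, j))))%:Z) ->
  forall i j, \forall t \near F,
    base (act' (i, j) (q t)) = act (p1 i, p2 j) (base (q t)).
Proof.
move=> gq qx p10 p20 p1S p2S i j.
move: i; apply: int_induction.
  move: j; apply: int_induction.
    apply: nearW => t; rewrite p10 p20.
    by case: actP actP' => -> _ _ [-> _ _].
  move=> j.
  have step : \forall t \near F,
     base (act' (0, j + 1) (q t)) = act (0, p2 (j + 1) - p2 j) (base (act' (0, j) (q t))).
    apply: filterS2 gq (qx (0, j)) => t gt qt.
    rewrite (_ : p2 (j + 1) - p2 j = (ht (rt (x (0, j))))%:Z);
      last by rewrite (p2S 0 j) addrC addKr.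
    rewrite -(return2 (gd_act' (0, j) gt) qt) -actD'.
    by rewrite Z2D addr0 [1 + _]addrC.
  split; apply: filterS2 step => t ->.
    by move=> ->; rewrite -actD Z2D add0r subrK.
  move=> h; apply: (can_inj (actionK actP (0, p2 (j + 1) - p2 j))).
  by rewrite h -actD Z2D add0r subrK.
move=> i.
have step : \forall t \near F,
   base (act' (i + 1, j) (q t)) = act (p1 (i + 1) - p1 i, 0) (base (act' (i, j) (q t))).
  apply: filterS2 gq (qx (i, j)) => t gt qt.
  rewrite (_ : p1 (i + 1) - p1 i = (wd (ct (x (i, j))))%:Z);
    last by rewrite (p1S i j) addrC addKr.
  rewrite -(return1 (gd_act' (i, j) gt) qt) -actD'.
  by rewrite Z2D add0r [1 + _]addrC.
split; apply: filterS2 step => t ->.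
  by move=> ->; rewrite -actD Z2D add0r subrK.
move=> h; apply: (can_inj (actionK actP (p1 (i + 1) - p1 i, 0))).
by rewrite h -actD Z2D add0r subrK.
Qed.

(** If m sits at offset (a, b) of block (i, j), then time m leads from the base point of q to floor
    (a, b) above that of [act' (i, j) q], where [return_letters] gives the letter. *)
Lemma extends_letters (I : Type) (F : set_system I) {FF : Filter F}
    (q : I -> torus G') x y :
  (\forall i \near F, gd' (q i)) ->
  (forall k, \forall i \near F, Q (x k) (act' k (q i))) ->
  extends f x y ->
  forall m, \forall i \near F, P (y m) (act m (base (q i))).
Proof.
move=> gq qx [p1 [p2 [[p10 p20] p1S p2S yE cov]]] m.
have a0 : A by exact: (e b0 0%N 0%N).
have p1S' i j : p1 (i + 1) = p1 i + (wd (ct (x (i, j))))%:Z.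
  by rewrite (p1S i j) width_block_letter.
have p2S' i j : p2 (j + 1) = p2 j + (ht (rt (x (i, j))))%:Z.
  by rewrite (p2S i j) height_block_letter.
have [i [j [hi hj]]] := cov m.
have ha : (absz (m.1 - p1 i)%R < width (f (letter (x (i, j)))))%N.
  by case/andP: hi => h1 h2; rewrite -ltz_nat gez0_abs ?subr_ge0// ltrBlDl -p1S.
have hb : (absz (m.2 - p2 j)%R < height (f (letter (x (i, j)))))%N.
  by case/andP: hj => h1 h2; rewrite -ltz_nat gez0_abs ?subr_ge0// ltrBlDl -p2S.
have := yE i j (Ordinal ha) (Ordinal hb); rewrite block_letterE//=.
have E1 : (absz (m.1 - p1 i)%R)%:Z + p1 i = m.1.
  by case/andP: hi => h _; rewrite gez0_abs ?subr_ge0// subrK.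
have E2 : (absz (m.2 - p2 j)%R)%:Z + p2 j = m.2.
  by case/andP: hj => h _; rewrite gez0_abs ?subr_ge0// subrK.
rewrite ![_ + Posz _]addrC E1 E2 -surjective_pairing => ->.
have ret := @near_return I F FF q x p1 p2 gq qx p10 p20 p1S' p2S' i j.
apply: filterS3 ret gq (qx (i, j)) => t ht' gt qt.
rewrite width_block_letter in ha; rewrite height_block_letter in hb.
have := return_letters (gd_act' (i, j) gt) qt ha hb.
by rewrite ht' -actD Z2D E1 E2 -surjective_pairing.
Qed.

(** Generic points lie on finitely many floors, so the ultrafilter of x selects one floor (i0, j0).
    The codings of the points below it converge to a configuration y, and the image of y, shifted by
    (i0, j0), equals x because atoms are disjoint. The converse inclusion moves an ultrafilter to
    the base. *)
Theorem block_desubstitution :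
  desubstitution f (symbolic_shift Q act') (symbolic_shift P act).
Proof.
have a0 : A by exact: (e b0 0%N 0%N).
split.
- exact: block_is_morphism.
- split; last by move=> x /symbolic_consistent; exact: block_extends.
  move=> w [x Xx]; apply: consistent_config_language.
  exact: symbolic_consistent.
apply/seteqP; split=> x; last first.
  move=> [k _ [y [z hz zy] <-]]; apply: symbolic_shift_shift => //.
  have [F [FU Fg Fz]] := symbolic_shift_ultra actP' gd_dense' Q_open hz.
  apply: (@near_symbolic_shift _ _ _ _ _ actP _ F base).
  exact: extends_letters Fg Fz zy.
move=> hx; have [F [FU Fg Fx]] := symbolic_shift_ultra actP gd_dense P_open hx.
pose W := \max_(b : B) wd (ct b); pose H := \max_(b : B) ht (rt b).
have : \forall p \near F, exists ij : 'I_W * 'I_H, exists q,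
    gd' q /\ p = act (ij.1%:Z, ij.2%:Z) (base q).
  apply: filterS Fg => p /tower_cover[q [b [i [j [gq qb hi hj pE]]]]].
  have hi' : (i < W)%N by rewrite (leq_trans hi)// (leq_bigmax (F := fun b => wd (ct b))).
  have hj' : (j < H)%N by rewrite (leq_trans hj)// (leq_bigmax (F := fun b => ht (rt b))).
  by exists (Ordinal hi', Ordinal hj'), q.
move=> /ultra_pigeonhole[[i0 j0] Fij].
(* Chooses the point below p on the selected floor; elsewhere the value is arbitrary. *)
have /choice[q hq] p : exists r : torus G',
    (exists q, gd' q /\ p = act (i0%:Z, j0%:Z) (base q)) ->
    gd' r /\ p = act (i0%:Z, j0%:Z) (base r).
  have [[r hr]|h] := pselect (exists q, gd' q /\ p = act (i0%:Z, j0%:Z) (base q)).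
    by exists r.
  by exists (torus_pi G' (0, 0)).
have Fq : \forall p \near F, gd' (q p) /\ p = act (i0%:Z, j0%:Z) (base (q p)).
  by apply: filterS Fij => p /hq.
have gq : \forall p \near F, gd' (q p) by apply: filterS Fq => p [].
have /choice[y Fy] (k : Z2) : exists b, \forall p \near F, Q b (act' k (q p)).
  apply: ultra_pigeonhole.
  by apply: filterS gq => p gp; apply/gd_cover'/gd_act'.
have hy : symbolic_shift Q act' y.
  exact: (@near_symbolic_shift _ _ _ _ _ actP' _ F q).
have [z yz] := @block_extends _ _ _ _ b0 _ _ _ _ e wd_gt0 ht_gt0 _ (symbolic_consistent hy).
have Fz m : \forall p \near F, P (z m) (act m (base (q p))).
  exact: extends_letters gq Fy yz m.
exists (i0%:Z, j0%:Z) => //; exists z; first by exists y.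
apply/funext => m; rewrite /Defs.shift.
have [p [[_ pE] xm zm]] := near_ex3 Fq (Fx m) (Fz (m + (i0%:Z, j0%:Z))).
by apply: P_disj zm _; rewrite actD -pE.
Qed.

End Desubstitution.

Lemma id_extends (A : finType) (x : config A) : extends (WordMap setT id) x x.
Proof.
exists id, id; split=> //.
  move=> i j a b; rewrite mxE.
  have -> : a%:Z = 0 by move: a => /= a; rewrite ord1.
  have -> : b%:Z = 0 by move: b => /= b; rewrite ord1.
  by rewrite !addr0.
by move=> m; exists m.1, m.2; rewrite !lexx !ltrDl.
Qed.

(** Serves the levels at which two consecutive systems coincide. Letters have shape (1, 1), which
    forces the position functions to be the identity. *)
Lemma id_desubstitution (A : finType) (X : set (config A)) :
  (forall k x, X x -> X (Defs.shift k x)) ->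
  desubstitution (WordMap setT id) X X.
Proof.
move=> hX; split.
- by split=> // u v w.
- by split=> // x _; exists x; exact: id_extends.
apply/seteqP; split=> x.
  move=> hx; exists 0 => //; exists x; last first.
    by apply/funext => m; rewrite /Defs.shift addr0.
  by exists x => //; exact: id_extends.
move=> [k _ [y [z hz [p [q [[p0 q0] pS qS yE _]]]] <-]]; apply: hX.
have pid : p =1 id.
  by apply: int_induction => // i; rewrite (pS i 0) /=; split; lia.
have qid : q =1 id.
  by apply: int_induction => // i; rewrite (qS 0 i) /=; split; lia.
suff -> : y = z by [].
apply/funext => -[i j].
have := yE i j ord0 ord0; rewrite mxE pid qid.
have -> : Posz (@ord0 0) = 0 by [].
by rewrite !addr0.
Qed.

(** * Arithmetic in Z[phi] and generic points *)

(* The ring [Z[phi]], with [(a, b)] standing for [a + b * phi]. *)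
Definition zphi := (BinNums.Z * BinNums.Z)%type.

Section ZphiOperations.
Import BinInt.Z.

Definition zadd (x y : zphi) : zphi := (add x.1 y.1, add x.2 y.2).
Definition zopp (x : zphi) : zphi := (opp x.1, opp x.2).
Definition zmul (x y : zphi) : zphi :=
  let bd := mul x.2 y.2 in
  (add (mul x.1 y.1) bd, add (add (mul x.1 y.2) (mul x.2 y.1)) bd).
Definition zeq0 (x : zphi) : bool := eqb x.1 0 && eqb x.2 0.

(* The sign of [a + b * phi] when [a] and [b] have opposite signs is read off
   the norm [a^2 + a * b - b^2]. *)
Definition zpos (x : zphi) : bool :=
  let a := x.1 in let b := x.2 in
  if leb 0 a then
    if leb 0 b then ltb 0 a || ltb 0 b
    else ltb 0 (sub (add (mul a a) (mul a b)) (mul b b))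
  else
    if leb b 0 then false
    else ltb (sub (add (mul a a) (mul a b)) (mul b b)) 0.

Definition znneg (x : zphi) : bool := zeq0 x || zpos x.

End ZphiOperations.

(** The triple (a, b, c) encodes the open half-plane a x + b y + c > 0. *)
Definition halfplane := (zphi * zphi * zphi)%type.

Section ZphiValues.
Variable R : realType.
Local Notation phi := (phi R).

Definition ZR (z : BinNums.Z) : R := (ssrZ.int_of_Z z)%:~R.
Definition zR (x : zphi) : R := ZR x.1 + ZR x.2 * phi.

Lemma phi_sqr : phi * phi = phi + 1.
Proof.
have h : Num.sqrt 5 * Num.sqrt 5 = 5 :> R by rewrite -expr2 sqr_sqrtr.
by rewrite /Defs.phi; move: h; set r := Num.sqrt 5 => h; nra.
Qed.

Lemma phi_bounds : 1618 / 1000 < phi < 1619 / 1000.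
Proof.
have := phi_sqr; have := phi_gt0 R => h1 h2.
by apply/andP; split; nra.
Qed.

Lemma phiV : phi^-1 = phi - 1.
Proof.
have h0 : phi != 0 by rewrite gt_eqF// phi_gt0.
apply: (mulfI h0); rewrite divff// mulrBr phi_sqr; ring.
Qed.

Lemma phiV2 : phi^-2 = 2 - phi.
Proof. by rewrite -exprVn phiV expr2 mulrBr !mulrBl phi_sqr; ring. Qed.

Lemma phiV3 : phi^-3 = 2 * phi - 3.
Proof.
rewrite -exprVn phiV exprS expr2.
by have := phi_sqr; set p := phi => h; ring: h.
Qed.

Lemma ZRD x y : ZR (BinInt.Z.add x y) = ZR x + ZR y.
Proof. by rewrite /ZR -intrD; congr (_%:~R); lia. Qed.

Lemma ZRN x : ZR (BinInt.Z.opp x) = - ZR x.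
Proof. by rewrite /ZR -intrN; congr (_%:~R); lia. Qed.

Lemma ZRM x y : ZR (BinInt.Z.mul x y) = ZR x * ZR y.
Proof. by rewrite /ZR -intrM; congr (_%:~R); lia. Qed.

Lemma zR_add x y : zR (zadd x y) = zR x + zR y.
Proof. rewrite /zR !ZRD; ring. Qed.

Lemma zR_opp x : zR (zopp x) = - zR x.
Proof. rewrite /zR !ZRN; ring. Qed.

Lemma zR_mul x y : zR (zmul x y) = zR x * zR y.
Proof.
rewrite /zR /= !ZRD !ZRM; have := phi_sqr; set p := phi => h.
ring: h.
Qed.

Lemma ZR_gt0 x : BinInt.Z.ltb BinNums.Z0 x -> 0 < ZR x.
Proof. by move=> h; rewrite /ZR ltr0z; lia. Qed.

Lemma ZR_ge0 x : BinInt.Z.leb BinNums.Z0 x -> 0 <= ZR x.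
Proof. by move=> h; rewrite /ZR ler0z; lia. Qed.

Lemma zeq0P x : zeq0 x -> zR x = 0.
Proof.
case: x => a b /andP[/= ha hb]; rewrite /zR /= /ZR.
have -> : ssrZ.int_of_Z a = 0 by lia.
have -> : ssrZ.int_of_Z b = 0 by lia.
by rewrite mul0r addr0.
Qed.

Lemma zpos_gt0 x : zpos x -> 0 < zR x.
Proof.
case: x => a b; rewrite /zpos /zR /=.
have normE : ZR (BinInt.Z.sub (BinInt.Z.add (BinInt.Z.mul a a) (BinInt.Z.mul a b)) (BinInt.Z.mul b b))
    = ZR a * ZR a + ZR a * ZR b - ZR b * ZR b.
  by rewrite -BinInt.Z.add_opp_r !(ZRD, ZRN, ZRM).
have := phi_bounds; have := phi_sqr.
case: ifP => ha; [have {}ha := ZR_ge0 ha|].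
  case: ifP => hb; [have {}hb := ZR_ge0 hb|].
    by move=> h1 h2 /orP[]/ZR_gt0 h; nra.
  have {}hb : 0 < ZR (BinInt.Z.opp b) by apply: ZR_gt0; lia.
  rewrite ZRN in hb; move=> h1 h2 /ZR_gt0; rewrite normE.
  move: (ZR a) (ZR b) ha hb => {normE} {}a {}b ha hb hn.
  (* The second factor is the conjugate, positive here, so the norm has the sign of a + b phi. *)
  have : 0 < (a + b * phi) * (a - b * (phi - 1)) by nra.
  by rewrite pmulr_lgt0//; nra.
case: ifP => // hb.
have {}ha : 0 < ZR (BinInt.Z.opp a) by apply: ZR_gt0; lia.
have {}hb : 0 < ZR b by apply: ZR_gt0; lia.
rewrite ZRN in ha; move=> h1 h2 hlt.
have /ZR_gt0 : BinInt.Z.ltb BinNums.Z0 (BinInt.Z.opp (BinInt.Z.sub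
    (BinInt.Z.add (BinInt.Z.mul a a) (BinInt.Z.mul a b)) (BinInt.Z.mul b b))) by lia.
rewrite ZRN normE.
move: (ZR a) (ZR b) ha hb => {hlt normE} {}a {}b ha hb hn.
(* Here both the norm and the conjugate are negative. *)
have hp : 0 < (a + b * phi) * (b * (phi - 1) - a) by nra.
have hc : 0 < b * (phi - 1) - a by case/andP: h2 => h2 h3; nra.
by rewrite pmulr_lgt0 in hp.
Qed.

Lemma znneg_ge0 x : znneg x -> 0 <= zR x.
Proof. by case/orP=> [/zeq0P->//|/zpos_gt0/ltW]. Qed.

Definition hval (h : halfplane) (v : R * R) : R :=
  zR h.1.1 * v.1 + zR h.1.2 * v.2 + zR h.2.

(** Degenerate lines are recognized by the real values of their coefficients, so the irrationality
    of phi never enters. *)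
Definition generic (v : R * R) := forall h : halfplane,
  hval h v = 0 -> zR h.1.1 = 0 /\ zR h.1.2 = 0.

Lemma itv_not_countable (a b : R) (S : set R) : a < b -> countable S ->
  exists2 x, a < x < b & ~ S x.
Proof.
move=> ab cS; apply: contrapT => /forall2NP h.
have sub : [set` `]a, b[] `<=` S.
  move=> x; rewrite /= in_itv /= => xab.
  by have [//|/contrapT] := h x.
have c : countable [set` `]a, b[] by apply: sub_countable cS; exact: subset_card_le.
have := countable_lebesgue_measure0 c.
rewrite lebesgue_measure_itv /= lte_fin ab -EFinD => -[] /eqP.
by rewrite subr_eq0 gt_eqF.
Qed.

(** There are countably many lines over Z[phi]: x is chosen off the vertical ones, then y off the
    heights at which the others meet the vertical through x. *)
Lemma generic_dense : dense generic.
Proof.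
move=> O [p Op]; rewrite openE => /(_ p Op).
move=> [[A B] /= [/nbhs_ballP[r1 /= r1_gt0 A1] /nbhs_ballP[r2 /= r2_gt0 B2]] AB].
have hb (c r : R) : 0 < r -> c - r < c + r by lra.
pose Sx : set R := (fun ac : zphi * zphi => - zR ac.2 / zR ac.1) @` setT.
have [x xr nSx] := @itv_not_countable _ _ Sx (hb p.1 r1 r1_gt0)
  (sub_countable (card_image_le _ _) (countableP _)).
pose Sy : set R := (fun h : halfplane => - (zR h.1.1 * x + zR h.2) / zR h.1.2) @` setT.
have [y yr nSy] := @itv_not_countable _ _ Sy (hb p.2 r2 r2_gt0)
  (sub_countable (card_image_le _ _) (countableP _)).
exists (x, y); split.
  apply: AB; split; [apply: A1|apply: B2]; rewrite /ball/= ltr_norml; lra.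
move=> h; rewrite /hval /= => e0.
have b0 : zR h.1.2 = 0.
  apply: contrapT => /eqP b0; apply: nSy; exists h => //.
  by apply: (canLR (mulfK b0)); move: e0; lra.
split=> //; apply: contrapT => /eqP a0; apply: nSx; exists (h.1.1, h.2) => //.
by apply: (canLR (mulfK a0)); move: e0; rewrite b0 /=; lra.
Qed.

Lemma generic_affine (c1 c2 d1 d2 : zphi) v : zR c1 != 0 -> zR c2 != 0 ->
  generic v -> generic (zR c1 * v.1 + zR d1, zR c2 * v.2 + zR d2).
Proof.
move=> c10 c20 gv h h0.
have [|] := gv (zmul h.1.1 c1, zmul h.1.2 c2,
    zadd (zadd (zmul h.1.1 d1) (zmul h.1.2 d2)) h.2).
  by rewrite -h0 /hval /= !(zR_add, zR_mul); ring.
by rewrite /= !zR_mul => /eqP h1 /eqP h2; split; apply/eqP;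
  [move: h1; rewrite mulf_eq0 (negPf c10) orbF|move: h2; rewrite mulf_eq0 (negPf c20) orbF].
Qed.

Lemma generic_translate (d1 d2 : zphi) v :
  generic v -> generic (v.1 + zR d1, v.2 + zR d2).
Proof.
move=> gv h h0.
have [|h1 h2] := gv (h.1.1, h.1.2,
    zadd (zadd (zmul h.1.1 d1) (zmul h.1.2 d2)) h.2); last by [].
by rewrite -h0 /hval /= !(zR_add, zR_mul); ring.
Qed.

End ZphiValues.

(** * Topology of the torus and density of its generic points *)

Section TorusTopology.
Variables (R : realType) (G : lattice R).

Lemma torus_pi_eq x y : torus_pi G x = torus_pi G y <-> lattice_set G (x - y).
Proof.
split=> [/eqmodP/asboolP//|h].
by apply/eqmodP/asboolP.
Qed.

Lemma torus_pi_continuous : continuous (torus_pi G).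
Proof. exact: pi_continuous. Qed.

Lemma open_translate (U : set (R * R)) w : open U -> open [set x | U (x + w)].
Proof.
move=> oU; apply: (@open_comp _ _ (fun x : R * R => x + w)) => // x _.
by apply: cvgD; [exact: cvg_id|exact: cvg_cst].
Qed.

Lemma torus_pi_open U : open U -> open (torus_pi G @` U).
Proof.
move=> oU; rewrite /open /= /quotient_open.
rewrite (_ : _ @^-1` _ = \bigcup_(w in lattice_set G) [set x | U (x + w)]).
  by apply: bigcup_open => w _; exact: open_translate.
apply/seteqP; split=> x.
  move=> [y Uy /torus_pi_eq [m [n e]]]; exists (y - x); first by exists m, n.
  by rewrite /= addrC subrK.
move=> [w [m [n we]] /= Uxw]; exists (x + w) => //.
by apply/torus_pi_eq; exists m, n; rewrite addrC addKr.
Qed.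

Definition torus_generic : set (torus G) := torus_pi G @` (@generic R).

Lemma torus_generic_dense : dense torus_generic.
Proof.
move=> O [p Op] oO.
have oO' : open (torus_pi G @^-1` O).
  by apply: open_comp oO => x _; exact: torus_pi_continuous.
have [v [Ov gv]] : (torus_pi G @^-1` O) `&` (@generic R) !=set0.
  apply: generic_dense oO'; exists (repr p).
  by rewrite /= /torus_pi reprK.
by exists (torus_pi G v); split=> //; exists v.
Qed.

Lemma torus_add_continuous w : continuous (fun p : torus G => torus_add p w).
Proof.
apply/quotient_continuous.
rewrite (_ : _ \o _ = (fun x => torus_pi G (x + w))); last first.
  by apply/funext => x; rewrite /= -torus_add_pi.
move=> x; apply: continuous_comp; last exact: torus_pi_continuous.
by apply: cvgD; [exact: cvg_id|exact: cvg_cst].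
Qed.

Lemma torus_add_action (f : Z2 -> R * R) : f 0 = 0 -> {morph f : m n / m + n >-> m + n} ->
  is_Z2_action (fun n (p : torus G) => torus_add p (f n)).
Proof.
move=> f0 fD; split.
- by move=> p; rewrite f0 /torus_add addr0 /torus_pi reprK.
- move=> m n p; rewrite fD -[p]reprK -/(torus_pi G _) !torus_add_pi.
  by rewrite -addrA [f m + _]addrC.
- by move=> n; exact: torus_add_continuous.
Qed.

(* Finiteness of the alphabet turns density of the union of the atoms into the
   covering condition of a topological partition. *)
Lemma generic_topological_partition (A : finType) (P : A -> set (torus G)) :
  (forall a, open (P a)) -> (forall a b p, P a p -> P b p -> a = b) ->
  (forall p, torus_generic p -> exists a, P a p) -> is_topological_partition P.
Proof.
move=> oP dP cP; split=> //.
  move=> a b ab; apply/seteqP; split=> // p [Pa Pb].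
  by move/eqP: ab; apply; exact: dP Pa Pb.
apply/seteqP; split=> // p _; apply: contrapT => hp.
have h a : \forall q \near p, ~ P a q.
  apply: contrapT => ha; apply: hp; exists a => //= B nB.
  apply: contrapT => hB; apply: ha.
  apply: (@filterS _ (nbhs p) _ B) => // q Bq Pq.
  by apply: hB; exists q.
have : \forall q \near p, forall a, ~ P a q.
  exact: (@filter_forall _ A (fun a q => ~ P a q) (nbhs p) (nbhs_filter p) h).
rewrite /prop_near1 nbhsE => -[U [oU Up] sUP].
have [q [Uq gq]] := torus_generic_dense (ex_intro _ p Up) oU.
by have [a Pa] := cP _ gq; exact: sUP _ Uq a Pa.
Qed.

End TorusTopology.

(** * Convex regions *)

Definition hopp (h : halfplane) : halfplane :=
  (zopp h.1.1, zopp h.1.2, zopp h.2).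

Definition zsub (x y : zphi) := zadd x (zopp y).

(* [farkas l l' m]: a positive multiple of [m] is a nonnegative combination of
   [l], [l'] and constants, with a nonzero coefficient. *)
Definition farkas (l l' m : halfplane) : bool :=
  let: (a, b, c) := l in let: (a', b', c') := l' in let: (ma, mb, mc) := m in
  let d := zsub (zmul a b') (zmul a' b) in
  if ~~ zpos d then false else
  let x := zsub (zmul ma b') (zmul mb a') in
  if ~~ znneg x then false else
  let y := zsub (zmul a mb) (zmul b ma) in
  if ~~ znneg y then false else
  let z := zsub (zmul d mc) (zadd (zmul x c) (zmul y c')) in
  znneg z && [|| zpos x, zpos y | zpos z].

(** Both orders of a pair are tried, since [farkas] asks for a positive determinant. *)
Definition implied (hs : seq halfplane) (m : halfplane) : bool :=
  has (fun l => has (fun l' => farkas l l' m) hs) hs.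

Definition emptyb (hs : seq halfplane) : bool :=
  has (fun m => implied hs (hopp m)) hs.

Definition disjointb (hs hs' : seq halfplane) : bool :=
  has (fun m => implied hs' (hopp m)) hs || has (fun m => implied hs (hopp m)) hs'.

Definition nondegenerate (h : halfplane) : bool :=
  [|| zpos h.1.1, zpos (zopp h.1.1), zpos h.1.2 | zpos (zopp h.1.2)].

(* The region [hs] is covered, up to lines, by the convex regions [Ps]: what
   lies beyond an edge of the first region must be covered by the others. *)
Fixpoint cover (Ps : seq (seq halfplane)) (hs : seq halfplane) : bool :=
  if Ps is P :: Ps' then
    if has (fun m => implied hs (hopp m)) P then cover Ps' hs else
    (fix beyond (ms : seq halfplane) (hs : seq halfplane) :=
      if ms is m :: ms' then
        if implied hs m then beyond ms' hs else
        [&& nondegenerate m, cover Ps' (hopp m :: hs) & beyond ms' (m :: hs)]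
      else true) P hs
  else emptyb hs.

Definition zpoint := (zphi * zphi)%type.

Definition hval_at (h : halfplane) (p : zpoint) : zphi :=
  zadd (zadd (zmul h.1.1 p.1) (zmul h.1.2 p.2)) h.2.

(* Positive on the left of the oriented line from [p] to [q]. *)
Definition edge (p q : zpoint) : halfplane :=
  let dx := zsub q.1 p.1 in let dy := zsub q.2 p.2 in
  (zopp dy, dx, zsub (zmul dy p.1) (zmul dx p.2)).

Definition polygon_sides (vs : seq zpoint) := zip vs (rot 1 vs).
Definition edges (vs : seq zpoint) := [seq edge e.1 e.2 | e <- polygon_sides vs].

Definition zc (a b : int) : zphi := (ssrZ.Z_of_int a, ssrZ.Z_of_int b).
Arguments zc (a b)%_Z.

(** Certifies boundedness; 9 exceeds the largest coordinate phi + 3 of a vertex. *)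
Definition big_square : seq halfplane :=
  let z := zc 0 0 in let one := zc 1 0 in let nine := zc 9 0 in
  [:: (one, z, nine); (zopp one, z, nine); (z, one, nine); (z, zopp one, nine)].

(* Convex regions [hs] with a direction [d] of recession. *)
Definition unbounded_region := (seq halfplane * zpoint)%type.

Definition recedes (u : unbounded_region) : bool :=
  let: (hs, d) := u in
  all (fun h => znneg (zadd (zmul h.1.1 d.1) (zmul h.1.2 d.2))) hs &&
  [|| zpos d.1, zpos (zopp d.1), zpos d.2 | zpos (zopp d.2)].

(** The direction of recession is the outer normal of the side. *)
Definition beyond_edge (h : halfplane) : unbounded_region :=
  ([:: hopp h], (zopp h.1.1, zopp h.1.2)).

Definition separated_from_side (e : zpoint * zpoint) (hs : seq halfplane) : bool :=
  has (fun h => znneg (zopp (hval_at h e.1)) && znneg (zopp (hval_at h e.2))) hs.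

(** A certificate that the bounded regions [pcs] and the unbounded regions [exts] are disjoint and
    avoid the boundary of [vs]; that they fill its complement is a hypothesis of
    [separates_interior]. *)
Definition separatesb (vs : seq zpoint) (pcs : seq (seq halfplane))
    (exts : seq unbounded_region) : bool :=
  [&& all (fun hs => all (implied hs) big_square) pcs,
      all recedes exts,
      all (fun hs => all (fun u => disjointb hs u.1) exts) pcs,
      all (fun e => all (separated_from_side e) pcs) (polygon_sides vs) &
      all (fun e => all (fun u => separated_from_side e u.1) exts)
          (polygon_sides vs)].

(* The neighbouring sides confine to a side [e] the points of the line of [e]
   which no side separates from the polygon. *)
Definition convexb (vs : seq zpoint) : bool :=
  let hs := edges vs in
  separatesb vs [:: hs] (map beyond_edge hs) &&
  all (fun e => has (fun h => zpos (hval_at h e.1) && zeq0 (hval_at h e.2)) hs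
             && has (fun h => zpos (hval_at h e.2) && zeq0 (hval_at h e.1)) hs)
      (polygon_sides vs).

Section Regions.
Variable R : realType.
Implicit Types (v : R * R) (h m : halfplane) (hs : seq halfplane).

Definition inside (hs : seq halfplane) (v : R * R) : bool :=
  all (fun h => 0 < hval h v) hs.

Definition zpt (p : zpoint) : R * R := (zR R p.1, zR R p.2).

Lemma zR_zc a b : @zR R (zc a b) = a%:~R + b%:~R * phi R.
Proof. by rewrite /zR /ZR /= !ssrZ.Z_of_intK. Qed.

Lemma zR_sub x y : @zR R (zsub x y) = zR R x - zR R y.
Proof. by rewrite /zsub zR_add zR_opp. Qed.

Lemma hval_opp h v : hval (hopp h) v = - hval h v.
Proof. by rewrite /hval /= !zR_opp; ring. Qed.

Lemma hval_atE h p : zR R (hval_at h p) = hval h (zpt p).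
Proof. by rewrite /hval_at !(zR_add, zR_mul). Qed.

(** Cramer's rule gives d m = x l + y l' + z with d > 0. *)
Lemma farkas_gt0 l l' m v : farkas l l' m ->
  0 < hval l v -> 0 < hval l' v -> 0 < hval m v.
Proof.
case: l l' m => [[a b] c] [[a' b'] c'] [[ma mb] mc] /=.
set d := zsub _ (zmul a' b); set x := zsub _ (zmul mb a').
set y := zsub _ (zmul b ma); set z := zsub _ (zadd _ _).
case: ifPn => // /negPn d0; case: ifPn => // /negPn x0; case: ifPn => // /negPn y0.
move=> /andP[z0 pos] l0 l0'.
have {}x0 := znneg_ge0 R x0; have {}y0 := znneg_ge0 R y0.
have {}z0 := znneg_ge0 R z0; have {}d0 := zpos_gt0 R d0.
rewrite -(pmulr_rgt0 _ d0).
have -> : zR R d * hval (ma, mb, mc) v =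
    zR R x * hval (a, b, c) v + zR R y * hval (a', b', c') v + zR R z.
  by rewrite /hval /= !(zR_sub, zR_add, zR_mul); ring.
have hx : 0 <= zR R x * hval (a, b, c) v by rewrite mulr_ge0// ltW.
have hy : 0 <= zR R y * hval (a', b', c') v by rewrite mulr_ge0// ltW.
case/or3P: pos => /(zpos_gt0 R) p0.
- by have := mulr_gt0 p0 l0; lra.
- by have := mulr_gt0 p0 l0'; lra.
- by lra.
Qed.

Lemma implied_gt0 hs m v : implied hs m -> inside hs v -> 0 < hval m v.
Proof.
move=> /hasP[l hl /hasP[l' hl' fk]] /allP hv.
by apply: farkas_gt0 fk _ _; apply: hv.
Qed.

Lemma implied_all hs ms v : all (implied hs) ms -> inside hs v -> inside ms v.
Proof. by move=> /allP h hv; apply/allP => m /h /implied_gt0; apply. Qed.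

Lemma implied_opp hs m v : implied hs (hopp m) -> inside hs v -> hval m v < 0.
Proof. by move=> /implied_gt0 h /h; rewrite hval_opp oppr_gt0. Qed.

Lemma emptybP hs v : emptyb hs -> ~ inside hs v.
Proof.
move=> /hasP[m hm /implied_opp h] hv; have := h _ hv.
by have /allP/(_ _ hm) m0 := hv; rewrite ltNge ltW.
Qed.

Lemma disjointbP hs hs' v : disjointb hs hs' -> inside hs v -> ~ inside hs' v.
Proof.
move=> /orP[] /hasP[m hm /implied_opp h] hv hv'.
  by have := h _ hv'; have /allP/(_ _ hm) m0 := hv; rewrite ltNge ltW.
by have := h _ hv; have /allP/(_ _ hm) m0 := hv'; rewrite ltNge ltW.
Qed.

Lemma nondegenerate_neq0 h v : nondegenerate h -> generic v -> hval h v != 0.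
Proof.
move=> nh gv; apply/eqP => /gv[a0 b0].
case/or4P: nh => /(zpos_gt0 R); rewrite ?zR_opp ?a0 ?b0 ?oppr0 ltxx //.
Qed.

(** A generic point lies on no edge, so splitting a region into the two open sides of an edge does
    not lose it. *)
Lemma cover_inside Ps hs v : cover Ps hs -> generic v -> inside hs v ->
  exists2 P, P \in Ps & inside P v.
Proof.
move=> + gv; elim: Ps hs => [|P Ps IH] hs /=; first by move=> /emptybP h /h.
case: ifP => _.
  by move=> /IH h /h[Q hQ vQ]; exists Q; rewrite // inE hQ orbT.
suff aux ms hs' : (fix beyond (ms : seq halfplane) (hs : seq halfplane) :=
      if ms is m :: ms' then
        if implied hs m then beyond ms' hs else
        [&& nondegenerate m, cover Ps (hopp m :: hs) & beyond ms' (m :: hs)]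
      else true) ms hs' -> inside hs' v ->
    (exists2 Q, Q \in Ps & inside Q v) \/ inside ms v.
  move=> /aux h /h[[Q hQ vQ]|vP]; first by exists Q; rewrite // inE hQ orbT.
  by exists P; rewrite // inE eqxx.
elim: ms hs' => [|m ms IHm] hs' /=; first by right.
case: ifP => [hm /IHm h hv|_ /and3P[nm cm /IHm h] hv].
  by rewrite (implied_gt0 hm hv) /=; exact: h.
have := nondegenerate_neq0 nm gv; rewrite neq_lt => /orP[m0|m0].
  by left; apply: (IH _ cm); rewrite /= hval_opp oppr_gt0 m0.
by rewrite m0 /=; apply: h; rewrite /= m0.
Qed.

Lemma hval_segment h (a b : R * R) t :
  hval h (a.1 + t * (b.1 - a.1), a.2 + t * (b.2 - a.2)) =
  (1 - t) * hval h a + t * hval h b.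
Proof. by rewrite /hval /=; ring. Qed.

Lemma hval_continuous h : continuous (@hval R h).
Proof.
move=> v; apply: cvgD; last exact: cvg_cst.
by apply: cvgD; (apply: cvgM; first exact: cvg_cst); [exact: cvg_fst|exact: cvg_snd].
Qed.

Lemma inside_open hs : open [set v | inside hs v].
Proof.
elim: hs => [|h hs IH]; first by rewrite (_ : mkset _ = setT) ?eqEsubset//; exact: openT.
rewrite (_ : mkset _ = [set v | 0 < hval h v] `&` [set v | inside hs v]).
  apply: openI => //.
  apply: (@open_comp _ _ (@hval R h) [set x | 0 < x]); last exact: open_gt.
  by move=> v _; exact: hval_continuous.
by apply/seteqP; split=> v /=; [move=> /andP|move=> [-> ->]].
Qed.

End Regions.

(** * Interiors of polygons *)

Section PolygonInterior.
Variable R : realType.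
Local Notation zR := (@zR R).
Local Notation zpt := (@zpt R).
Implicit Types (v : R * R) (h : halfplane) (hs : seq halfplane).

Lemma globally_flat (T : Type) (A B : set T) : A `<=` B ->
  globally A `=>` globally B.
Proof. by move=> AB P BP x /AB; exact: BP. Qed.

Lemma connected_ray (p d : R * R) :
  connected [set (p.1 + s * d.1, p.2 + s * d.2) | s in `[0, +oo[%classic].
Proof.
apply: connected_continuous_connected.
  by apply/connected_intervalP/interval_is_interval.
apply: continuous_subspaceT => s.
apply: (@cvg_pair _ _ _ (nbhs s) (nbhs (p.1 + s * d.1)) (nbhs (p.2 + s * d.2))).
  by apply: cvgD; [exact: cvg_cst|apply: cvgM; [exact: cvg_id|exact: cvg_cst]].
by apply: cvgD; [exact: cvg_cst|apply: cvgM; [exact: cvg_id|exact: cvg_cst]].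
Qed.

Lemma ray_unbounded (p d : R * R) : d != 0 ->
  ~ bounded_set [set (p.1 + s * d.1, p.2 + s * d.2) | s in `[0, +oo[%classic].
Proof.
move=> d0 /ex_strict_bound_gt0[M M0 hM].
have coord (x y : R) : y != 0 ->
    (forall s, 0 <= s -> `|x + s * y| < M) -> False.
  move=> y0 hxy.
  have yp : 0 < `|y| by rewrite normr_gt0.
  pose s := (M + `|x|) / `|y|.
  have s0 : 0 <= s by rewrite divr_ge0// addr_ge0// ltW.
  have sy : `|s * y| = M + `|x| by rewrite normrM (ger0_norm s0) divfK// gt_eqF.
  have := ler_normB (x + s * y) x; rewrite addrAC subrr add0r sy => h.
  by have := hxy s s0; lra.
have hM' s : 0 <= s -> `|(p.1 + s * d.1, p.2 + s * d.2) : R * R| < M.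
  by move=> s0; apply: hM; exists s; rewrite //= in_itv /= s0.
case: (eqVneq d.1 0) => d10.
  apply: (coord p.2 d.2).
    by apply: contra_neq d0 => d20; rewrite [d]surjective_pairing d10 d20.
  by move=> s /hM'; rewrite prod_normE /= gt_max => /andP[].
by apply: (coord p.1 d.1) => // s /hM'; rewrite prod_normE /= gt_max => /andP[].
Qed.

(** The component of a point of V contains an unbounded ray. The component of a point of U meets U
    in a set both open and closed in it, so it stays in U and is bounded. *)
Lemma polygon_interior_split (vs : seq (R * R)) (U V : set (R * R)) :
  open U -> open V -> U `&` V = set0 -> bounded_set U ->
  ~` polygon_boundary vs = U `|` V ->
  (forall p, V p -> exists2 d : R * R, d != 0 &
     forall s : R, 0 <= s -> V (p.1 + s * d.1, p.2 + s * d.2)) ->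
  polygon_interior vs = U.
Proof.
move=> oU oV UV bU bE ray; apply/seteqP; split=> p.
  move=> [np bp]; have : (U `|` V) p by rewrite -bE.
  move=> [//|/ray[d d0 hd]].
  have []// := @ray_unbounded p d d0.
  apply: sub_boundedr bp; apply: globally_flat; apply: connected_component_max.
  - by exists 0; rewrite /= ?in_itv /= ?lexx// !mul0r !addr0 -surjective_pairing.
  - move=> z [s]; rewrite /= in_itv /= andbT => s0 <-.
    have : (U `|` V) (p.1 + s * d.1, p.2 + s * d.2) by right; exact: hd.
    by rewrite -bE.
  - exact: connected_ray.
move=> Up; have np : (~` polygon_boundary vs) p by rewrite bE; left.
split=> //.
set K := connected_component _ p.
have Kp : K p by exact: connected_component_refl.
have KUV : K `<=` U `|` V by rewrite -bE; exact: connected_component_sub.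
have KU : K `&` U = K.
  apply: (@component_connected _ (~` polygon_boundary vs) p).
  - by exists p.
  - by exists U.
  - exists (~` V); first exact: open_closedC.
    apply/seteqP; split=> q [Kq hq]; split=> //.
      by move=> Vq; have : (U `&` V) q by []; rewrite UV.
    by have [] := KUV _ Kq.
apply: sub_boundedr bU; apply: globally_flat.
by rewrite -KU => q [].
Qed.

Lemma polygon_sidesE (vs : seq zpoint) :
  zip (map zpt vs) (rot 1 (map zpt vs)) =
  [seq (zpt e.1, zpt e.2) | e <- polygon_sides vs].
Proof.
rewrite -map_rot /polygon_sides; move: (rot 1 vs) => ws.
by elim: vs ws => [|x s IH] [|y t] //=; rewrite IH.
Qed.

Lemma polygon_boundaryP vs v : polygon_boundary (map zpt vs) v <->
  exists e t, [/\ e \in polygon_sides vs, 0 <= t <= 1 &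
    v = ((zpt e.1).1 + t * ((zpt e.2).1 - (zpt e.1).1),
         (zpt e.1).2 + t * ((zpt e.2).2 - (zpt e.1).2))].
Proof.
rewrite /polygon_boundary /= polygon_sidesE; split.
  by move=> [_ /mapP[e he ->] [t ht vE]]; exists e, t.
move=> [e [t [he ht vE]]]; exists (zpt e.1, zpt e.2).
  by apply/mapP; exists e.
by exists t.
Qed.

Lemma zeq0_hval h p : zeq0 (hval_at h p) -> hval h (zpt p) = 0.
Proof. by move=> /(zeq0P R); rewrite hval_atE. Qed.

Lemma zpos_hval h p : zpos (hval_at h p) -> 0 < hval h (zpt p).
Proof. by move=> /(zpos_gt0 R); rewrite hval_atE. Qed.

Lemma separated_boundary e hs t : separated_from_side e hs -> 0 <= t <= 1 ->
  inside hs ((zpt e.1).1 + t * ((zpt e.2).1 - (zpt e.1).1),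
             (zpt e.1).2 + t * ((zpt e.2).2 - (zpt e.1).2)) -> False.
Proof.
move=> /hasP[h hh /andP[/(znneg_ge0 R) n1 /(znneg_ge0 R) n2]] /andP[t0 t1].
move=> /allP /(_ _ hh); rewrite hval_segment.
rewrite zR_opp hval_atE in n1; rewrite zR_opp hval_atE in n2; nra.
Qed.

(** The covering hypothesis concerns every point off the boundary, including nongeneric ones, so
    [cover] cannot supply it. *)
Theorem separates_interior vs pcs exts : separatesb vs pcs exts ->
  (forall v, ~ polygon_boundary (map zpt vs) v ->
     has (fun hs => inside hs v) pcs || has (fun u => inside u.1 v) exts) ->
  polygon_interior (map zpt vs) = [set v | has (fun hs => inside hs v) pcs].
Proof.
move=> /and5P[/allP bnd /allP rec /allP disj /allP sepP /allP sepE] cov.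
have op (T : Type) (f : T -> seq halfplane) l :
    open [set v : R * R | has (fun x => inside (f x) v) l].
  elim: l => [|x l IH]; first by rewrite (_ : mkset _ = set0); [exact: open0|apply/seteqP; split].
  rewrite (_ : mkset _ = [set v | inside (f x) v] `|` [set v | has (fun x => inside (f x) v) l]).
    by apply: openU => //; exact: inside_open.
  by apply/seteqP; split=> v /=; [move=> /orP|move=> h; apply/orP].
apply: (@polygon_interior_split _ _ [set v | has (fun u => inside u.1 v) exts]).
- exact: (op _ id).
- exact: op.
- apply/seteqP; split=> // v [/= /hasP[hs hsP hv] /hasP[u uE uv]].
  have /allP/(_ _ uE) := disj _ hsP.
  by move=> /disjointbP/(_ hv).
- exists 9; split; first exact: num_real.
  move=> M M9 v /= /hasP[hs /bnd/implied_all h /h].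
  rewrite /inside /= /hval /=.
  rewrite !zR_opp !zR_zc => /and5P[h1 h2 h3 h4 _].
  rewrite prod_normE /= ge_max !ler_norml; apply/andP; split; lra.
- apply/seteqP; split=> v /=.
    by move=> /cov/orP[]; [left|right].
  move=> hv /polygon_boundaryP[e [t [he ht vE]]].
  case: hv => /= /hasP[x hx]; rewrite vE.
    by apply: separated_boundary ht; have /allP := sepP _ he; exact.
  by apply: separated_boundary ht; have /allP/(_ _ hx) := sepE _ he.
- move=> p /= /hasP[[hs d] hE hp].
  have /andP[/allP hd d0] := rec _ hE.
  exists (zpt d).
    apply/eqP => dE; have d1 : zR d.1 = 0 by rewrite -[LHS]/(zpt d).1 dE.
    have d2 : zR d.2 = 0 by rewrite -[LHS]/(zpt d).2 dE.
    by case/or4P: d0 => /(zpos_gt0 R); rewrite ?zR_opp ?d1 ?d2 ?oppr0 ltxx.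
  move=> s s0; apply/hasP; exists (hs, d) => //; apply/allP => h hh.
  have /allP/(_ _ hh) p0 := hp; have /(znneg_ge0 R) := hd _ hh.
  rewrite zR_add !zR_mul /hval /= => dh.
  have -> : zR h.1.1 * (p.1 + s * zR d.1) + zR h.1.2 * (p.2 + s * zR d.2) + zR h.2 =
    hval h p + s * (zR h.1.1 * zR d.1 + zR h.1.2 * zR d.2) by rewrite /hval; ring.
  by rewrite ltr_wpDr// mulr_ge0.
Qed.

Lemma on_edge_line p q v : zpt p != zpt q -> hval (edge p q) v = 0 ->
  exists t, v = ((zpt p).1 + t * ((zpt q).1 - (zpt p).1),
                 (zpt p).2 + t * ((zpt q).2 - (zpt p).2)).
Proof.
move=> pq; rewrite /hval /= !(zR_sub, zR_opp, zR_mul) => h0.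
case: (eqVneq (zR q.1) (zR p.1)) => e1.
  have e2 : zR q.2 - zR p.2 != 0.
    by rewrite subr_eq0; apply: contra_neq pq => e2; rewrite /zpt e1 e2.
  exists ((v.2 - zR p.2) / (zR q.2 - zR p.2)).
  rewrite divfK// [LHS]surjective_pairing e1 subrr mulr0 addr0; congr pair; last by ring.
  by apply: (mulfI e2); move: h0; rewrite e1; lra.
have e2 : zR q.1 - zR p.1 != 0 by rewrite subr_eq0.
exists ((v.1 - zR p.1) / (zR q.1 - zR p.1)).
rewrite [LHS]surjective_pairing divfK//; congr pair; first by ring.
apply: (mulfI e2); rewrite mulrDr [X in _ = _ + X]mulrA [_ * (_ / _)]mulrC divfK//.
by move: h0; lra.
Qed.

(** A point neither inside nor strictly beyond a side lies on the line of some side; the two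
    neighbouring sides, nonnegative there, confine its parameter to [0, 1], which puts it on the
    boundary. *)
Lemma convex_interior vs : convexb vs ->
  polygon_interior (map zpt vs) = [set v | inside (edges vs) v].
Proof.
move=> /andP[sep /allP nb].
rewrite (separates_interior sep) => [|v nbv].
  by apply/seteqP; split=> v /=; rewrite orbF.
rewrite /= orbF; case: (boolP (inside _ _)) => //= nin; apply/hasP.
suff [h hh h0] : exists2 h, h \in edges vs & hval h v < 0.
  by exists (beyond_edge h); rewrite ?map_f//= hval_opp oppr_gt0 h0.
apply: contrapT => /forall2NP hn.
have ge0 h : h \in edges vs -> 0 <= hval h v.
  by move=> hh; case: (hn h) => // /negP; rewrite -leNgt.
move: nin => /allPn[_ /mapP[e he ->]]; rewrite -leNgt => le0.
have e0 : hval (edge e.1 e.2) v = 0.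
  by apply/eqP; rewrite eq_le le0 ge0//; apply: map_f.
have /andP[/hasP[h1 hh1 /andP[p1 z1]] /hasP[h2 hh2 /andP[p2 z2]]] := nb _ he.
have {}p1 := zpos_hval p1; have {}p2 := zpos_hval p2.
have {}z1 := zeq0_hval z1; have {}z2 := zeq0_hval z2.
have ne : zpt e.1 != zpt e.2.
  by apply: contra_eq_neq z1 => <-; rewrite gt_eqF.
have [t vE] := on_edge_line ne e0.
have := ge0 _ hh1; have := ge0 _ hh2; rewrite vE !hval_segment z1 z2 => t0 t1.
apply: nbv; apply/polygon_boundaryP; exists e, t; split=> //.
by apply/andP; split; nra.
Qed.

End PolygonInterior.

(** * The polygons over Z[phi] *)

Definition z0 := zc 0 0.
Definition z1 := zc 1 0.
Definition z2 := zc 2 0.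
Definition zf := zc 0 1.
Definition zs := zc (-1) 1.
Definition zt := zc 2 (-1).
Definition zu := zc (-3) 2.
Definition z2t := zc 4 (-2).
Definition zp1 := zc 1 1.
Definition zp2 := zc 2 1.
Definition zp3 := zc 3 1.

Definition zpolygonsU : seq (seq zpoint) :=
  [:: [:: (zs, zs); (z2t, zs); (zs, z2t)];
      [:: (z2t, zs); (z1, zs); (z1, z1); (zs, z1); (zs, z2t)];
      [:: (zu, zs); (zt, zs); (z0, z1)];
      [:: (z0, zs); (zu, zs); (z0, z1)];
      [:: (zs, zs); (zs, z2t); (zt, z1)];
      [:: (zs, z2t); (zs, z1); (zt, z1)];
      [:: (zt, zs); (zt, z1); (z0, z1)];
      [:: (zt, zs); (zs, zs); (zt, z1)];
      [:: (zs, z0); (z1, z0); (zs, zt)];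
      [:: (z1, z0); (z1, zt); (z2t, zs); (zs, zs)];
      [:: (z1, zt); (z1, zs); (z2t, zs)];
      [:: (zs, zt); (z1, z0); (zs, zs)];
      [:: (zt, zt); (zt, zs); (zu, zs)];
      [:: (zs, z0); (zs, zt); (zt, zs); (zt, zt)];
      [:: (zt, z0); (zt, zt); (zu, zs); (z0, zs)];
      [:: (zt, z0); (zs, z0); (zt, zt)];
      [:: (z0, z0); (zt, z0); (z0, zt)];
      [:: (zt, z0); (z0, zs); (z0, zt)];
      [:: (zs, zt); (zs, zs); (zt, zs)]].

Definition zpolygons0 : seq (seq (seq zpoint)) :=
  [:: [:: [:: (z0, z0); (zs, z0); (zs, z1)];
          [:: (zs, z0); (z1, z0); (z1, z1)];
          [:: (z1, z0); (zf, z0); (zf, z1)]];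
      [:: [:: (z0, z0); (zs, z1); (z0, z1)];
          [:: (zs, z0); (z1, z1); (zs, z1)];
          [:: (z1, z0); (zf, z1); (z1, z1)]];
      [:: [:: (z0, z2); (zs, zp2); (z0, zp1)]];
      [:: [:: (z1, z1); (zf, z2); (zf, zp2); (z1, z2)]];
      [:: [:: (z0, z2); (z1, zp2); (z1, zp3)]];
      [:: [:: (z0, zp1); (zs, zp2); (z1, zp3); (zt, zp2); (zt, zp3); (z0, zp2)]];
      [:: [:: (z0, zp2); (zt, zp3); (z0, zp3)];
          [:: (zt, zp2); (z1, zp3); (zt, zp3)];
          [:: (z1, zp2); (zf, zp3); (z1, zp3)]];
      [:: [:: (z0, z1); (z1, zp2); (z0, z2)];
          [:: (z1, zp1); (zf, zp2); (zf, zp3); (z1, zp2)]];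
      [:: [:: (zs, z1); (zf, zp2); (zs, z2)]];
      [:: [:: (z0, z1); (zs, z1); (zs, z2)];
          [:: (zs, z1); (z1, z1); (z1, z2)];
          [:: (z1, z1); (zf, z1); (zf, z2)]];
      [:: [:: (z0, z1); (z1, zp1); (z1, zp2)]]].

(* The only nonconvex polygon, atom 5 of [P0], is its convex hull minus the
   notch between sides 2 and 3. *)
Definition hexagon : seq zpoint := nth [::] (nth [::] zpolygons0 5) 0.
Definition hexagon_side i := nth ((z0, z0, z0) : halfplane) (edges hexagon) i.
Definition hexagon_hull : seq halfplane :=
  [:: hexagon_side 0; hexagon_side 1; hexagon_side 4; hexagon_side 5].
Definition hexagon_pieces : seq (seq halfplane) :=
  [:: hexagon_side 3 :: hexagon_hull; hexagon_side 2 :: hexagon_hull].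
(** The notch is prolonged upwards, past the segment joining its two tips, into an unbounded
    wedge. *)
Definition hexagon_exterior : seq unbounded_region :=
  ([:: hopp (hexagon_side 2); hopp (hexagon_side 3)], (z0, z1))
  :: map beyond_edge hexagon_hull.

(** The fallback is meaningful for [hexagon] only. *)
Definition pieces (vs : seq zpoint) : seq (seq halfplane) :=
  if convexb vs then [:: edges vs] else hexagon_pieces.

Definition piecesU : seq (seq (seq halfplane)) :=
  Eval vm_compute in map pieces zpolygonsU.
Definition pieces0 : seq (seq (seq halfplane)) :=
  Eval vm_compute in map (fun ps => flatten (map pieces ps)) zpolygons0.

Lemma piecesUE : piecesU = map pieces zpolygonsU.
Proof. by vm_compute. Qed.

Lemma pieces0E : pieces0 = map (fun ps => flatten (map pieces ps)) zpolygons0.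
Proof. by vm_compute. Qed.

Definition rectangle (a b : zphi) : seq halfplane :=
  [:: (z1, z0, z0); (zopp z1, z0, a); (z0, z1, z0); (z0, zopp z1, b)].

Definition partitionb (P : seq (seq (seq halfplane))) (box : seq halfplane) :=
  [&& all (all (fun hs => all (implied hs) box)) P,
      all (fun i => all (fun j => (i == j) ||
         all (fun hs => all (disjointb hs) (nth [::] P j)) (nth [::] P i))
       (iota 0 (size P))) (iota 0 (size P)) &
      cover (flatten P) box].

Section PolygonData.
Variable R : realType.
Local Notation phi := (phi R).
Local Notation zpt := (@zpt R).

Lemma polygonsUE : polygonsU R = map (map zpt) zpolygonsU.
Proof.
rewrite /polygonsU /zpolygonsU /= /zpt /= !zR_zc phiV phiV2 phiV3.
by do ![congr (_ :: _)]; congr (_, _); rewrite ?mulr1z ?mulr0z; ring.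
Qed.

Lemma polygons0E : polygons0 R = map (map (map zpt)) zpolygons0.
Proof.
rewrite /polygons0 /zpolygons0 /= /zpt /= !zR_zc phiV phiV2.
by do ![congr (_ :: _)]; congr (_, _); rewrite ?mulr1z ?mulr0z; ring.
Qed.

Definition hexagon_vertex i : zpoint := nth (z0, z0) hexagon i.

Lemma hexagon_side_line i v : (i < 6)%N -> hval (hexagon_side i) v = 0 ->
  exists t, (forall h, hval h v =
      (1 - t) * hval h (zpt (hexagon_vertex i)) +
      t * hval h (zpt (hexagon_vertex (i.+1 %% 6)))) /\
    (0 <= t <= 1 -> polygon_boundary (map zpt hexagon) v).
Proof.
move=> i6; have -> : hexagon_side i =
    edge (hexagon_vertex i) (hexagon_vertex (i.+1 %% 6)).
  by case: i i6 => [|[|[|[|[|[|?]]]]]] // _; vm_compute.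
have ne : zpt (hexagon_vertex i) != zpt (hexagon_vertex (i.+1 %% 6)).
  have : nondegenerate (edge (hexagon_vertex i) (hexagon_vertex (i.+1 %% 6))).
    by case: i i6 => [|[|[|[|[|[|?]]]]]] // _; vm_compute.
  move=> nd; apply/eqP => -[e1 e2].
  by case/or4P: nd => /(zpos_gt0 R);
    rewrite /= !(zR_opp, zR_sub) ?e1 ?e2 subrr ?oppr0 ltxx.
move=> /(on_edge_line ne)[t vE]; exists t; split.
  by move=> h; rewrite vE hval_segment.
move=> t01; apply/polygon_boundaryP; exists (hexagon_vertex i, hexagon_vertex (i.+1 %% 6)), t.
by split=> //; case: i i6 {ne vE} => [|[|[|[|[|[|?]]]]]] // _; vm_compute.
Qed.

(** Same principle as for convex polygons. Next to the notch the confining side is replaced by the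
    alternative [hK], of which only one branch can hold. *)
Lemma hexagon_cover v : ~ polygon_boundary (map zpt hexagon) v ->
  has (fun hs => inside hs v) hexagon_pieces ||
  has (fun u => inside u.1 v) hexagon_exterior.
Proof.
move=> nb; have seg i : (i < 6)%N -> hval (hexagon_side i) v = 0 ->
    exists t, (forall h, hval h v =
      (1 - t) * hval h (zpt (hexagon_vertex i)) +
      t * hval h (zpt (hexagon_vertex (i.+1 %% 6)))) /\ ~ (0 <= t <= 1).
  by move=> i6 /(hexagon_side_line i6)[t [hE tb]]; exists t; split=> // /tb.
have P i j : zpos (hval_at (hexagon_side i) (hexagon_vertex j)) ->
  0 < hval (hexagon_side i) (zpt (hexagon_vertex j)) by exact: zpos_hval.
have Z i j : zeq0 (hval_at (hexagon_side i) (hexagon_vertex j)) ->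
  hval (hexagon_side i) (zpt (hexagon_vertex j)) = 0 by exact: zeq0_hval.
have N i j : zpos (zopp (hval_at (hexagon_side i) (hexagon_vertex j))) ->
  hval (hexagon_side i) (zpt (hexagon_vertex j)) < 0.
  by move=> /(zpos_gt0 R); rewrite zR_opp hval_atE oppr_gt0.
have L i j k : zpos (zsub (hval_at (hexagon_side i) (hexagon_vertex j))
    (hval_at (hexagon_side i) (hexagon_vertex k))) ->
  hval (hexagon_side i) (zpt (hexagon_vertex k)) <
  hval (hexagon_side i) (zpt (hexagon_vertex j)).
  by move=> /(zpos_gt0 R); rewrite zR_sub !hval_atE subr_gt0.
apply/orP; rewrite /hexagon_pieces /hexagon_exterior /hexagon_hull /= !hval_opp !oppr_gt0 !andbT !orbF.
set h := fun i => hval (hexagon_side i) v.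
rewrite -![hval (hexagon_side _) v]/(h _).
case: (ltP (h 0%N) 0) => h0; first by right; rewrite !orbT.
case: (ltP (h 1%N) 0) => h1; first by right; rewrite !orbT.
case: (ltP (h 4%N) 0) => h4; first by right; rewrite !orbT.
case: (ltP (h 5%N) 0) => h5; first by right; rewrite !orbT.
case: (boolP ((h 2%N < 0) && (h 3%N < 0))) => [_|]; first by right.
rewrite negb_and -!leNgt => hK; left.
have {}h0 : 0 < h 0%N.
  rewrite lt_neqAle h0 andbT eq_sym; apply/eqP => /(seg 0%N isT)[t [hE []]].
  move: h1 h5; rewrite /h !hE (Z 5%N 0%N) // (Z 1%N 1%N) // => h1 h5.
  have := P 5%N 1%N isT; have := P 1%N 0%N isT; rewrite /= in h1 h5 *.
  by move=> *; apply/andP; split; nra.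
have {}h1 : 0 < h 1%N.
  rewrite lt_neqAle h1 andbT eq_sym; apply/eqP => /(seg 1%N isT)[t [hE []]].
  move: h0 hK; rewrite /h !hE (Z 0%N 1%N) // (Z 2%N 2%N) // => h0 hK.
  (* Along side 1 the value of side 3 starts negative and decreases, so for t >= 0 only side 2 can
     be nonnegative, which gives t <= 1. *)
  have := P 0%N 2%N isT; have := P 2%N 1%N isT; have := N 3%N 1%N isT.
  have := L 3%N 1%N 2%N isT; rewrite /= in h0 hK *.
  move=> *; have t0 : 0 <= t by nra.
  by rewrite t0 /=; case/orP: hK => hK; nra.
have {}h4 : 0 < h 4%N.
  rewrite lt_neqAle h4 andbT eq_sym; apply/eqP => /(seg 4%N isT)[t [hE []]].
  move: h5 hK; rewrite /h !hE (Z 5%N 5%N) // (Z 3%N 4%N) // => h5 hK.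
  have := P 5%N 4%N isT; have := P 3%N 5%N isT; have := N 2%N 5%N isT.
  have := L 2%N 5%N 4%N isT; rewrite /= in h5 hK *.
  move=> *; have t1 : t <= 1 by nra.
  by rewrite t1 andbT; case/orP: hK => hK; nra.
have {}h5 : 0 < h 5%N.
  rewrite lt_neqAle h5 andbT eq_sym; apply/eqP => /(seg 5%N isT)[t [hE []]].
  move: h0 h4; rewrite /h !hE (Z 0%N 0%N) // (Z 4%N 5%N) // => h0 h4.
  have := P 0%N 5%N isT; have := P 4%N 0%N isT; rewrite /= in h0 h4 *.
  by move=> *; apply/andP; split; nra.
rewrite h0 h1 h4 h5 /= !andbT.
case: (ltP 0 (h 3%N)) => //= h3; case: (ltP 0 (h 2%N)) => //= h2; exfalso.
case/orP: hK => hK.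
  have /(seg 2%N isT)[t [hE []]] : h 2%N = 0 by apply/eqP; rewrite eq_le h2 hK.
  move: h1 h3; rewrite /h !hE (Z 1%N 2%N) // (Z 3%N 3%N) // => h1 h3.
  have := P 1%N 3%N isT; have := N 3%N 2%N isT; rewrite /= in h1 h3 *.
  by move=> *; apply/andP; split; nra.
have /(seg 3%N isT)[t [hE []]] : h 3%N = 0 by apply/eqP; rewrite eq_le h3 hK.
move: h4 h2; rewrite /h !hE (Z 4%N 4%N) // (Z 2%N 3%N) // => h4 h2.
have := P 4%N 3%N isT; have := N 2%N 4%N isT; rewrite /= in h4 h2 *.
by move=> *; apply/andP; split; nra.
Qed.

Lemma pieces_interior vs : convexb vs || (vs == hexagon) ->
  polygon_interior (map zpt vs) = [set v | has (fun hs => inside hs v) (pieces vs)].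
Proof.
rewrite /pieces; case: ifP => [cv _|_ /= /eqP ->].
  by rewrite convex_interior//; apply/seteqP; split=> v /=; rewrite orbF.
by apply: separates_interior hexagon_cover; vm_compute.
Qed.

End PolygonData.

(** * Fundamental domains *)

Lemma pair_mulrz (V W : zmodType) (p : V * W) (m : int) : p *~ m = (p.1 *~ m, p.2 *~ m).
Proof.
case: m => n /=; first by rewrite -!pmulrn; elim: n => [|n IH]; rewrite ?mulrS ?IH.
rewrite !NegzE !mulrNz -!pmulrn.
have -> : p *+ n.+1 = (p.1 *+ n.+1, p.2 *+ n.+1).
  by elim: n.+1 => [|k IH]; rewrite ?mulrS ?IH.
by [].
Qed.

Section BoxLattice.
Variables (R : realType) (G : lattice R) (L1 L2 e : zphi).
Hypothesis G1 : gen1 G = (zR R L1, 0).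
Hypothesis G2 : gen2 G = (zR R e, zR R L2).
Hypotheses (L1_gt0 : zpos L1) (L2_gt0 : zpos L2).
Implicit Types v w : R * R.

Let l1 : 0 < zR R L1. Proof. exact: zpos_gt0. Qed.
Let l2 : 0 < zR R L2. Proof. exact: zpos_gt0. Qed.

Lemma box_latticeP w : lattice_set G w <-> exists m n : int,
  w = (zR R L1 * m%:~R + zR R e * n%:~R, zR R L2 * n%:~R).
Proof.
have E m n : gen1 G *~ m + gen2 G *~ n =
    (zR R L1 * m%:~R + zR R e * n%:~R, zR R L2 * n%:~R).
  rewrite G1 G2 !pair_mulrz /= mul0rz !mulrzr.
  by congr (_, _); rewrite /= add0r.
by split=> -[m [n ->]]; exists m, n; rewrite E.
Qed.

Lemma inside_rectangle a b v : inside (rectangle a b) v =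
  (0 < v.1 < zR R a) && (0 < v.2 < zR R b).
Proof.
have x0 : zR R z0 = 0 by rewrite zR_zc mul0r addr0.
have x1 : zR R z1 = 1 by rewrite zR_zc mul0r addr0.
rewrite /inside /= /hval /= !zR_opp x0 x1 !mul0r !addr0 !add0r !mul1r !mulN1r.
by rewrite ![- _ + _]addrC !subr_gt0 andbT -!andbA.
Qed.

(** The second coordinate comes first: it involves n alone, and n = 0 removes the skew [e]. *)
Lemma box_uniq v w : inside (rectangle L1 L2) v -> inside (rectangle L1 L2) w ->
  torus_pi G v = torus_pi G w -> v = w.
Proof.
rewrite !inside_rectangle => /andP[v1 v2] /andP[w1 w2] /torus_pi_eq /box_latticeP.
move=> [m [n [e1 e2]]].
have small (x L : R) (k : int) : 0 < L -> x = L * k%:~R -> - L < x < L -> k = 0.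
  move=> L0 -> /andP[h1 h2].
  have h3 : k%:~R < 1%:~R :> R by rewrite -(ltr_pM2l L0) mulr1.
  have h4 : (-1)%:~R < k%:~R :> R by rewrite -(ltr_pM2l L0) mulrN1z mulrN1.
  by move: h3 h4; rewrite !ltr_int; clear; lia.
have n0 : n = 0 by apply: (small _ _ _ l2 e2); lra.
rewrite n0 mulr0 addr0 in e1; rewrite n0 mulr0 in e2.
have m0 : m = 0 by apply: (small _ _ _ l1 e1); lra.
rewrite m0 mulr0 in e1.
by rewrite [v]surjective_pairing [w]surjective_pairing; congr pair; apply/eqP;
  rewrite -subr_eq0 ?e1 ?e2.
Qed.

Lemma generic_coord_neq0 v : generic v -> v.1 != 0 /\ v.2 != 0.
Proof.
have x0 : zR R z0 = 0 by rewrite zR_zc mul0r addr0.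
have x1 : zR R z1 = 1 by rewrite zR_zc mul0r addr0.
move=> gv; split; apply/eqP => v0.
  have [|h _] := gv (z1, z0, z0).
    by rewrite /hval /= x0 x1 v0 mulr0 mul0r !addr0.
  by move: h; rewrite /= x1 => /eqP; rewrite oner_eq0.
have [|_ h] := gv (z0, z1, z0).
  by rewrite /hval /= x0 x1 v0 mulr0 mul0r !addr0.
by move: h; rewrite /= x1 => /eqP; rewrite oner_eq0.
Qed.

Lemma box_rep w : generic w ->
  exists v, [/\ generic v, inside (rectangle L1 L2) v & torus_pi G v = torus_pi G w].
Proof.
move=> gw.
pose n : int := Num.floor (w.2 / zR R L2).
pose m : int := Num.floor ((w.1 - zR R e * n%:~R) / zR R L1).
pose d1 := zopp (zadd (zmul L1 (zc m 0)) (zmul e (zc n 0))).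
pose d2 := zopp (zmul L2 (zc n 0)).
have d1E : zR R d1 = - (zR R L1 * m%:~R + zR R e * n%:~R).
  by rewrite /d1 !(zR_opp, zR_add, zR_mul) !zR_zc !mul0r !addr0.
have d2E : zR R d2 = - (zR R L2 * n%:~R).
  by rewrite /d2 !(zR_opp, zR_mul) !zR_zc !mul0r !addr0.
have gv := @generic_translate R d1 d2 w gw.
exists (w.1 + zR R d1, w.2 + zR R d2); rewrite inside_rectangle; split; first exact: gv.
  have [/= v1 v2] := generic_coord_neq0 gv.
  have fl (x L : R) : 0 < L ->
      0 <= x - L * (Num.floor (x / L))%:~R < L.
    move=> L0; have h1 := Num.Theory.floor_le (x / L); have h2 := Num.Theory.floorD1_gt (x / L).
    have {}h1 : L * (Num.floor (x / L))%:~R <= x by rewrite mulrC -ler_pdivlMr.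
    have {}h2 : x < L * (Num.floor (x / L) + 1)%:~R by rewrite mulrC -ltr_pdivrMr.
    by rewrite intrD mulrDr mulr1 in h2; apply/andP; split; lra.
  have := fl w.2 _ l2; have := fl (w.1 - zR R e * n%:~R) _ l1.
  rewrite /= -/n -/m !lt_neqAle ![0 == _]eq_sym v1 v2 d1E d2E /=.
  have -> : w.1 - zR R e * n%:~R - zR R L1 * m%:~R =
    w.1 - (zR R L1 * m%:~R + zR R e * n%:~R) by ring.
  by rewrite -!lt_neqAle => -> ->.
apply/torus_pi_eq/box_latticeP; exists (- m), (- n).
rewrite d1E d2E /= [X in _ - X]surjective_pairing.
by congr (_, _) => /=; rewrite !intrN; ring.
Qed.

End BoxLattice.

Section BoxPartition.
Variables (R : realType) (G : lattice R) (L1 L2 e : zphi).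
Hypothesis G1 : gen1 G = (zR R L1, 0).
Hypothesis G2 : gen2 G = (zR R e, zR R L2).
Hypotheses (L1_gt0 : zpos L1) (L2_gt0 : zpos L2).
Variables (n : nat) (Ps : seq (seq (seq halfplane))) (P : 'I_n -> set (torus G)).
Hypothesis size_Ps : size Ps = n.
Hypothesis Ps_partition : partitionb Ps (rectangle L1 L2).
Hypothesis PE : forall a : 'I_n, P a =
  torus_pi G @` [set v | has (fun hs => inside hs v) (nth [::] Ps a)].
Implicit Types v w : R * R.

Let uniq_rep := box_uniq G1 G2 L1_gt0 L2_gt0.

Lemma piece_in_box (a : 'I_n) v :
  has (fun hs => inside hs v) (nth [::] Ps a) -> inside (rectangle L1 L2) v.
Proof.
have /and3P[/allP h _ _] := Ps_partition.
have hP : nth [::] Ps a \in Ps by rewrite mem_nth// size_Ps.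
by move=> /hasP[hs hsP]; have /allP/(_ _ hsP)/implied_all := h _ hP; apply.
Qed.

Lemma atom_inside (a : 'I_n) v : inside (rectangle L1 L2) v ->
  P a (torus_pi G v) <-> has (fun hs => inside hs v) (nth [::] Ps a).
Proof.
move=> hv; rewrite PE; split=> [[w /= hw e']|h]; last by exists v.
by rewrite -(uniq_rep _ _ e')// (piece_in_box hw).
Qed.

Lemma atom_open a : open (P a).
Proof.
rewrite PE; apply: torus_pi_open; elim: (nth _ _ _) => [|hs l IH].
  by rewrite (_ : mkset _ = set0); [exact: open0|apply/seteqP; split].
rewrite (_ : mkset _ = [set v | inside hs v] `|` [set v | has (fun hs => inside hs v) l]).
  by apply: openU => //; exact: inside_open.
by apply/seteqP; split=> v /=; [move=> /orP|move=> h; apply/orP].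
Qed.

Lemma atom_disj a b p : P a p -> P b p -> a = b.
Proof.
rewrite !PE => -[v /= hv <-] [w /= hw e'].
have vw := uniq_rep (piece_in_box hw) (piece_in_box hv) e'.
rewrite vw in hw; have /and3P[_ /allP h _] := Ps_partition.
have io (c : 'I_n) : nat_of_ord c \in iota 0 (size Ps) by rewrite mem_iota size_Ps /=.
have /allP/(_ _ (io b)) /orP[/eqP/val_inj//|/allP hd] := h _ (io a).
move: hv hw => /hasP[hs hsP hv] /hasP[hs' hsP' hw].
by have /allP/(_ _ hsP')/disjointbP/(_ hv) := hd _ hsP.
Qed.

Lemma atom_cover_box v : generic v -> inside (rectangle L1 L2) v ->
  exists a : 'I_n, has (fun hs => inside hs v) (nth [::] Ps a).
Proof.
move=> gv hv; have /and3P[_ _ cov] := Ps_partition.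
have [Q /flattenP[pcs /(nthP [::])[i hi <-] hQ] Qv] := cover_inside cov gv hv.
rewrite size_Ps in hi; exists (Ordinal hi).
by apply/hasP; exists Q.
Qed.

Lemma atom_cover p : torus_generic p -> exists a, P a p.
Proof.
move=> [w gw <-]; have [v [gv hv <-]] := box_rep G1 G2 L1_gt0 L2_gt0 gw.
by have [a ha] := atom_cover_box gv hv; exists a; apply/atom_inside.
Qed.

Lemma atom_topological_partition : is_topological_partition P.
Proof.
apply: generic_topological_partition; [exact: atom_open| |exact: atom_cover].
by move=> a b p; exact: atom_disj.
Qed.

End BoxPartition.

(** * The given partitions as unions of convex pieces *)

Section ExplicitPartitions.
Variable R : realType.

Lemma polygons_atom_pieces (G : lattice R) (ps : seq (seq zpoint)) :
  all (fun vs => convexb vs || (vs == hexagon)) ps ->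
  @polygons_atom R G (map (map (@zpt R)) ps) =
  torus_pi G @` [set v | has (fun hs => inside hs v) (flatten (map pieces ps))].
Proof.
move=> /allP hps; rewrite /polygons_atom; congr image; apply/seteqP; split=> v /=.
  move=> [vs /mapP[ws hws ->]]; rewrite pieces_interior; last exact: hps.
  move=> /= /hasP[hs hsP hv]; apply/hasP; exists hs => //.
  by apply/flattenP; exists (pieces ws) => //; exact: map_f.
move=> /hasP[hs /flattenP[_ /mapP[ws hws ->] hsP] hv].
exists (map (@zpt R) ws); first exact: (map_f (map (@zpt R))).
by rewrite pieces_interior; [apply/hasP; exists hs|exact: hps].
Qed.

Lemma PUE (a : 'I_19) : @PU R a =
  torus_pi (latticeZ2 R) @` [set v | has (fun hs => inside hs v) (nth [::] piecesU a)].
Proof.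
have ha : (a < size zpolygonsU)%N by [].
rewrite /PU polygonsUE (nth_map [::])//.
rewrite (@polygons_atom_pieces (latticeZ2 R) [:: nth [::] zpolygonsU a]).
  by rewrite piecesUE (nth_map [::])// [flatten _]/= cats0.
have /allP h : all convexb zpolygonsU by vm_compute.
by rewrite /= h// mem_nth.
Qed.

Lemma P0E (a : 'I_11) : @P0 R a =
  torus_pi (lattice0 R) @` [set v | has (fun hs => inside hs v) (nth [::] pieces0 a)].
Proof.
have ha : (a < size zpolygons0)%N by [].
rewrite /P0 polygons0E (nth_map [::])// polygons_atom_pieces.
  by rewrite pieces0E (nth_map [::]).
have /allP h : all (all (fun vs => convexb vs || (vs == hexagon))) zpolygons0 by vm_compute.
by apply: h; rewrite mem_nth.
Qed.

Lemma piecesU_partition : partitionb piecesU (rectangle z1 z1).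
Proof. by vm_compute. Qed.

Lemma pieces0_partition : partitionb pieces0 (rectangle zf zp3).
Proof. by vm_compute. Qed.

Lemma latticeZ2_gen1 : gen1 (latticeZ2 R) = (zR R z1, 0).
Proof. by rewrite zR_zc mul0r addr0. Qed.

Lemma latticeZ2_gen2 : gen2 (latticeZ2 R) = (zR R z0, zR R z1).
Proof. by rewrite !zR_zc !mul0r !addr0. Qed.

Lemma lattice0_gen1 : gen1 (lattice0 R) = (zR R zf, 0).
Proof. by rewrite zR_zc mul1r add0r. Qed.

Lemma lattice0_gen2 : gen2 (lattice0 R) = (zR R z1, zR R zp3).
Proof. by rewrite !zR_zc mul0r addr0 mul1r addrC. Qed.

End ExplicitPartitions.

(** * Towers over an affine copy of the unit square *)

Definition strip (x : bool) (a c : zphi) : halfplane :=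
  if x then (a, z0, c) else (z0, a, c).

Definition pieceU (b : nat) : seq halfplane := head [::] (nth [::] piecesU b).

(* [classU x b]: the atom [b] of [PU] lies in the band [x < s] (or [y < s]);
   otherwise it lies in [x > s] (or [y > s]). *)
Definition classU (x : bool) (b : nat) : bool :=
  implied (pieceU b) (strip x (zopp z1) zs).

(** A bounded search: the multiples that occur are at most 5 in absolute value. *)
Definition lattice_multiple (L x : zphi) : bool :=
  has (fun k => zeq0 (zsub x (zmul (zc k 0) L)))
      [seq k%:Z | k <- iota 0 20] || 
  has (fun k => zeq0 (zadd x (zmul (zc k 0) L))) [seq k%:Z | k <- iota 0 20].

(* The floors [c * (0, s) + xs_i] and [c * (s, 1) + xs_j], [j < n], of a
   Rokhlin tower of the rotation by [r] modulo [L], whose base [c * (0, 1) + xs_0]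
   returns to itself as the rotation by [t] of the unit circle; [ci] is the
   inverse of [c]. *)
Definition tower_strips (x : bool) (ci : zphi) (xs : seq zphi) (n : nat) :
    seq (seq halfplane) :=
  [seq [:: strip x ci (zopp (zmul ci o)); strip x (zopp ci) (zadd zs (zmul ci o))]
     | o <- xs] ++
  [seq [:: strip x ci (zopp (zadd zs (zmul ci o)));
           strip x (zopp ci) (zadd z1 (zmul ci o))] | o <- take n xs].

(** The congruences modulo [L] say that floor i is the i-th translate of the base, and that
    [size xs] or [n] steps move the base by c t or c (t - 1). *)
Definition towerb (x : bool) (box : seq halfplane) (c ci L r : zphi)
    (xs : seq zphi) (n : nat) : bool :=
  let o i := nth z0 xs i in
  [&& zeq0 (zsub (zmul ci c) z1), (0 < n)%N, (n <= size xs)%N,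
      all (fun i => lattice_multiple L
          (zsub (zsub (o i) (o 0%N)) (zmul (zc i 0) r))) (iota 0 (size xs)),
      lattice_multiple L (zsub (zmul c zt) (zmul (zc (size xs) 0) r)),
      lattice_multiple L (zsub (zmul c (zsub zt z1)) (zmul (zc n 0) r)) &
      cover (tower_strips x ci xs n) box].

(** Orbits of the base offset, under t modulo 1 here and in [window_floors2], under 1 modulo phi in
    [window_floors1]. The bases are (0, s), (u, s) and (u, 2u) respectively; with a negative scale
    the offset is the upper end of the floor. *)
Definition omega_floors : seq zphi := [:: zs; z1].
Definition window_floors1 : seq zphi :=
  [:: zc (-6) 4; zc (-5) 4; zc (-4) 3; zc (-3) 2; zc (-2) 2; zc (-1) 1; zc 0 1; zc 1 0].
Definition window_floors2 : seq zphi := [:: zc (-3) 2; zc (-1) 1; zc 0 0].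

Definition affine := (zphi * zphi * zphi * zphi)%type.

Definition pull (m : affine) (h : halfplane) : halfplane :=
  let: (c1, c2, d1, d2) := m in
  (zmul h.1.1 c1, zmul h.1.2 c2, zadd (zadd (zmul h.1.1 d1) (zmul h.1.2 d2)) h.2).

Definition maps_into (m : affine) (hs : seq halfplane) (target : seq halfplane) :=
  all (fun h => implied hs (pull m h)) target.

(* The value is [size Ps] when no region contains the image of [hs] under [m]. *)
Definition locate (Ps : seq (seq (seq halfplane))) (m : affine)
    (hs : seq halfplane) : nat :=
  find (fun pcs => has (maps_into m hs) pcs) Ps.

Definition omega_letter (b i j : nat) : nat :=
  locate piecesU (zopp zs, zopp zs, nth z0 omega_floors i, nth z0 omega_floors j)
    (pieceU b).

(* [window_affine 0 0 0] is the affine copy of the unit square, found by search,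
   whose tower refines the partition induced by [P0]: the translates of the
   images of the atoms of [PU] each lie in a single atom of [P0]. *)
Definition window_affine (i j h : nat) : affine :=
  (zc 3 (-2), zt, nth z0 window_floors1 i, zadd (nth z0 window_floors2 j) (zc h 0)).

Definition column_letter (b i j h : nat) : nat :=
  locate pieces0 (window_affine i j h) (pieceU b).

Definition tower_size (xs : seq zphi) (n : nat) (c : bool) : nat :=
  if c then size xs else n.
Definition omega_size := tower_size omega_floors 1.
Definition window_width := tower_size window_floors1 5.
Definition window_height := tower_size window_floors2 2.

Definition omegab : bool :=
  all (fun b => all (fun i => all (fun j => omega_letter b i j < 19)%N
    (iota 0 (omega_size (classU false b)))) (iota 0 (omega_size (classU true b))))
    (iota 0 19).

(* [column_class b i j] is true when the floor lies below [y = s], where the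
   return time to the base [0 < y < 1] of the first tower is 5 instead of 4. *)
Definition column_class (b i j : nat) : bool :=
  implied (pieceU b) (pull (window_affine i j 0) (strip false (zopp z1) zs)).
Definition column_height (c : bool) : nat := if c then 5 else 4.

Definition windowb : bool :=
  all (fun b => all (fun i => all (fun j =>
    [&& maps_into (window_affine i j 0) (pieceU b) (rectangle zf z1),
        column_class b i j ||
        implied (pieceU b) (pull (window_affine i j 0) (hopp (strip false (zopp z1) zs))) &
        all (fun h => column_letter b i j h < 11)%N
          (iota 0 (column_height (column_class b i j)))])
    (iota 0 (window_height (classU false b)))) (iota 0 (window_width (classU true b))))
    (iota 0 19).

Definition classUb : bool :=
  all (fun x => all (fun b =>
    (nth [::] piecesU b == [:: pieceU b]) && (classU x b ||
    implied (pieceU b) (hopp (strip x (zopp z1) zs))))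
    (iota 0 19)) [:: true; false].

Section Towers.
Variable R : realType.
Implicit Types v w : R * R.
Local Notation zR := (@zR R).

Definition coord (x : bool) w : R := if x then w.1 else w.2.

Lemma hval_strip x a c w : hval (strip x a c) w = zR a * coord x w + zR c.
Proof.
have Z : zR z0 = 0 by rewrite zR_zc mul0r addr0.
by case: x; rewrite /hval /= Z mul0r ?addr0 ?add0r.
Qed.

Lemma zR_z0 : zR z0 = 0. Proof. by rewrite zR_zc mul0r addr0. Qed.
Lemma zR_z1 : zR z1 = 1. Proof. by rewrite zR_zc mul0r addr0. Qed.
Lemma zR_nat (n : int) : zR (zc n 0) = n%:~R. Proof. by rewrite zR_zc mul0r addr0. Qed.

Lemma lattice_multipleP L x : lattice_multiple L x -> exists k : int, zR x = zR L * k%:~R.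
Proof.
case/orP => /hasP[k _ /(zeq0P R)]; rewrite ?zR_sub ?zR_add zR_mul zR_nat => h.
  by exists k; lra.
by exists (- k); rewrite intrN; lra.
Qed.

Lemma classUbT : classUb. Proof. by vm_compute. Qed.

Lemma nth_piecesU (b : 'I_19) : nth [::] piecesU b = [:: pieceU b].
Proof.
have /andP[/allP h _] := classUbT.
by have /andP[/eqP] := h b (etrans (mem_iota 0 19 b) (ltn_ord b)).
Qed.

Lemma has_pieceU (b : 'I_19) v :
  has (fun hs => inside hs v) (nth [::] piecesU b) = inside (pieceU b) v.
Proof. by rewrite nth_piecesU /= orbF. Qed.

Lemma classUP x (b : 'I_19) v : inside (pieceU b) v ->
  if classU x b then coord x v < zR zs else zR zs < coord x v.
Proof.
move=> hv; have hb : nat_of_ord b \in iota 0 19 by rewrite mem_iota /= ltn_ord.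
have : classU x b || implied (pieceU b) (hopp (strip x (zopp z1) zs)).
  have /and3P[/allP h1 /allP h2 _] := classUbT.
  by case: x; [have /andP[] := h1 _ hb|have /andP[] := h2 _ hb].
case: ifP => [/implied_gt0/(_ hv) + _|_ /= /implied_gt0/(_ hv)].
  by rewrite hval_strip zR_opp zR_z1; lra.
by rewrite hval_opp hval_strip zR_opp zR_z1; lra.
Qed.

Section Floors.
Variables (x : bool) (box : seq halfplane) (c ci L r : zphi) (xs : seq zphi) (n : nat).
Hypothesis T : towerb x box c ci L r xs n.

Lemma tower_scale : zR ci * zR c = 1.
Proof.
have /and5P[/(zeq0P R) h _ _ _ _] := T.
by move: h; rewrite zR_sub zR_mul zR_z1 => /eqP; rewrite subr_eq0 => /eqP.
Qed.

Lemma tower_scale_neq0 : zR c != 0.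
Proof.
by apply/eqP => c0; have := tower_scale; rewrite c0 mulr0 => /eqP; rewrite eq_sym oner_eq0.
Qed.

Lemma tower_size_gt0 b : (0 < tower_size xs n b)%N.
Proof.
have /and5P[_ n0 ns _ _] := T.
by case: b => //=; apply: leq_trans ns.
Qed.

Lemma tower_floor b (i : nat) : (i < tower_size xs n b)%N ->
  exists k : int, zR (nth z0 xs i) = zR (nth z0 xs 0) + i%:R * zR r + zR L * k%:~R.
Proof.
have /and5P[_ _ ns /allP h _] := T => hi.
have {}hi : i \in iota 0 (size xs).
  by rewrite mem_iota /=; case: b hi => //= hi; exact: leq_trans ns.
have [k] := lattice_multipleP (h i hi).
rewrite !zR_sub zR_mul zR_nat -pmulrn => e; exists k; lra.
Qed.

Lemma tower_return (b : bool) : exists k : int,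
  zR c * (if b then zR zt else zR zt - 1) =
  (tower_size xs n b)%:R * zR r + zR L * k%:~R.
Proof.
have /and5P[_ _ _ _ /and3P[h1 h2 _]] := T.
case: b; [have [k] := lattice_multipleP h1|have [k] := lattice_multipleP h2];
  by rewrite zR_sub !zR_mul ?zR_sub ?zR_z1 zR_nat -pmulrn => e; exists k; rewrite /tower_size; lra.
Qed.

Lemma tower_cover1 w : generic w -> inside box w -> exists y i b,
  [/\ 0 < y < 1, if b then y < zR zs else zR zs < y,
      (i < tower_size xs n b)%N &
      coord x w = zR c * y + zR (nth z0 xs i)].
Proof.
move=> gw hw; have /and5P[_ _ ns _ /and3P[_ _ cov]] := T.
have [Q hQ vQ] := cover_inside cov gw hw.
have key o : coord x w = zR c * (zR ci * (coord x w - zR o)) + zR o.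
  by rewrite mulrA [zR c * _]mulrC tower_scale mul1r subrK.
have sE : 0 < zR zs < 1.
  by rewrite zR_zc; have /andP[] := phi_bounds R => *; apply/andP; split; lra.
move: hQ vQ; rewrite mem_cat => /orP[/mapP[d /(nthP z0)[i hi <-] ->]|/mapP[d]].
  rewrite /inside /= !hval_strip zR_opp !(zR_add, zR_opp, zR_mul) => /and3P[h1 h2 _].
  exists (zR ci * (coord x w - zR (nth z0 xs i))), i, true.
  by split=> //; [apply/andP; split; lra|lra].
move=> /(nthP z0)[i hi <-] ->.
rewrite size_takel// in hi; rewrite nth_take//.
rewrite /inside /= !hval_strip !zR_opp !(zR_add, zR_opp, zR_mul) zR_z1 => /and3P[h1 h2 _].
exists (zR ci * (coord x w - zR (nth z0 xs i))), i, false.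
by split=> //; [apply/andP; split; lra|lra].
Qed.

End Floors.

Local Notation U := (latticeZ2 R).

Let uniqU v w := @box_uniq R U _ _ _ (latticeZ2_gen1 R) (latticeZ2_gen2 R) isT isT v w.

(** Meaningful at generic points only; (0, 0) is a default. *)
Definition unit_rep (q : torus U) : R * R :=
  xget (0, 0) [set v | [/\ generic v, inside (rectangle z1 z1) v & torus_pi U v = q]].

Lemma unit_repP q : torus_generic q ->
  [/\ generic (unit_rep q), inside (rectangle z1 z1) (unit_rep q) &
      torus_pi U (unit_rep q) = q].
Proof.
move=> [w gw <-].
have [v hv] := @box_rep R U _ _ _ (latticeZ2_gen1 R) (latticeZ2_gen2 R) isT isT w gw.
rewrite /unit_rep; set S := [set v | _].
have : S (xget (0, 0) S) by apply: xgetPex; exists v.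
by [].
Qed.

Lemma unit_rep_pi v : generic v -> inside (rectangle z1 z1) v -> unit_rep (torus_pi U v) = v.
Proof.
move=> gv hv.
have [_ h1 h2] := unit_repP (ex_intro2 _ _ v gv erefl).
exact: uniqU h1 hv h2.
Qed.

Lemma inside_unit v : inside (rectangle z1 z1) v = (0 < v.1 < 1) && (0 < v.2 < 1).
Proof. by rewrite inside_rectangle zR_z1. Qed.

Lemma ztE : zR zt = phi R ^-2.
Proof. by rewrite zR_zc phiV2; ring. Qed.

Lemma RU_pi k v : @RU R k (torus_pi U v) =
  torus_pi U (v.1 + zR (zmul zt (zc k.1 0)), v.2 + zR (zmul zt (zc k.2 0))).
Proof. by rewrite /RU torus_add_pi !zR_mul !zR_nat ztE. Qed.

Lemma RU_generic k (q : torus U) : torus_generic q -> torus_generic (RU k q).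
Proof.
move=> [v gv <-]; rewrite RU_pi.
by exists (v.1 + zR (zmul zt (zc k.1 0)), v.2 + zR (zmul zt (zc k.2 0)));
  first exact: generic_translate.
Qed.

Lemma RU_action : is_Z2_action (@RU R).
Proof.
apply: torus_add_action => [|m n]; first by rewrite !mulr0.
by congr (_, _) => /=; rewrite intrD mulrDr.
Qed.

Lemma PU_unit (b : 'I_19) v : inside (rectangle z1 z1) v ->
  PU b (torus_pi U v) <-> inside (pieceU b) v.
Proof.
move=> hv; rewrite -has_pieceU.
exact: (atom_inside (latticeZ2_gen1 R) (latticeZ2_gen2 R) isT isT _ (piecesU_partition) (@PUE R)).
Qed.

Lemma zs_bounds : 0 < zR zs < 1 /\ zR zt = 1 - zR zs.
Proof.
rewrite !zR_zc; have /andP[] := phi_bounds R => *.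
by split; [apply/andP; split|]; lra.
Qed.

(** Since s + t = 1, the rotation by t stays in the unit interval from the low band and wraps once
    from the high band. *)
Lemma unit_rep_step (x : bool) b (q : torus U) : torus_generic q -> PU b q ->
  let v := unit_rep q in
  let d := if classU x b then zR zt else zR zt - 1 in
  unit_rep (RU (if x then (1, 0) else (0, 1)) q) =
    (if x then (v.1 + d, v.2) else (v.1, v.2 + d)).
Proof.
move=> gq bq v d; have [gv hv vq] := unit_repP gq.
have bv : inside (pieceU b) v by apply/PU_unit => //; rewrite vq.
have hd := classUP x bv; have [s01 tE] := zs_bounds.
pose dz := if classU x b then zt else zsub zt z1.
have dE : d = zR dz by rewrite /d /dz; case: ifP => //; rewrite zR_sub zR_z1.
set w := (if x then (v.1 + d, v.2) else (v.1, v.2 + d)).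
have gw : generic w.
  rewrite /w dE; have := @generic_translate R (if x then dz else z0) (if x then z0 else dz) v gv.
  by case: (x); rewrite zR_z0 addr0.
have hw : inside (rectangle z1 z1) w.
  move: hv hd; rewrite !inside_unit /w /d; case: (x); case: ifP => _ /= /andP[/andP[? ?] /andP[? ?]] ?;
  by apply/andP; split; apply/andP; split; lra.
rewrite -(unit_rep_pi gw hw); congr unit_rep; rewrite -{1}vq RU_pi.
apply/torus_pi_eq/(box_latticeP (latticeZ2_gen1 R) (latticeZ2_gen2 R)).
exists (if x && ~~ classU x b then 1 else 0), (if ~~ x && ~~ classU x b then 1 else 0).
rewrite /w /d !zR_mul zR_z0 zR_z1 mul0r addr0 !mul1r -/v.
by case: (x); case: (classU _ b) => /=; rewrite !zR_nat; congr (_, _) => /=; rewrite ?intr1 ?mulr1 ?mulr0z ?mulr1z; ring.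
Qed.

Section TowerDesubstitution.
Variables (G : lattice R) (L1 L2 : zphi).
Hypothesis G1 : gen1 G = (zR L1, 0).
Hypothesis G2 : gen2 G = (zR z0, zR L2).
Hypotheses (L1_gt0 : zpos L1) (L2_gt0 : zpos L2).
Variables (c1 ci1 r1 c2 ci2 r2 : zphi) (xs ys : seq zphi) (n1 n2 : nat).
Hypothesis T1 : towerb true (rectangle L1 L2) c1 ci1 L1 r1 xs n1.
Hypothesis T2 : towerb false (rectangle L1 L2) c2 ci2 L2 r2 ys n2.
Variables (A : finType) (P : A -> set (torus G)) (act : Z2 -> torus G -> torus G).
Hypothesis actP : is_Z2_action act.
Hypothesis actE : forall k v, act k (torus_pi G v) =
  torus_pi G (v.1 + zR r1 * k.1%:~R, v.2 + zR r2 * k.2%:~R).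
Hypothesis P_open : forall a, open (P a).
Hypothesis P_disj : forall a a' p, P a p -> P a' p -> a = a'.
Variable e : 'I_19 -> nat -> nat -> A.

Let floor v (i j : nat) : R * R :=
  (zR c1 * v.1 + zR (nth z0 xs i), zR c2 * v.2 + zR (nth z0 ys j)).

Hypothesis letters : forall (b : 'I_19) (i j : nat) v,
  (i < tower_size xs n1 (classU true b))%N ->
  (j < tower_size ys n2 (classU false b))%N ->
  generic v -> inside (pieceU b) v -> P (e b i j) (torus_pi G (floor v i j)).

Let base q := torus_pi G (floor (unit_rep q) 0 0).

Let act_floor b b' v i j : (i < tower_size xs n1 b)%N -> (j < tower_size ys n2 b')%N ->
  act (i%:Z, j%:Z) (torus_pi G (floor v 0 0)) = torus_pi G (floor v i j).
Proof.
move=> /(tower_floor T1)[k ek] /(tower_floor T2)[l el].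
rewrite actE; apply/torus_pi_eq/(box_latticeP G1 G2); exists (- k), (- l).
rewrite zR_z0 mul0r addr0 /floor /= ek el.
by congr (_, _) => /=; rewrite intrN -!pmulrn; ring.
Qed.

(** The product of a tower in x and a tower in y: a horizontal return time depends only on the band
    of x, a vertical one only on the band of y. *)
Theorem tower_desubstitution :
  desubstitution (block_morphism ord0 (classU true) (classU false)
      (tower_size xs n1) (tower_size ys n2) e)
    (XU R) (symbolic_shift P act).
Proof.
apply: (@block_desubstitution R G U A 'I_19 bool bool P act (@PU R) (@RU R)
  (@torus_generic R G) (@torus_generic R U) (classU true) (classU false)
  (tower_size xs n1) (tower_size ys n2) e base ord0 actP RU_action
  (@torus_generic_dense R G) (@torus_generic_dense R U) P_open).
- exact: (atom_open (@PUE R)).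
- exact: P_disj.
- exact: RU_generic.
- exact: (atom_cover (latticeZ2_gen1 R) (latticeZ2_gen2 R) isT isT _ piecesU_partition (@PUE R)).
- exact: tower_size_gt0 T1.
- exact: tower_size_gt0 T2.
- move=> b b' q gq bq bq'.
  (* A vertical step keeps the first coordinate, hence its band. *)
  have /= st := @unit_rep_step false b q gq bq.
  have [gv hv vq] := unit_repP gq; have [gw hw wq] := unit_repP (RU_generic (0, 1) gq).
  have bv : inside (pieceU b) (unit_rep q) by apply/PU_unit; rewrite ?vq.
  have bw : inside (pieceU b') (unit_rep (RU (0, 1) q)) by apply/PU_unit; rewrite ?wq.
  move: (classUP true bv) (classUP true bw); rewrite st /=.
  by do 2!case: ifP => // _; lra.
- move=> b b' q gq bq bq'.
  have /= st := @unit_rep_step true b q gq bq.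
  have [gv hv vq] := unit_repP gq; have [gw hw wq] := unit_repP (RU_generic (1, 0) gq).
  have bv : inside (pieceU b) (unit_rep q) by apply/PU_unit; rewrite ?vq.
  have bw : inside (pieceU b') (unit_rep (RU (1, 0) q)) by apply/PU_unit; rewrite ?wq.
  move: (classUP false bv) (classUP false bw); rewrite st /=.
  by do 2!case: ifP => // _; lra.
- move=> b q gq bq; rewrite /base (@unit_rep_step true b q gq bq) actE.
  have [k ek] := tower_return T1 (classU true b).
  apply/torus_pi_eq/(box_latticeP G1 G2); exists k, 0.
  rewrite zR_z0 mul0r addr0 mulr0 /floor /=.
  by congr (_, _) => /=; rewrite ?mulrDr ?ek -?pmulrn; ring.
- move=> b q gq bq; rewrite /base (@unit_rep_step false b q gq bq) actE.
  have [k ek] := tower_return T2 (classU false b).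
  apply/torus_pi_eq/(box_latticeP G1 G2); exists 0, k.
  rewrite zR_z0 mul0r addr0 mulr0 /floor /=.
  by congr (_, _) => /=; rewrite ?mulrDr ?ek -?pmulrn; ring.
- move=> b q i j gq bq hi hj; have [gv hv vq] := unit_repP gq.
  rewrite /base (act_floor _ hi hj); apply: letters => //.
  by apply/PU_unit; rewrite ?vq.
move=> p [w0 gw0 <-].
have [w [gw hw <-]] := box_rep G1 G2 L1_gt0 L2_gt0 gw0.
have [y1 [i [b1 [y1b y1c hi wE1]]]] := tower_cover1 T1 gw hw.
have [y2 [j [b2 [y2b y2c hj wE2]]]] := tower_cover1 T2 gw hw.
have gv : generic (y1, y2).
  have nz1 := tower_scale_neq0 T1; have nz2 := tower_scale_neq0 T2.
  have s1 := tower_scale T1; have s2 := tower_scale T2.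
  have ci10 : zR ci1 != 0 by apply/eqP => z; move: s1; rewrite z mul0r => /eqP; rewrite eq_sym oner_eq0.
  have ci20 : zR ci2 != 0 by apply/eqP => z; move: s2; rewrite z mul0r => /eqP; rewrite eq_sym oner_eq0.
  (* The point below w is its image under the inverse affine map, again over Z[phi]. *)
  have := @generic_affine R ci1 ci2 (zopp (zmul ci1 (nth z0 xs i))) (zopp (zmul ci2 (nth z0 ys j))) w ci10 ci20 gw.
  rewrite !zR_opp !zR_mul; move: wE1 wE2; rewrite /coord => -> ->.
  by rewrite !mulrDr !mulrA s1 s2 !mul1r !addrK.
have hv : inside (rectangle z1 z1) (y1, y2) by rewrite inside_unit y1b y2b.
have [b hb] := atom_cover_box (erefl : size piecesU = 19%N) piecesU_partition gv hv.
rewrite has_pieceU in hb.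
have e1 : classU true b = b1.
  by move: (classUP true hb) y1c; rewrite /coord; case: ifP; case: (b1) => //= _; lra.
have e2 : classU false b = b2.
  by move: (classUP false hb) y2c; rewrite /coord; case: ifP; case: (b2) => //= _; lra.
exists (torus_pi U (y1, y2)), b, i, j; rewrite e1 e2; split=> //.
- by exists (y1, y2).
- exact/PU_unit.
- rewrite /base unit_rep_pi// (act_floor _ hi hj) /floor /= -wE1 -wE2.
  by rewrite -surjective_pairing.
Qed.

End TowerDesubstitution.

End Towers.

(** * The self-similarity *)

Section Omega.
Variable R : realType.
Implicit Types v w : R * R.
Local Notation zR := (@zR R).

Definition apply_affine (m : affine) v : R * R :=
  let: (c1, c2, d1, d2) := m in (zR c1 * v.1 + zR d1, zR c2 * v.2 + zR d2).

Lemma hval_pull m h v : hval (pull m h) v = hval h (apply_affine m v).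
Proof.
by case: m => [[[c1 c2] d1] d2]; rewrite /hval /= !(zR_add, zR_mul); ring.
Qed.

Lemma maps_intoP m hs target v : maps_into m hs target -> inside hs v ->
  inside target (apply_affine m v).
Proof.
move=> /allP h hv; apply/allP => l hl.
by rewrite -hval_pull; exact: implied_gt0 (h _ hl) hv.
Qed.

Lemma locateP Ps m hs v : (locate Ps m hs < size Ps)%N -> inside hs v ->
  has (fun l => inside l (apply_affine m v)) (nth [::] Ps (locate Ps m hs)).
Proof.
rewrite -has_find => /(nth_find [::])/hasP[l hl hm] hv.
by apply/hasP; exists l; last exact: maps_intoP hm hv.
Qed.

End Omega.

Lemma towerZ1 : towerb true (rectangle z1 z1) (zopp zs) (zopp zf) z1 zt omega_floors 1.
Proof. by vm_compute. Qed.

Lemma towerZ2 : towerb false (rectangle z1 z1) (zopp zs) (zopp zf) z1 zt omega_floors 1.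
Proof. by vm_compute. Qed.

Lemma omegabT : omegab.
Proof. by vm_compute. Qed.

Definition omega_entry (b : 'I_19) (i j : nat) : 'I_19 := inord (omega_letter b i j).

Definition omega : wordmap 'I_19 'I_19 :=
  block_morphism ord0 (classU true) (classU false) omega_size omega_size omega_entry.

Lemma omega_letter_lt (b : 'I_19) i j :
  (i < omega_size (classU true b))%N -> (j < omega_size (classU false b))%N ->
  (omega_letter b i j < 19)%N.
Proof.
move=> hi hj; have /allP h := omegabT.
have /allP/(_ i) := h b (etrans (mem_iota 0 19 b) (ltn_ord b)).
by rewrite mem_iota => /(_ hi)/allP/(_ j); rewrite mem_iota => /(_ hj).
Qed.

Lemma omega_desubstitution (R : realType) : desubstitution omega (XU R) (XU R).
Proof.
apply: (@tower_desubstitution R (latticeZ2 R) z1 z1 (latticeZ2_gen1 R)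
  (latticeZ2_gen2 R) isT isT _ _ zt _ _ zt _ _ _ _ towerZ1 towerZ2
  _ _ _ (RU_action R)).
- by move=> k v; rewrite RU_pi !zR_mul !zR_nat.
- by move=> a; exact: (atom_open (@PUE R)).
- exact: (atom_disj (latticeZ2_gen1 R) (latticeZ2_gen2 R) isT isT
    (erefl : size piecesU = 19%N) piecesU_partition (@PUE R)).
- move=> b i j v hi hj _ hv; have lt19 := omega_letter_lt hi hj.
  rewrite PUE /=; eexists; last by reflexivity.
  rewrite /= inordK//; exact: (locateP (R := R) (Ps := piecesU) lt19 hv).
Qed.

(** * Expansivity and primitivity of the self-similarity *)

Definition omega_successors (b : nat) : seq nat :=
  [seq omega_letter b i j | i <- iota 0 (omega_size (classU true b)),
                            j <- iota 0 (omega_size (classU false b))].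

Fixpoint omega_reach (succ : seq (seq nat)) (m : nat) (a : nat) : seq nat :=
  if m is m'.+1 then
    undup (flatten [seq nth [::] succ c | c <- omega_reach succ m' a])
  else [:: a].

Definition omega_table : seq (seq nat) := [seq omega_successors b | b <- iota 0 19].

(* A letter of an image lies in the low band exactly on the first column (row)
   of the image, whence the coding of columns and rows by a Fibonacci word. *)
Definition omega_classb : bool :=
  all (fun b => all (fun i => all (fun j =>
      (classU true (omega_letter b i j) == (i == 0)) &&
      (classU false (omega_letter b i j) == (j == 0)))%N
    (iota 0 (omega_size (classU false b)))) (iota 0 (omega_size (classU true b))))
    (iota 0 19).

Definition omega_primitiveb (m : nat) : bool :=
  let t := omega_table in
  all (fun a => let r := omega_reach t m a in all (fun b => b \in r) (iota 0 19))
      (iota 0 19).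

Local Notation U_consistent :=
  (consistent_word (fun b : 'I_19 => classU true b) (fun b : 'I_19 => classU false b)).

Lemma omega_classbT : omega_classb.
Proof. by vm_compute. Qed.

Lemma omega_entry_class (b : 'I_19) i j :
  (i < omega_size (classU true b))%N -> (j < omega_size (classU false b))%N ->
  classU true (omega_entry b i j) = (i == 0)%N /\
  classU false (omega_entry b i j) = (j == 0)%N.
Proof.
move=> hi hj; rewrite /omega_entry inordK; last exact: omega_letter_lt.
have /allP h := omega_classbT.
have /allP/(_ i) := h b (etrans (mem_iota 0 19 b) (ltn_ord b)).
by rewrite mem_iota => /(_ hi)/allP/(_ j); rewrite mem_iota => /(_ hj)/andP[/eqP-> /eqP->].
Qed.

Definition omega_cols (w : word 'I_19) :=
  col_shape ord0 (fun b : 'I_19 => classU true b) omega_size w.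
Definition omega_rows (w : word 'I_19) :=
  row_shape ord0 (fun b : 'I_19 => classU false b) omega_size w.

Lemma omega_wmatE w (x : 'I_(width (omega w))) (y : 'I_(height (omega w))) :
  wmat (omega w) x y =
  omega_entry (wget ord0 w (reshape_index (omega_cols w) x) (reshape_index (omega_rows w) y))
    (reshape_offset (omega_cols w) x) (reshape_offset (omega_rows w) y).
Proof. by rewrite mxE. Qed.

Lemma omega_wmat_class w (x : 'I_(width (omega w))) (y : 'I_(height (omega w))) :
  U_consistent w ->
  classU true (wmat (omega w) x y) = (reshape_offset (omega_cols w) x == 0)%N /\
  classU false (wmat (omega w) x y) = (reshape_offset (omega_rows w) y == 0)%N.
Proof.
move=> Lw; have [/andP[w0 h0] _ _] := Lw; have [h1 h2] := consistent_wget ord0 Lw.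
have hr := reshape_indexP (sh := omega_cols w) (ltn_ord x).
have hr' := reshape_indexP (sh := omega_rows w) (ltn_ord y).
have hc := reshape_offsetP (sh := omega_cols w) (ltn_ord x).
have hc' := reshape_offsetP (sh := omega_rows w) (ltn_ord y).
rewrite size_col_shape in hr; rewrite size_row_shape in hr'.
rewrite omega_wmatE; apply: omega_entry_class.
  by rewrite (h1 _ _ 0%N)//; rewrite nth_col_shape in hc.
by rewrite (h2 _ 0%N)//; rewrite nth_row_shape in hc'.
Qed.

Lemma omega_size_gt0 b : (0 < omega_size b)%N. Proof. by case: b. Qed.

Lemma size_omega_cols w : (width w <= sumn (omega_cols w))%N.
Proof.
rewrite -(size_col_shape ord0 (fun b : 'I_19 => classU true b) omega_size w) -/(omega_cols w).
have : all (fun n => 0 < n)%N (omega_cols w).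
  by apply/allP => _ /mapP[i _ ->]; exact: omega_size_gt0.
by elim: (omega_cols w) => //= n s IH /andP[n0 /IH h]; lia.
Qed.

Lemma size_omega_rows w : (height w <= sumn (omega_rows w))%N.
Proof.
rewrite -(size_row_shape ord0 (fun b : 'I_19 => classU false b) omega_size w) -/(omega_rows w).
have : all (fun n => 0 < n)%N (omega_rows w).
  by apply/allP => _ /mapP[i _ ->]; exact: omega_size_gt0.
by elim: (omega_rows w) => //= n s IH /andP[n0 /IH h]; lia.
Qed.

(** The classes of a letter of the image depend only on its offset within its block, and the offset
    is common to a whole column or row. Hence all iterates are defined. *)
Lemma omega_consistent w : U_consistent w -> U_consistent (omega w).
Proof.
move=> Lw; have [/andP[w0 h0] _ _] := Lw; split.
- by rewrite /nonempty_word (leq_trans w0 (size_omega_cols w)) (leq_trans h0 (size_omega_rows w)).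
- move=> x y y'; have [-> _] := omega_wmat_class x y Lw.
  by have [-> _] := omega_wmat_class x y' Lw.
- move=> x x' y; have [_ ->] := omega_wmat_class x y Lw.
  by have [_ ->] := omega_wmat_class x' y Lw.
Qed.

Lemma letter_consistent (a : 'I_19) : U_consistent (letter a).
Proof. by split=> // i j k; rewrite !mxE. Qed.

Lemma omega_iter_consistent m a : U_consistent (iter m omega (letter a)).
Proof. by elim: m => [|m IH]; [exact: letter_consistent|exact: omega_consistent]. Qed.

(* The lower left letter of an image is in the low band, so that its own image
   has size 2 x 2. *)
Lemma omega_grows w : U_consistent w ->
  (width (omega w) < width (omega (omega w)))%N /\
  (height (omega w) < height (omega (omega w)))%N.
Proof.
move=> Lw; have [/andP[w0 h0] _ _] := omega_consistent Lw.
have [cx cy] := omega_wmat_class (Ordinal w0) (Ordinal h0) Lw.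
rewrite /= /reshape_offset sub0n in cx; rewrite /= /reshape_offset sub0n in cy.
have grow (s : seq nat) : all (fun n => 0 < n)%N s -> (nth 0%N s 0 = 2)%N ->
    (size s < sumn s)%N.
  case: s => //= n s /andP[_ hs] ->.
  have : (size s <= sumn s)%N by elim: s hs => //= k s IH /andP[k0 /IH]; lia.
  by lia.
split.
  rewrite -[X in (X < _)%N](size_col_shape ord0 (fun b : 'I_19 => classU true b) omega_size).
  apply: grow; first by apply/allP => _ /mapP[i _ ->]; exact: omega_size_gt0.
  rewrite nth_col_shape//.
  by rewrite (wgetE ord0 (w := omega w) (Ordinal w0) (Ordinal h0)) cx.
rewrite -[X in (X < _)%N](size_row_shape ord0 (fun b : 'I_19 => classU false b) omega_size).
apply: grow; first by apply/allP => _ /mapP[i _ ->]; exact: omega_size_gt0.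
rewrite nth_row_shape//.
by rewrite (wgetE ord0 (w := omega w) (Ordinal w0) (Ordinal h0)) cy.
Qed.

Lemma omega_iter_size m a : (m <= width (iter m omega (letter a)))%N /\
  (m <= height (iter m omega (letter a)))%N.
Proof.
(* [omega_grows] compares [omega w] with its image, so growth starts at the first iterate. *)
elim: m => [//|[|m] [IH1 IH2]].
  have [/andP[h1 h2] _ _] := omega_iter_consistent 1 a.
  by split.
have [h1 h2] := omega_grows (omega_iter_consistent m a).
by split; [exact: leq_ltn_trans IH1 h1|exact: leq_ltn_trans IH2 h2].
Qed.

Lemma omega_iter_defined m a : iter_defined omega m (letter a).
Proof. by move=> k _; exact: omega_iter_consistent. Qed.

Lemma omega_expansive : expansive omega.
Proof.
move=> a K; exists K.+1; have [h1 h2] := omega_iter_size K.+1 a.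
by split=> //; exact: omega_iter_defined.
Qed.

Lemma omega_occurs w (b : 'I_19) i j : U_consistent w -> occurs b w ->
  (i < omega_size (classU true b))%N -> (j < omega_size (classU false b))%N ->
  occurs (omega_entry b i j) (omega w).
Proof.
move=> Lw [r [r' wb]] hi hj.
have [h1 h2] := consistent_wget ord0 Lw.
have [/andP[w0 h0] _ _] := Lw.
have bE : wget ord0 w r r' = b by rewrite wgetE.
have hi' : (i < omega_size (classU true (wget ord0 w r 0)))%N by rewrite (h1 _ _ r')// bE.
have hj' : (j < omega_size (classU false (wget ord0 w 0 r')))%N by rewrite (h2 _ r)// bE.
have hx : (flatten_index (omega_cols w) r i < sumn (omega_cols w))%N.
  by apply: flatten_indexP; rewrite nth_col_shape.
have hy : (flatten_index (omega_rows w) r' j < sumn (omega_rows w))%N.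
  by apply: flatten_indexP; rewrite nth_row_shape.
exists (Ordinal hx), (Ordinal hy).
rewrite -(wgetE ord0 (w := omega w)) /= block_imageE// bE.
by [].
Qed.

Lemma omega_reach_occurs m (a : 'I_19) c : c \in omega_reach omega_table m a ->
  (c < 19)%N /\ occurs (inord c : 'I_19) (iter m omega (letter a)).
Proof.
elim: m c => [|m IH] c /=.
  rewrite inE => /eqP ->; split; first exact: ltn_ord.
  by exists ord0, ord0; rewrite mxE inord_val.
rewrite mem_undup => /flattenP[_ /mapP[b /IH[b19 ob] ->]].
rewrite (nth_map 0%N) ?size_iota// nth_iota// add0n.
move=> /allpairsP[[i j] /= [hi hj ->]]; rewrite !mem_iota /= !add0n in hi hj.
have bE : nat_of_ord (inord b : 'I_19) = b by rewrite inordK.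
have := @omega_letter_lt (inord b) i j; have := @omega_occurs _ (inord b) i j (omega_iter_consistent m a) ob.
rewrite /omega_entry bE => h1 h2.
by split; [exact: h2|exact: h1].
Qed.

Lemma omega_primitive : primitive omega.
Proof.
(* The seventh iterate of each letter contains the whole alphabet, as [omega_primitiveb 7]
   certifies. *)
exists 7 => a b; split; first exact: omega_iter_defined.
have /allP h : omega_primitiveb 7 by vm_compute.
have io (c : 'I_19) : nat_of_ord c \in iota 0 19 by rewrite mem_iota /=.
have /allP/(_ b (io b)) hb := h a (io a).
by have [_] := omega_reach_occurs hb; rewrite inord_val.
Qed.

(** * The first induction *)

Section FirstInduction.
Variable R : realType.
Implicit Types v w : R * R.
Local Notation zR := (@zR R).
Local Notation T0 := (torus (lattice0 R)).

Lemma lattice1_indep :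
  (phi R, 0 : R).1 * (0 : R, 1 : R).2 - (phi R, 0 : R).2 * (0 : R, 1 : R).1 != 0.
Proof. by rewrite /= mulr1 mulr0 subr0 gt_eqF// phi_gt0. Qed.

Definition lattice1 : lattice R := Lattice lattice1_indep.
Local Notation T1 := (torus lattice1).

Lemma lattice1_gen1 : gen1 lattice1 = (zR zf, 0).
Proof. by rewrite zR_zc mul1r add0r. Qed.

Lemma lattice1_gen2 : gen2 lattice1 = (zR z0, zR z1).
Proof. by rewrite !zR_zc !mul0r !addr0. Qed.

(* The return map of [R0] to the base [0 < y < 1] of the torus, and its shear. *)
Definition R1 (n : Z2) (p : T1) : T1 :=
  torus_add p ((n.1 - n.2)%:~R, zR zt * n.2%:~R).
Definition R2 (n : Z2) (p : T1) : T1 :=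
  torus_add p (n.1%:~R, zR zt * n.2%:~R).

Lemma R1_action : is_Z2_action R1.
Proof.
apply: torus_add_action => [|m n]; first by rewrite !mulr0.
by congr (_, _) => /=; rewrite !(intrD, intrN); ring.
Qed.

Lemma R2_action : is_Z2_action R2.
Proof.
apply: torus_add_action => [|m n]; first by rewrite !mulr0.
by congr (_, _) => /=; rewrite !(intrD, intrN); ring.
Qed.

Lemma R0_action : is_Z2_action (@R0 R).
Proof.
by apply: torus_add_action => // m n; congr (_, _) => /=; rewrite intrD.
Qed.

Lemma R1_shear k p : R1 (mulZ2 shear11 k) p = R2 k p.
Proof.
have e2 : (mulZ2 shear11 k).2 = k.2 by rewrite /mulZ2 /= !mxE /= mul0r add0r mul1r.
have e1 : (mulZ2 shear11 k).1 = k.1 + k.2 by rewrite /mulZ2 /= !mxE /= !mul1r.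
by rewrite /R1 /R2 e1 e2 addrK.
Qed.

(* A letter records the return time to the base, 5 or 4, and the column of
   letters of [P0] met before the return. *)
Definition column := (bool * {ffun 'I_5 -> 'I_11})%type.

(** Entries past the return time are forced to be [ord0], so that distinct letters have disjoint
    atoms. Columns that no point meets have empty atoms. *)
Definition column_at (b : column) v (h : 'I_5) : Prop :=
  if (h < column_height b.1)%N then P0 (b.2 h) (torus_pi (lattice0 R) (v.1, v.2 + h%:R))
  else b.2 h = ord0.

Definition column_set (b : column) : set (R * R) :=
  [set v | [/\ inside (rectangle zf z1) v,
     if b.1 then v.2 < zR zs else zR zs < v.2 & forall h, column_at b v h]].

Definition P1 (b : column) : set T1 := torus_pi lattice1 @` column_set b.

Let uniq1 v w := @box_uniq R lattice1 _ _ _ lattice1_gen1 lattice1_gen2 isT isT v w.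
Let rep1 w := @box_rep R lattice1 _ _ _ lattice1_gen1 lattice1_gen2 isT isT w.

Lemma P0_open a : open (@P0 R a).
Proof. exact: (atom_open (@P0E R)). Qed.

Lemma P0_disj a b p : @P0 R a p -> P0 b p -> a = b.
Proof.
exact: (atom_disj (lattice0_gen1 R) (lattice0_gen2 R) isT isT
  (erefl : size pieces0 = 11%N) pieces0_partition (@P0E R)).
Qed.

Lemma P0_cover (p : T0) : torus_generic p -> exists a, P0 a p.
Proof.
exact: (atom_cover (lattice0_gen1 R) (lattice0_gen2 R) isT isT
  (erefl : size pieces0 = 11%N) pieces0_partition (@P0E R)).
Qed.

Lemma P1_open b : open (P1 b).
Proof.
apply: torus_pi_open.
have hE : column_set b = [set v | inside (rectangle zf z1) v] `&`
    ([set v | if b.1 then v.2 < zR zs else zR zs < v.2] `&`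
     \bigcap_(h in [set: 'I_5]) [set v | column_at b v h]).
  apply/seteqP; split=> v /=; first by case=> hv cv h; split=> //; split=> // i _; exact: h.
  by move=> [hv [cv h]]; split=> // i; exact: h i I.
rewrite hE; apply: openI; first exact: inside_open.
apply: openI.
  case: (b.1).
    apply: (@open_comp _ _ (fun v : R * R => v.2) [set y | y < zR zs]); last exact: open_lt.
    by move=> v _; exact: cvg_snd.
  apply: (@open_comp _ _ (fun v : R * R => v.2) [set y | zR zs < y]); last exact: open_gt.
  by move=> v _; exact: cvg_snd.
rewrite openE => v hv; apply: filter_finite_bigcap => [|h _]; first exact: finite_finset.
have {hv}: column_at b v h by exact: hv.
rewrite /column_at; case: ifP => _ hv; last by apply: (filterS _ (@filterT _ (nbhs v) _)) => w _; exact: hv.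
have oU : open (torus_pi (lattice0 R) @^-1` P0 (b.2 h)).
  apply: open_comp; last exact: P0_open.
  by move=> x _; exact: torus_pi_continuous.
have := @open_translate R _ (0, h%:R) oU.
rewrite openE => /(_ v) /=; rewrite /interior /=.
have wE w : w + (0, h%:R) = (w.1, w.2 + h%:R) by congr (_, _); rewrite /= addr0.
rewrite wE => /(_ hv); apply: filterS => w /=.
by rewrite wE.
Qed.

Lemma P1_disj b b' p : P1 b p -> P1 b' p -> b = b'.
Proof.
move=> [v [hv cv Pv] <-] [w [hw cw Pw] e].
have vw := uniq1 hw hv e; rewrite vw in cw Pw.
have c : b.1 = b'.1 by move: cv cw; case: (b.1); case: (b'.1) => //; lra.
case: b b' c Pv Pw {cv cw e} => [c f] [c' f'] /= <- Pv Pw; congr pair.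
apply/ffunP => h; have := Pv h; have := Pw h; rewrite /column_at /=.
by case: ifP => _; [move=> h1 h2; exact: P0_disj h2 h1|move=> -> ->].
Qed.

Lemma generic_up v (h : nat) : generic v -> generic (v.1, v.2 + h%:R).
Proof.
move=> /(generic_translate (d1 := z0) (d2 := zc h 0)).
by rewrite zR_z0 addr0 zR_nat pmulrn.
Qed.

Lemma generic_neq_zs v : generic v -> v.2 != zR zs.
Proof.
move=> gv; have [_] := generic_coord_neq0 (@generic_translate R z0 (zopp zs) v gv).
by rewrite /= zR_opp subr_eq0.
Qed.

Lemma column_cover v : generic v -> inside (rectangle zf z1) v ->
  exists b, column_set b v /\ b.1 = (v.2 < zR zs).
Proof.
move=> gv hv.
have /choice[f hf] (h : 'I_5) : exists a, P0 a (torus_pi (lattice0 R) (v.1, v.2 + h%:R)).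
  by apply: P0_cover; exists (v.1, v.2 + h%:R) => //; exact: generic_up.
exists (v.2 < zR zs, [ffun h : 'I_5 => if (h < column_height (v.2 < zR zs)%R)%N then f h else ord0]).
split=> //; split=> //=.
  by case: ltgtP => // /eqP; rewrite (negPf (generic_neq_zs gv)).
by move=> h; rewrite /column_at /= ffunE; case: (_ < _)%N => //; exact: hf.
Qed.

Lemma P1_cover p : torus_generic p -> exists b, P1 b p.
Proof.
move=> [w gw <-]; have [v [gv hv <-]] := rep1 gw.
by have [b [hb _]] := column_cover gv hv; exists b, v.
Qed.

Lemma P1_partition : is_topological_partition P1.
Proof.
apply: generic_topological_partition; [exact: P1_open| |exact: P1_cover].
by move=> b b' p; exact: P1_disj.
Qed.

Definition base_rep (q : T1) : R * R :=
  xget (0, 0) [set v | [/\ generic v, inside (rectangle zf z1) v & torus_pi lattice1 v = q]].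

Lemma base_repP q : torus_generic q ->
  [/\ generic (base_rep q), inside (rectangle zf z1) (base_rep q) &
      torus_pi lattice1 (base_rep q) = q].
Proof.
move=> [w gw <-]; have [v hv] := rep1 gw.
rewrite /base_rep; set S := [set v | _].
have : S (xget (0, 0) S) by apply: xgetPex; exists v.
by [].
Qed.

Lemma base_rep_pi v : generic v -> inside (rectangle zf z1) v ->
  base_rep (torus_pi lattice1 v) = v.
Proof.
move=> gv hv.
have [_ h1 h2] := base_repP (ex_intro2 _ _ v gv erefl).
exact: uniq1 h1 hv h2.
Qed.

Lemma P1_base_rep b q : torus_generic q -> P1 b q -> column_set b (base_rep q).
Proof.
move=> /base_repP[gv hv vq] [w hw wq].
have [hw1 _ _] := hw; have <- // : w = base_rep q.
by apply: uniq1 => //; rewrite wq vq.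
Qed.

Lemma R1_generic k (q : T1) : torus_generic q -> torus_generic (R1 k q).
Proof.
move=> [v gv <-]; rewrite /R1 torus_add_pi.
have := @generic_translate R (zc (k.1 - k.2) 0) (zmul zt (zc k.2 0)) v gv.
by rewrite zR_mul !zR_nat => h; exists (v.1 + (k.1 - k.2)%:~R, v.2 + zR zt * k.2%:~R).
Qed.

Lemma base_rep_R1 k q : torus_generic q -> exists m n : int,
  base_rep (R1 k q) = ((base_rep q).1 + (k.1 - k.2)%:~R + zR zf * m%:~R,
                       (base_rep q).2 + zR zt * k.2%:~R + n%:~R).
Proof.
move=> gq; have [_ _ vq] := base_repP gq.
have [_ _] := base_repP (R1_generic k gq).
rewrite -{2}vq /R1 torus_add_pi => /torus_pi_eq.
move=> /(box_latticeP lattice1_gen1 lattice1_gen2)[m [n [e1 e2]]]; exists m, n.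
rewrite zR_z0 mul0r addr0 in e1; rewrite zR_z1 mul1r in e2.
by rewrite [LHS]surjective_pairing; congr (_, _); [move: e1|move: e2] => /= h; lra.
Qed.

Definition induction_map : wordmap column 'I_11 :=
  block_morphism (false, [ffun=> ord0]) (fun=> tt) fst (fun=> 1%N) column_height
    (fun b _ h => b.2 (inord h)).

Lemma base_rep_R1_row q : torus_generic q -> exists m : int,
  base_rep (R1 (1, 0) q) = ((base_rep q).1 + 1 + zR zf * m%:~R, (base_rep q).2).
Proof.
move=> gq; have [m [n e]] := base_rep_R1 (1, 0) gq.
have [_ + _] := base_repP gq; have [_ + _] := base_repP (R1_generic (1, 0) gq).
rewrite e !inside_rectangle zR_z1 /= mulr0 addr0 => /andP[_ h1] /andP[_ h2].
have n0 : n = 0.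
  have h3 : n%:~R < 1%:~R :> R by lra.
  have h4 : (-1)%:~R < n%:~R :> R by rewrite intrN; lra.
  by move: h3 h4; rewrite !ltr_int; clear; lia.
by exists m; rewrite n0 /= mulr1z mulr0z !addr0.
Qed.

(** Landing in 0 < y < 1 fixes the vertical wrap: none from y < s, where t = 5 - (phi + 3), and one
    from y > s, where t - 1 = 4 - (phi + 3). *)
Lemma base_rep_R1_up b q : torus_generic q -> P1 b q -> exists m : int,
  base_rep (R1 (0, 1) q) = ((base_rep q).1 - 1 + zR zf * m%:~R,
    (base_rep q).2 + (column_height b.1)%:R - zR zp3).
Proof.
move=> gq bq; have [m [n e]] := base_rep_R1 (0, 1) gq.
have [_ c _] := P1_base_rep gq bq.
have [_ + _] := base_repP gq; have [_ + _] := base_repP (R1_generic (0, 1) gq).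
rewrite e !inside_rectangle zR_z1 /= mulr1 => /andP[_ h1] /andP[_ h2].
exists m; congr (_, _).
move: c h1; rewrite !zR_zc /column_height; have /andP[f1 f2] := phi_bounds R.
case: (b.1) => c h1.
  have -> : n = 0; last by rewrite mulr0z; ring.
  have h3 : n%:~R < 1%:~R :> R by lra.
  have h4 : (-1)%:~R < n%:~R :> R by rewrite intrN; lra.
  by move: h3 h4; rewrite !ltr_int; clear; lia.
have -> : n = -1; last by rewrite intrN; ring.
have h3 : n%:~R < 0%:~R :> R by lra.
have h4 : (-2)%:~R < n%:~R :> R by rewrite intrN; lra.
by move: h3 h4; rewrite !ltr_int; clear; lia.
Qed.

Lemma induction_desubstitution :
  desubstitution induction_map (symbolic_shift P1 R1) (X0 R).
Proof.
apply: (@block_desubstitution R (lattice0 R) lattice1 'I_11 column unit bool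
  (@P0 R) (@R0 R) P1 R1 (@torus_generic R (lattice0 R)) (@torus_generic R lattice1)
  (fun=> tt) fst (fun=> 1%N) column_height (fun b _ h => b.2 (inord h))
  (fun q => torus_pi (lattice0 R) (base_rep q)) _ R0_action R1_action
  (@torus_generic_dense R _) (@torus_generic_dense R _) P0_open P1_open P0_disj
  R1_generic P1_cover) => //.
- by case.
- move=> b b' q gq bq bq'.
  have [_ c _] := P1_base_rep gq bq.
  have [_ c' _] := P1_base_rep (R1_generic _ gq) bq'.
  have [m e] := base_rep_R1_row gq; rewrite e /= in c'.
  by move: c c'; case: (b.1); case: (b'.1) => //; lra.
- move=> b q gq bq; have [m ->] := base_rep_R1_row gq.
  rewrite /R0 torus_add_pi; apply/torus_pi_eq/(box_latticeP (lattice0_gen1 R) (lattice0_gen2 R)).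
  by exists m, 0; congr (_, _) => /=; ring.
- move=> b q gq bq; have [m ->] := base_rep_R1_up gq bq.
  rewrite /R0 torus_add_pi; apply/torus_pi_eq/(box_latticeP (lattice0_gen1 R) (lattice0_gen2 R)).
  (* Leaving through the top subtracts (1, phi + 3) once. *)
  exists m, (-1); rewrite zR_z1 -pmulrn.
  by congr (_, _) => /=; rewrite intrN; ring.
- move=> b q i j gq bq; rewrite ltnS leqn0 => /eqP -> hj.
  have [_ _ Pv] := P1_base_rep gq bq.
  have j5 : (j < 5)%N by apply: leq_trans hj _; case: (b.1).
  have := Pv (inord j); rewrite /column_at inordK// hj /R0 torus_add_pi.
  rewrite -pmulrn; congr (P0 _ (torus_pi _ _)).
  by congr (_, _); rewrite /= addr0.
move=> p [w0 gw0 <-].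
have [w [gw hw <-]] := box_rep (lattice0_gen1 R) (lattice0_gen2 R) isT isT gw0.
move: hw; rewrite inside_rectangle => /andP[w1]; rewrite zR_zc => /andP[w2 w3].
have /andP[f1 f2] := phi_bounds R.
pose n := Num.floor w.2.
have n1 := Num.Theory.floor_le w.2; have n2 := Num.Theory.floorD1_gt w.2.
rewrite -/n intrD in n1 n2.
have n0 : 0 <= n by rewrite Num.Theory.floor_ge_int mulr0z ltW.
pose j := absz n; have jn : n = j%:Z by rewrite gez0_abs.
have gv : generic (w.1, w.2 - n%:~R).
  have := @generic_translate R z0 (zopp (zc n 0)) w gw.
  by rewrite zR_z0 addr0 zR_opp zR_nat.
have hv : inside (rectangle zf z1) (w.1, w.2 - n%:~R).
  rewrite inside_rectangle w1 zR_z1 /=; apply/andP; split; last lra.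
  rewrite lt_neqAle subr_ge0 n1 andbT eq_sym.
  by have [_] := generic_coord_neq0 gv.
have [b [hb bE]] := column_cover gv hv.
exists (torus_pi lattice1 (w.1, w.2 - n%:~R)), b, 0%N, j; split=> //.
- by exists (w.1, w.2 - n%:~R).
- by exists (w.1, w.2 - n%:~R).
- rewrite bE /=; have j5 : (j < 5)%N.
    have : n%:~R < 5%:~R :> R by lra.
    by rewrite ltr_int jn.
  (* On floor 4, y - 4 < phi - 1 = s, so the column has height 5. *)
  rewrite /column_height; case: ltP => // hs.
  rewrite ltn_neqAle -ltnS j5 andbT; apply/eqP => j4.
  by move: hs; rewrite jn j4 zR_zc; lra.
- rewrite base_rep_pi// /R0 torus_add_pi -/j; congr torus_pi.
  by rewrite [LHS]surjective_pairing; congr (_, _) => /=; rewrite ?addr0// jn subrK.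
Qed.

Lemma windowbT : windowb.
Proof. by vm_compute. Qed.

Lemma towerW1 : towerb true (rectangle zf z1) (zc 3 (-2)) (zc (-1) (-2)) zf z1 window_floors1 5.
Proof. by vm_compute. Qed.

Lemma towerW2 : towerb false (rectangle zf z1) zt zp1 z1 zt window_floors2 2.
Proof. by vm_compute. Qed.

Definition window_entry (b : 'I_19) (i j : nat) : column :=
  (column_class b i j,
   [ffun h : 'I_5 => if (h < column_height (column_class b i j))%N
                     then inord (column_letter b i j h) else ord0]).

Definition window_map : wordmap 'I_19 column :=
  block_morphism ord0 (classU true) (classU false) window_width window_height window_entry.

(** By [windowb], over each atom of [PU] a floor stays on one side of y = s and its vertical
    translates each stay in one atom of [P0]; so the floor lies in one atom of [P1]. *)
Lemma window_desubstitution : desubstitution window_map (XU R) (symbolic_shift P1 R2).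
Proof.
apply: (@tower_desubstitution R lattice1 zf z1 lattice1_gen1
  lattice1_gen2 isT isT _ _ z1 _ _ zt _ _ _ _ towerW1 towerW2
  _ _ _ R2_action).
- by move=> k v; rewrite /R2 torus_add_pi zR_z1 mul1r.
- exact: P1_open.
- by move=> b b' p; exact: P1_disj.
move=> b i j v hi hj gv hv.
have /allP h := windowbT.
have /allP/(_ i) := h b (etrans (mem_iota 0 19 b) (ltn_ord b)).
rewrite mem_iota => /(_ hi)/allP/(_ j); rewrite mem_iota => /(_ hj) {h}.
move=> /and3P[/maps_intoP box cls /allP lets].
have fl h : @apply_affine R (window_affine i j h) v =
    (zR (zc 3 (-2)) * v.1 + zR (nth z0 window_floors1 i),
     zR zt * v.2 + zR (nth z0 window_floors2 j) + h%:R).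
  by rewrite /window_affine /apply_affine zR_add zR_nat -pmulrn; congr (_, _); exact: addrA.
set w := (zR (zc 3 (-2)) * v.1 + _, _).
have w0 : @apply_affine R (window_affine i j 0) v = w by rewrite fl addr0.
exists w => //; split.
- by have := box _ _ hv; rewrite w0.
- move: cls; rewrite /window_entry [_.1]/=; case: ifP => [hc _|_ /orP[//|hc]].
    have := implied_gt0 hc hv; rewrite hval_pull w0 hval_strip zR_opp zR_z1 /coord.
    by lra.
  have := implied_gt0 hc hv; rewrite hval_pull w0 hval_opp hval_strip zR_opp zR_z1 /coord.
  by lra.
- move=> l; rewrite /column_at /= ffunE; case hl: (_ < _)%N => //.
  have lt11 : (column_letter b i j l < 11)%N by apply: lets; rewrite mem_iota.
  rewrite P0E; exists (w.1, w.2 + l%:R) => //=.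
  by rewrite inordK// -[(_, _)]fl; exact: (locateP (Ps := pieces0)).
Qed.

End FirstInduction.

(** * The chain of systems *)

(** Each coordinate of the reindexed family is a coordinate of the original one. *)
Lemma reindex_continuous (I : choiceType) (K : topologicalType) (g : I -> I) :
  continuous (fun x : {ptws I -> K} => (fun m => x (g m)) : {ptws I -> K}).
Proof.
move=> x; apply/cvg_sup; first (apply: fmap_filter; exact: (@nbhs_filter {ptws I -> K})).
move=> k U [V] [[W] oW <-] Wx WU.
have : nbhs (proj (g k) x) W by apply: open_nbhs_nbhs; split.
move=> /(@proj_continuous _ (fun _ : I => K) (g k) x).
by apply: (@filterS _ _ (@nbhs_filter {ptws I -> K} x)) => z Wz; exact: WU.
Qed.

Section Shear.
Variable A : finType.

Definition shear (x : config A) : config A := fun m => x (m.1 - m.2, m.2).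
Definition unshear (x : config A) : config A := fun m => x (m.1 + m.2, m.2).

Lemma shearK : cancel shear unshear.
Proof.
by move=> x; apply/funext => m; rewrite /unshear /shear /= addrK -surjective_pairing.
Qed.

Lemma unshearK : cancel unshear shear.
Proof.
by move=> x; apply/funext => m; rewrite /unshear /shear /= subrK -surjective_pairing.
Qed.

Lemma mul_shear11 k : mulZ2 shear11 k = (k.1 + k.2, k.2).
Proof. by rewrite /mulZ2 !mxE /= !mul1r mul0r add0r. Qed.

Lemma shear_shift k x :
  Defs.shift (mulZ2 shear11 k) (shear x) = shear (Defs.shift k x).
Proof.
apply/funext => m; rewrite mul_shear11 /shear /Defs.shift /=; congr (x _).
by congr (_, _) => /=; ring.
Qed.

End Shear.

Section Systems.
Variable R : realType.

Definition system1 : torus_system R := TorusSystem (R1_action R) (P1_partition R).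
Definition system2 : torus_system R := TorusSystem (R2_action R) (P1_partition R).

Lemma PU_partition : is_topological_partition (@PU R).
Proof.
exact: (atom_topological_partition (latticeZ2_gen1 R) (latticeZ2_gen2 R) isT isT
  (erefl : size piecesU = 19%N) piecesU_partition (@PUE R)).
Qed.

Definition systemU : torus_system R := TorusSystem (RU_action R) PU_partition.

(** By [R1_shear], the conditions for one action on a finite set are those for the other on the
    sheared set, with the same point of the torus. *)
Lemma shear_symbolic x :
  symbolic_shift (@P1 R) (@R2 R) x <-> symbolic_shift (@P1 R) (@R1 R) (shear x).
Proof.
split=> hx S fS.
  apply/(allowedP _ (R1_action R)).
  have /(allowedP _ (R2_action R))[p hp] :=
    hx [set (m.1 - m.2, m.2) | m in S] (finite_image _ fS).
  exists p => k Sk; have := hp (k.1 - k.2, k.2).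
  rewrite -R1_shear mul_shear11 /= subrK -surjective_pairing; apply.
  by exists k.
apply/(allowedP _ (R2_action R)).
have /(allowedP _ (R1_action R))[p hp] :=
  hx [set (m.1 + m.2, m.2) | m in S] (finite_image _ fS).
exists p => k Sk; have := hp (k.1 + k.2, k.2).
rewrite /shear /= addrK -surjective_pairing -R1_shear mul_shear11; apply.
by exists k.
Qed.

Lemma shear_conjugacy12 :
  shear_conjugacy shear11 (shift_of system2) (shift_of system1) (@shear column).
Proof.
split; last by move=> k x _; exact: shear_shift.
split; [split|split].
- by move=> x /shear_symbolic.
- by move=> x y _ _; exact: (can_inj (@shearK column)).
- move=> y hy; exists (unshear y); last exact: unshearK.
  by apply/shear_symbolic; rewrite unshearK.
- apply: continuous_subspaceT; exact: reindex_continuous.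
exists (@unshear column); split.
  by apply: continuous_subspaceT; exact: reindex_continuous.
by move=> x _; exact: shearK.
Qed.

Lemma id_conjugacy (A : finType) (X : set (config A)) : topological_conjugacy X X id.
Proof.
split=> //; split; first by split=> // y Xy; exists y.
split; first by apply: continuous_subspaceT => x; exact: cvg_id.
by exists id; split=> //; apply: continuous_subspaceT => x; exact: cvg_id.
Qed.

End Systems.

Lemma letterwise_id (A : finType) (X : set (config A)) : letterwise id @` X = X.
Proof.
rewrite -[RHS]image_id; congr (_ @` X).
Qed.

Unset Implicit Arguments.

(* Only the systems [S 1], ..., [S 10] matter. *)
Theorem theorem1p2 (R : realType) :
  exists S : nat -> torus_system R,
  [/\ (* (i) *)
      exists beta0 : wordmap (alphabet (S 1%N)) 'I_11,
        desubstitution beta0 (shift_of (S 1%N)) (X0 R),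
      (* (ii) *)
      exists beta1 : config (alphabet (S 2%N)) -> config (alphabet (S 1%N)),
        shear_conjugacy shear11 (shift_of (S 2%N)) (shift_of (S 1%N)) beta1,
      (* (iii) *)
      forall i : nat, (2 <= i <= 7)%N ->
        exists beta : wordmap (alphabet (S i.+1)) (alphabet (S i)),
          desubstitution beta (shift_of (S i.+1)) (shift_of (S i)),
      (* (iv) *)
      self_similar (shift_of (S 8%N)) /\
      exists (beta8 : wordmap (alphabet (S 9%N)) (alphabet (S 8%N)))
             (beta9 : wordmap (alphabet (S 10%N)) (alphabet (S 9%N)))
             (tau : alphabet (S 8%N) -> alphabet (S 10%N)),
        let omega := wcomp beta8 (wcomp beta9 (letter_map tau)) in
        [/\ bijective tau,
            desubstitution beta8 (shift_of (S 9%N)) (shift_of (S 8%N)),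
            desubstitution beta9 (shift_of (S 10%N)) (shift_of (S 9%N)),
            shift_of (S 10%N) = letterwise tau @` shift_of (S 8%N) &
            self_similarity omega (shift_of (S 8%N)) /\ primitive omega]
    & (* (v) *)
      [/\ is_subshift (shift_of (S 8%N)), is_subshift (XU R),
          exists f, topological_conjugacy (shift_of (S 8%N)) (XU R) f &
          exists zeta : 'I_19 -> alphabet (S 8%N),
            bijective zeta /\ letterwise zeta @` XU R = shift_of (S 8%N)]].
Proof.
have subU : is_subshift (XU R) by exact: symbolic_shift_subshift (RU_action R).
have idU : desubstitution (WordMap setT id) (XU R) (XU R).
  by apply: id_desubstitution; case: subU.
have selfU : self_similarity omega (XU R).
  by split; [exact: subU|exact: omega_expansive|exact: omega_desubstitution].
have bij_id : bijective (id : 'I_19 -> 'I_19) by exists id.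
exists (fun n => match n with
  1 => system1 R | 2 => system2 R | _ => systemU R end)%N.
split.
- by exists induction_map; exact: induction_desubstitution.
- by exists (@shear column); exact: shear_conjugacy12.
- case=> [//|[//|[|n]]] _; last by exists (WordMap setT id).
  by exists window_map; exact: window_desubstitution.
- split; first by exists omega.
  (* Systems 8, 9 and 10 coincide, so one factor carries the whole self-similarity. *)
  exists (WordMap setT id), omega, id => /=.
  have -> : wcomp (WordMap setT id) (wcomp omega (letter_map id)) = omega.
    have idw (w : word 'I_19) : map_word id w = w.
      by case: w => m n w; rewrite /map_word /=; congr Word; apply/matrixP => i j; rewrite mxE.
    rewrite /wcomp /letter_map /omega /block_morphism /=; congr WordMap.
      by apply/seteqP; split=> w /=; rewrite idw; [case=> -[_]|move=> cw; split].
    by apply/funext => w; rewrite idw.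
  split=> //; first exact: omega_desubstitution.
    by rewrite letterwise_id.
  by split=> //; exact: omega_primitive.
split=> //; first by exists id; exact: id_conjugacy.
by exists id; split=> //; rewrite letterwise_id.
Qed.
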